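(* Let $p>2$ be a prime, $f\ge 1$, $q=p^f$, and let $k=(k_0,\dots,k_{f-1})$ with $r_i=k_i-2>q+p-2$ for all $0\le i\le f-1$. Put $r=r_0+r_1p+\cdots+r_{f-1}p^{f-1}$ and assume $r\equiv 0 \pmod{q-1}$. Let $a_p$ lie in a finite extension $E$ of $\mathbb{Q}_{p^f}$ with $v(a_p)\in(0,1)$. Then the natural surjection $\mathrm{ind}_{KZ}^G\mathbb{1}\twoheadrightarrow \bar\Theta_{k,a_p}$ (described in the context) vanishes on $T(\mathrm{ind}_{KZ}^G\mathbb{1})$, i.e. it factors through $\mathrm{ind}_{KZ}^G\mathbb{1}/T$. In particular, $\bar\Theta_{k,a_p}$ is a quotient of a universal supersingular representation $\mathrm{ind}_{KZ}^G\mathbb{1}/T(\mathrm{ind}_{KZ}^G\mathbb{1})$.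
   Context: Notation: $\mathbb{Q}_{p^f}$ is the unramified extension of $\mathbb{Q}_p$ of degree $f$, $\mathbb{Z}_{p^f}$ its ring of integers, $\mathbb{F}_q$ its residue field; $[\lambda]$ denotes the Teichmüller lift of $\lambda\in\mathbb{F}_q$. $G=\mathrm{GL}_2(\mathbb{Q}_{p^f})$, $K=\mathrm{GL}_2(\mathbb{Z}_{p^f})$, $Z$ the center of $G$, $v$ the $p$-adic valuation with $v(p)=1$. For a ring $R\supseteq\mathbb{Z}_{p^f}$ (or $R=\bar{\mathbb F}_p$), $V(R)=\bigotimes_{i=0}^{f-1}\mathrm{Sym}^{r_i}R^2$ is realized as polynomials in $X_0,Y_0,\dots,X_{f-1},Y_{f-1}$ homogeneous of degree $r_i$ in $(X_i,Y_i)$; $\begin{pmatrix}a&b\\c&d\end{pmatrix}\in K$ acts by $v\mapsto v(a^{\sigma^i}X_i+c^{\sigma^i}Y_i,\,b^{\sigma^i}X_i+d^{\sigma^i}Y_i)$ ($\sigma$ the Frobenius), and the scalar $p\in Z$ acts trivially. For a $KZ$-representation $W$, $\mathrm{ind}_{KZ}^GW$ is compact induction and $[g,w]$ is the function supported on $KZg^{-1}$ with $g'\mapsto g'g\cdot w$. The Hecke operator $T$ on $\mathrm{ind}_{KZ}^GV(R)$ is the $G$-equivariant map $T([g,v])=\sum_{\lambda\in\mathbb{F}_q}\big[g\begin{pmatrix}p&[\lambda]\\0&1\end{pmatrix},\,v(X_i,(-[\lambda])^{p^i}X_i+pY_i)\big]+\big[g\begin{pmatrix}1&0\\0&p\end{pmatrix},\,v(pX_i,Y_i)\big]$,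 the substitutions being made for every $i=0,\dots,f-1$. Let $\mathcal O_E$, $k_E$ be the ring of integers and residue field of $E$. Define $\Pi_{k,a_p}=\mathrm{ind}_{KZ}^GV(E)/(T-a_p)$, $\Theta_{k,a_p}$ = image of $\mathrm{ind}_{KZ}^GV(\mathcal O_E)$ in $\Pi_{k,a_p}$, and $\bar\Theta_{k,a_p}=\Theta_{k,a_p}\otimes_{\mathcal O_E}k_E$; there is a natural surjection $\mathrm{ind}_{KZ}^GV_r\twoheadrightarrow\bar\Theta_{k,a_p}$ where $V_r=V(\bar{\mathbb F}_p)$ (a representation of $\Gamma=\mathrm{GL}_2(\mathbb F_q)$, hence of $KZ$). Let $\theta_i=X_iY_{i-1}^p-Y_iX_{i-1}^p$ (indices mod $f$), $V_r^*\subseteq V_r$ the subspace of elements $\sum_i\theta_iP_i$ with $P_i$ polynomials, $X_r$ the $\Gamma$-submodule of $V_r$ generated by $X_0^{r_0}\cdots X_{f-1}^{r_{f-1}}$, and $Q=V_r/(V_r^*+X_r)$. Under the hypotheses, $\mathrm{ind}_{KZ}^G(V_r^*+X_r)$ lies in the kernel of $\mathrm{ind}V_r\to\bar\Theta_{k,a_p}$ and $Q$ is the trivial one-dimensional representation $\mathbb 1$, giving the surjection $\mathrm{ind}_{KZ}^G\mathbb 1\twoheadrightarrow\bar\Theta_{k,a_p}$. On $\mathrm{ind}_{KZ}^G\sigma$ for a weight $\sigma=\bigotimes\mathrm{Sym}^{s_i}\bar{\mathbb F}_p^2\otimes\det^m$, $T$ denotes the mod $p$ Hecke operator $T([g,v])=\sum_{\lambda}[g\begin{pmatrix}p&[\lambda]\\0&1\end{pmatrix},v(X_i,(-\lambda)^{p^i}X_i)]+[g\begin{pmatrix}1&0\\0&p\end{pmatrix},v(0,Y_i)]$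 (the reduction of the formula above). *)

(* Defs.v *)
From HB Require Import structures.
From mathcomp Require Import all_boot all_order all_algebra all_fingroup all_field.
From mathcomp Require Import generic_quotient ring_quotient.
From mathcomp Require Import boolp classical_sets functions finmap.
From mathcomp Require monalg.
From mathcomp Require Import mpoly.

Set Implicit Arguments.
Unset Strict Implicit.
Unset Printing Implicit Defensive.

Import Order.TTheory GRing.Theory Num.Theory.
Local Open Scope ring_scope.
Local Open Scope quotient_scope.

Section ModuleQuotient.
Variables (R : nzRingType) (V : lmodType R).

(* The submodule generated by A. *)
Definition span_of (A : V -> Prop) : {pred V} := fun x =>
  `[< forall S : V -> Prop, S 0 ->
      (forall (a : R) u v, S u -> S v -> S (a *: u + v)) ->
      (forall u, A u -> S u) -> S x >].

Variable A : V -> Prop.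

Lemma span_of_gen x : A x -> x \in span_of A.
Proof. by move=> Ax; apply/asboolP => S _ _; apply. Qed.

Lemma span_of_submod : submod_closed (span_of A).
Proof.
split; first by apply/asboolP => S S0.
move=> a u v /asboolP Su /asboolP Sv; apply/asboolP => S S0 SL SA.
exact: SL (Su S S0 SL SA) (Sv S S0 SL SA).
Qed.

HB.instance Definition _ :=
  GRing.isSubmodClosed.Build R V (span_of A) (GRing.submod_closed_semi span_of_submod).
Definition span_closed : zmodClosed V := span_of A.

Definition lquot : Type := Quotient.quot span_closed.
HB.instance Definition _ := GRing.Zmodule.on lquot.

Definition lpi (x : V) : lquot := \pi_(Quotient.quot span_closed) x.

Lemma lpi_eq x y : (lpi x == lpi y) = (x - y \in span_of A).
Proof. by rewrite Quotient.idealrBE. Qed.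

Lemma lpiP (u : lquot) : exists x, u = lpi x.
Proof. by exists (repr (u : Quotient.quot span_closed)); rewrite /lpi reprK. Qed.

Fact lpiB : zmod_morphism lpi.
Proof. by move=> x y; rewrite /lpi raddfB. Qed.
HB.instance Definition _ := GRing.isZmodMorphism.Build V lquot lpi lpiB.

Definition lscale (a : R) (u : lquot) : lquot :=
  lpi (a *: repr (u : Quotient.quot span_closed)).

Lemma lscale_pi a x : lscale a (lpi x) = lpi (a *: x).
Proof.
apply/eqP; rewrite lpi_eq -scalerBr.
apply: rpredZ; rewrite -lpi_eq; apply/eqP.
by rewrite /lpi reprK.
Qed.

Fact lscaleA a b u : lscale a (lscale b u) = lscale (a * b) u.
Proof. by case: (lpiP u) => x ->; rewrite !lscale_pi scalerA. Qed.
Fact lscale1 : left_id 1 lscale.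
Proof. by move=> u; case: (lpiP u) => x ->; rewrite lscale_pi scale1r. Qed.
Fact lscaleDr : right_distributive lscale +%R.
Proof.
move=> a u v; case: (lpiP u) => x ->; case: (lpiP v) => y ->.
by rewrite -raddfD !lscale_pi scalerDr raddfD.
Qed.
Fact lscaleDl u : {morph lscale^~ u : a b / a + b}.
Proof.
by move=> a b; case: (lpiP u) => x ->; rewrite !lscale_pi scalerDl raddfD.
Qed.
HB.instance Definition _ := GRing.Zmodule_isLmodule.Build R lquot
  lscaleA lscale1 lscaleDr lscaleDl.

Fact lpiZ : scalable lpi.
Proof. by move=> a x; rewrite -lscale_pi. Qed.
HB.instance Definition _ := GRing.isScalable.Build R V lquot *:%R lpi lpiZ.

End ModuleQuotient.

Record rep (R : nzRingType) (G : groupType) := Rep {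
  rep_car :> lmodType R;
  ract : G -> rep_car -> rep_car;
  ract_linear : forall g, linear (ract g);
  ract1 : forall x, ract 1%g x = x;
  ractM : forall g h x, ract (g * h)%g x = ract g (ract h x) }.

Section RepTheory.
Variables (R : nzRingType) (G : groupType) (M : rep R G).
HB.instance Definition _ g :=
  GRing.isLinear.Build R M M *:%R (@ract R G M g) (@ract_linear R G M g).
End RepTheory.

Record rep_hom (R : nzRingType) (G : groupType) (M N : rep R G) := RepHom {
  hom_fun :> {linear M -> N};
  hom_act : forall g x, hom_fun (ract g x) = ract g (hom_fun x) }.

Section QuotientRep.
Variables (R : nzRingType) (G : groupType) (M : rep R G) (A : M -> Prop).
Hypothesis stabA : forall g x, A x -> A (ract g x).

Definition qact (g : G) (u : lquot A) : lquot A :=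
  lpi A (ract g (repr (u : Quotient.quot (span_closed A)))).

Lemma span_of_act g x : x \in span_of A -> ract g x \in span_of A.
Proof.
move=> /asboolP Sx; apply/asboolP => S S0 SL SA.
apply: (Sx (fun x => S (ract g x))) => [|a u v Su Sv|u Au].
- by rewrite linear0.
- by rewrite linearP; apply: SL.
- by apply/SA/stabA.
Qed.

Lemma qact_pi g x : qact g (lpi A x) = lpi A (ract g x).
Proof.
apply/eqP; rewrite lpi_eq -linearB; apply: span_of_act.
by rewrite -lpi_eq /lpi reprK.
Qed.

Fact qact_linear g : linear (qact g).
Proof.
move=> a u v; case: (lpiP u) => x ->; case: (lpiP v) => y ->.
by rewrite -linearP !qact_pi !linearP.
Qed.
Fact qact1 u : qact 1%g u = u.
Proof. by case: (lpiP u) => x ->; rewrite qact_pi ract1. Qed.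
Fact qactM g h u : qact (g * h)%g u = qact g (qact h u).
Proof. by case: (lpiP u) => x ->; rewrite !qact_pi ractM. Qed.

Definition quot_rep : rep R G := Rep qact_linear qact1 qactM.

Definition quot_pi : rep_hom M quot_rep :=
  @RepHom R G M quot_rep (lpi A : {linear _ -> _})
    (fun g x => esym (qact_pi g x)).
End QuotientRep.

Section CompactInduction.
Variables (R : nzRingType) (G : groupType) (S : pred G) (H : subGroupType S).
Variable (W : rep R H).

(* Compactness of the support modulo H is finiteness of the set of cosets H h
   that it meets; no topology is put on G as H is open in the application. *)
Definition in_ind : pred (G -> W) := fun f =>
  `[< (forall (k : H) g, f (val k * g)%g = ract k (f g)) /\
      exists s : seq G, forall g, f g <> 0 ->
        exists2 h, h \in s & exists k : H, g = (val k * h)%g >].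

Lemma in_ind_submod : submod_closed in_ind.
Proof.
split.
  apply/asboolP; split=> [k g|]; first by rewrite -[RHS]/(ract k 0) linear0.
  by exists [::].
move=> a u v /asboolP[uE [su Hu]] /asboolP[vE [sv Hv]].
apply/asboolP; split=> [k g|].
  rewrite -[LHS]/(a *: u (val k * g)%g + v (val k * g)%g) uE vE.
  by rewrite -[RHS]/(ract k (a *: u g + v g)) linearP.
exists (su ++ sv) => g; rewrite -[(_ + _) g]/(a *: u g + v g) => nz.
have [u0|nzu] := eqVneq (u g) 0; last first.
  have [h hs Hh] := Hu g (elimN eqP nzu); exists h => //.
  by rewrite mem_cat hs.
have [h hs Hh] : exists2 h, h \in sv & exists k : H, g = (val k * h)%g.
  by apply: Hv => v0; apply: nz; rewrite u0 v0 scaler0 addr0.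
by exists h => //; rewrite mem_cat hs orbT.
Qed.
HB.instance Definition _ := GRing.isSubmodClosed.Build R (G -> W) in_ind
  (GRing.submod_closed_semi in_ind_submod).

Record ind_car : Type := IndCar { ind_fun :> G -> W; _ : in_ind ind_fun }.
HB.instance Definition _ := [isSub for ind_fun].
HB.instance Definition _ := [Choice of ind_car by <:].
HB.instance Definition _ := [SubChoice_isSubLmodule of ind_car by <:].

Definition ind_shift (g : G) (f : G -> W) : G -> W := fun h => f (h * g)%g.

Lemma ind_shift_in g (f : ind_car) : in_ind (ind_shift g f).
Proof.
case: f => f /= /asboolP[fE [s Hs]]; apply/asboolP; split=> [k h|].
  by rewrite /ind_shift -mulgA fE.
exists [seq (h * g^-1)%g | h <- s] => h /Hs[h' hs [k Hk]].
exists (h' * g^-1)%g; first exact: map_f.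
by exists k; rewrite mulgA -Hk mulgK.
Qed.

Definition ind_act g (f : ind_car) : ind_car := IndCar (ind_shift_in g f).

Fact ind_act_linear g : linear (ind_act g).
Proof. by move=> a u v; apply: val_inj; apply: funext. Qed.
Fact ind_act1 f : ind_act 1%g f = f.
Proof. by apply: val_inj; apply: funext => h; rewrite /= /ind_shift mulg1. Qed.
Fact ind_actM g h f : ind_act (g * h)%g f = ind_act g (ind_act h f).
Proof. by apply: val_inj; apply: funext => x; rewrite /= /ind_shift mulgA. Qed.

Definition ind : rep R G := Rep ind_act_linear ind_act1 ind_actM.

Definition ind_elem_fun (g : G) (w : W) : G -> W := fun g' =>
  if insub (g' * g)%g is Some k then ract (k : H) w else 0.

Lemma ind_elem_in g w : in_ind (ind_elem_fun g w).
Proof.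
apply/asboolP; split=> [k g'|].
  rewrite /ind_elem_fun -mulgA; case: (insubP H (g' * g)%g) => [u Su uE|nS].
    have Sk : S (val (k * u)%g) by apply: valP.
    rewrite -uE -valM insubT -ractM; congr (ract _ _).
    by apply: val_inj; rewrite SubK.
  rewrite insubF ?linear0 //; apply/negbTE.
  apply: contra nS => Skg; pose u : H := Sub _ Skg.
  have <- : val (k^-1 * u)%g = (g' * g)%g; last exact: valP.
  by rewrite valM SubK [LHS]mulgA -valM mulVg val1 mul1g.
exists [:: g^-1%g] => g' nz; exists g^-1%g; first by rewrite mem_head.
move: nz; rewrite /ind_elem_fun; case: insubP => [u Su uE _|] //.
by exists u; rewrite uE mulgK.
Qed.

(* The function [g, w]. *)
Definition ind_elem g w : ind := IndCar (ind_elem_in g w).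

End CompactInduction.

Section InductionFunctor.
Variables (R : nzRingType) (G : groupType) (S : pred G) (H : subGroupType S).
Variables (W W' : rep R H) (e : rep_hom W W').

Lemma ind_comp_in (f : ind W) : in_ind (e \o (f : ind_car W)).
Proof.
case: f => f /= /asboolP[fE [s Hs]]; apply/asboolP; split=> [k g|].
  by rewrite /= fE hom_act.
by exists s => g /= nz; apply: Hs => f0; apply: nz; rewrite f0 linear0.
Qed.
Definition ind_comp (f : ind W) : ind W' := IndCar (ind_comp_in f).

Fact ind_comp_linear : linear ind_comp.
Proof.
move=> a u v; apply: val_inj; apply: funext => h /=.
by rewrite -[LHS]/(e (a *: (u : ind_car W) h + (v : ind_car W) h)) linearP.
Qed.
HB.instance Definition _ :=
  GRing.isLinear.Build R (ind W) (ind W') *:%R ind_comp ind_comp_linear.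
Fact ind_comp_act g f : ind_comp (ract g f) = ract g (ind_comp f).
Proof. exact: val_inj. Qed.
Definition ind_map : rep_hom (ind W) (ind W') := RepHom ind_comp_act.

End InductionFunctor.

Section ExtensionOfScalars.
Import monalg.
(* Theta is a subset of an E-linear representation M, stable under addition, the
   scalars in the subring O of E, and G; red restricts to a ring morphism from
   O to k.  The tensor product of Theta with k over O is presented as the free
   k-module on Theta modulo the bilinearity relations. *)
Variables (E k : fieldType) (O : pred E) (red : E -> k).
Variables (G : groupType) (M : rep E G) (Theta : M -> Prop).
Hypothesis stabT : forall g x, Theta x -> Theta (ract g x).

Definition lattice : choiceType := {x : M | `[< Theta x >]}.

Definition tens_rel (m : (monalg.malg lattice k)) : Prop :=
  (exists x y z : lattice, sval z = sval x + sval y /\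
     m = monalg.mkmalgU z 1 - monalg.mkmalgU x 1 - monalg.mkmalgU y 1) \/
  (exists (a : E) (x z : lattice), [/\ O a, sval z = a *: sval x &
     m = monalg.mkmalgU z 1 - red a *: monalg.mkmalgU x 1]).

Definition lattice_act (g : G) (x : lattice) : lattice :=
  exist _ (ract g (sval x)) (introT (asboolP _) (stabT g (elimT (asboolP _) (svalP x)))).

Definition malg_act (g : G) (m : (monalg.malg lattice k)) : (monalg.malg lattice k) :=
  \sum_(x <- monalg.msupp m) monalg.mcoeff x m *: monalg.mkmalgU (lattice_act g x) 1.

Lemma malg_actE g m (D : {fset lattice}) : (monalg.msupp m `<=` D)%fset ->
  malg_act g m =
    \sum_(x <- D) monalg.mcoeff x m *: monalg.mkmalgU (lattice_act g x) 1.
Proof.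
move=> sD; rewrite /malg_act; apply: big_fset_incl => // x _.
by move/monalg.mcoeff_outdom ->; rewrite scale0r.
Qed.

Fact malg_act_linear g : linear (malg_act g).
Proof.
move=> a u v; pose D := (monalg.msupp u `|` monalg.msupp v)%fset.
rewrite (@malg_actE g u D) ?fsubsetUl // (@malg_actE g v D) ?fsubsetUr //.
rewrite (@malg_actE g (a *: u + v) D).
  rewrite scaler_sumr -big_split; apply: eq_bigr => x _ /=.
  by rewrite monalg.mcoeffD monalg.mcoeffZ scalerDl scalerA.
apply: fsubset_trans (monalg.msuppD_le _ _) _.
by apply: fsetSU; apply: monalg.msuppZ_le.
Qed.
HB.instance Definition _ g := GRing.isLinear.Build k (monalg.malg lattice k)
  (monalg.malg lattice k) *:%R (malg_act g) (malg_act_linear g).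

Lemma malg_actU g x : malg_act g (monalg.mkmalgU x 1) = monalg.mkmalgU (lattice_act g x) 1.
Proof.
rewrite (@malg_actE g _ [fset x]%fset) ?big_seq_fset1 ?monalg.mcoeffUU ?scale1r //.
exact: monalg.msuppU_le.
Qed.

Lemma malg_expand (m : (monalg.malg lattice k)) :
  m = \sum_(x <- monalg.msupp m) monalg.mcoeff x m *: monalg.mkmalgU x 1.
Proof.
rewrite {1}[m]monalg.monalgE; apply: eq_bigr => x _.
apply/monalg.malgP => y.
by rewrite monalg.mcoeffZ !monalg.mcoeffU; case: eqP; rewrite ?mulr1 ?mulr0.
Qed.

Lemma lattice_act1 x : lattice_act 1%g x = x.
Proof. by apply: val_inj; rewrite /= ract1. Qed.
Lemma lattice_actM g h x :
  lattice_act (g * h)%g x = lattice_act g (lattice_act h x).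
Proof. by apply: val_inj; rewrite /= ractM. Qed.

Fact malg_act1 m : malg_act 1%g m = m.
Proof.
rewrite [RHS]malg_expand; apply: eq_bigr => x _.
by rewrite lattice_act1.
Qed.
Fact malg_actM g h m : malg_act (g * h)%g m = malg_act g (malg_act h m).
Proof.
rewrite [malg_act h m]/malg_act linear_sum; apply: eq_bigr => x _.
by rewrite linearZ /= malg_actU lattice_actM.
Qed.

Definition malg_rep : rep k G := Rep malg_act_linear malg_act1 malg_actM.

Lemma tens_rel_stable g (m : malg_rep) : tens_rel m -> tens_rel (ract g m).
Proof.
case=> [[x [y [z [zE ->]]]]|[a [x [z [Oa zE ->]]]]].
  left; exists (lattice_act g x), (lattice_act g y), (lattice_act g z); split.
    by rewrite /= zE linearD.
  by rewrite !linearB /= !malg_actU.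
right; exists a, (lattice_act g x), (lattice_act g z); split=> //.
  by rewrite /= zE linearZ.
by rewrite linearB linearZ /= !malg_actU.
Qed.

Definition tens_rep : rep k G := quot_rep tens_rel_stable.

Definition tens (x : lattice) (c : k) : tens_rep :=
  lpi tens_rel (c *: monalg.mkmalgU x 1).

End ExtensionOfScalars.

Section Polynomials.
Variables (f : nat) (R : comNzRingType).
Implicit Types (r : 'I_f -> nat) (N : 'I_f -> 'M[R]_2).

Definition varX (i : 'I_f) : {mpoly R[f + f]} := 'X_(lshift f i).
Definition varY (i : 'I_f) : {mpoly R[f + f]} := 'X_(rshift f i).

Definition multihom r : {pred {mpoly R[f + f]}} := fun P =>
  all (fun m : 'X_{1..f + f} =>
         [forall i, m (lshift f i) + m (rshift f i) == r i]%N) (msupp P).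

Lemma multihomP r P : reflect
  (forall m, m \in msupp P -> forall i, (m (lshift f i) + m (rshift f i))%N = r i)
  (P \in multihom r).
Proof.
apply: (iffP allP) => H m mP; first by move=> i; apply/eqP/(forallP (H m mP)).
by apply/forallP => i; rewrite H.
Qed.

Lemma multihom_submod r : submod_closed (multihom r).
Proof.
split; first by apply/multihomP => m; rewrite msupp0.
move=> a P Q /multihomP hP /multihomP hQ; apply/multihomP => m.
by move/msuppD_le; rewrite mem_cat => /orP[/msuppZ_le/hP|/hQ].
Qed.
HB.instance Definition _ r := GRing.isSubmodClosed.Build R {mpoly R[f + f]}
  (multihom r) (GRing.submod_closed_semi (multihom_submod r)).

Record Vpoly r : Type := VPoly { Vval :> {mpoly R[f + f]}; _ : Vval \in multihom r }.
HB.instance Definition _ r := [isSub for @Vval r].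
HB.instance Definition _ r := [Choice of Vpoly r by <:].
HB.instance Definition _ r := [SubChoice_isSubLmodule of Vpoly r by <:].

(* The substitution (X_i, Y_i) := (X_i, Y_i) *m N_i for all i, that is
   X_i := a X_i + c Y_i and Y_i := b X_i + d Y_i when N_i = (a b ; c d). *)
Definition msubst_var N (l : 'I_(f + f)) : {mpoly R[f + f]} :=
  match fintype.split l with
  | inl i => N i 0 0 *: varX i + N i 1 0 *: varY i
  | inr i => N i 0 1 *: varX i + N i 1 1 *: varY i
  end.
Definition msubst N (P : {mpoly R[f + f]}) : {mpoly R[f + f]} :=
  P \mPo [tuple msubst_var N l | l < f + f].

Lemma multihom_ext r r' P : r =1 r' -> P \in multihom r -> P \in multihom r'.
Proof. by move=> e /multihomP h; apply/multihomP => m /h H i; rewrite -e. Qed.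

Lemma multihom1 : 1 \in multihom (fun=> 0%N).
Proof.
apply/multihomP => m; rewrite -mpolyX0 => /mem_msuppXP <- i.
by rewrite !mnm0E.
Qed.

Lemma multihomM r r' P P' : P \in multihom r -> P' \in multihom r' ->
  P * P' \in multihom (fun i => r i + r' i)%N.
Proof.
move=> /multihomP h /multihomP h'; apply/multihomP => m /msuppM_le.
by case/allpairsP => -[m1 m2] /= [m1P m2P ->] i; rewrite !mnmDE addnACA h ?h'.
Qed.

Lemma multihomX r P n : P \in multihom r ->
  P ^+ n \in multihom (fun i => n * r i)%N.
Proof.
move=> h; elim: n => [|n ih].
  by apply: multihom_ext multihom1 => i; rewrite mul0n.
by rewrite exprS; apply: multihom_ext (multihomM h ih) => i; rewrite mulSn.
Qed.

Lemma multihom_prod (I : Type) (s : seq I) (d : I -> 'I_f -> nat) F :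
  (forall j, F j \in multihom (d j)) ->
  \prod_(j <- s) F j \in multihom (fun i => \sum_(j <- s) d j i)%N.
Proof.
move=> h; elim: s => [|j s ih].
  by rewrite big_nil; apply: multihom_ext multihom1 => i; rewrite big_nil.
rewrite big_cons; apply: multihom_ext (multihomM (h j) ih) => i.
by rewrite big_cons.
Qed.

Definition var_index (l : 'I_(f + f)) : 'I_f :=
  match fintype.split l with inl i => i | inr i => i end.

Lemma multihom_var l : 'X_l \in multihom (fun i => (var_index l == i) : nat).
Proof.
apply/multihomP => m /mem_msuppXP <- i; rewrite !mnm1E /var_index.
case: (splitP l) => j e.
  have -> : l = lshift f j by apply: val_inj.
  by rewrite (inj_eq (@lshift_inj _ _)) eq_lrshift addn0.
have -> : l = rshift f j by apply: val_inj.
by rewrite (inj_eq (@rshift_inj _ _)) eq_rlshift add0n.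
Qed.

Lemma msubst_var_multihom N l :
  msubst_var N l \in multihom (fun i => (var_index l == i) : nat).
Proof.
have hX i : varX i \in multihom (fun i' => (i == i') : nat).
  apply: multihom_ext (multihom_var (lshift f i)) => i'.
  by rewrite /var_index (unsplitK (inl i)).
have hY i : varY i \in multihom (fun i' => (i == i') : nat).
  apply: multihom_ext (multihom_var (rshift f i)) => i'.
  by rewrite /var_index (unsplitK (inr i)).
by rewrite /msubst_var /var_index; case: (fintype.split l) => i;
  apply: rpredD; apply: rpredZ.
Qed.

Lemma sum_var_index (m : 'X_{1..f + f}) i :
  (\sum_l m l * (var_index l == i) = m (lshift f i) + m (rshift f i))%N.
Proof.
rewrite big_split_ord /= (bigD1 i) //= [X in (_ + X)%N](bigD1 i) //=.
rewrite /var_index (unsplitK (inl i)) (unsplitK (inr i)) eqxx !muln1.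
rewrite !big1 ?addn0 // => j /negbTE ne.
  by rewrite (unsplitK (inr j)) ne muln0.
by rewrite (unsplitK (inl j)) ne muln0.
Qed.

Lemma msubst_multihom r N P : P \in multihom r -> msubst N P \in multihom r.
Proof.
move=> /multihomP h; rewrite /msubst comp_mpolyEX big_seq.
apply: rpred_sum => m mP; apply: rpredZ; rewrite comp_mpolyX.
have := multihom_prod (index_enum 'I_(f + f))
  (fun l => multihomX (m l) (msubst_var_multihom N l)).
under eq_bigr do rewrite -[msubst_var N _](tnth_mktuple (msubst_var N)).
apply: multihom_ext => i; rewrite -(h m mP i) -sum_var_index.
exact: eq_bigr.
Qed.

Definition Vsubst r N (P : Vpoly r) : Vpoly r :=
  VPoly (msubst_multihom N (valP P)).

Fact msubst_linear N : linear (msubst N).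
Proof. by move=> a P Q; rewrite /msubst linearP. Qed.
HB.instance Definition _ N := GRing.isLinear.Build R {mpoly R[f + f]}
  {mpoly R[f + f]} *:%R (msubst N) (msubst_linear N).

Lemma msubst_varX N i : msubst N (varX i) = N i 0 0 *: varX i + N i 1 0 *: varY i.
Proof.
rewrite /msubst /varX comp_mpolyXU -tnth_nth tnth_mktuple /msubst_var.
by rewrite (unsplitK (inl i)).
Qed.
Lemma msubst_varY N i : msubst N (varY i) = N i 0 1 *: varX i + N i 1 1 *: varY i.
Proof.
rewrite /msubst /varY comp_mpolyXU -tnth_nth tnth_mktuple /msubst_var.
by rewrite (unsplitK (inr i)).
Qed.

Lemma msubst1 P : msubst (fun=> 1%:M) P = P.
Proof.
rewrite -[RHS]comp_mpoly_id /msubst; congr (_ \mPo _).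
apply: eq_from_tnth => l; rewrite !tnth_mktuple /msubst_var.
case: (splitP l) => i e; rewrite !mxE /= !scale1r !scale0r ?addr0 ?add0r.
  by congr 'X_[U_(_)]; apply: val_inj.
by congr 'X_[U_(_)]; apply: val_inj.
Qed.

Lemma mx22E (A B : 'M[R]_2) i j : (A *m B) i j = A i 0 * B 0 j + A i 1 * B 1 j.
Proof. by rewrite !mxE !big_ord_recl big_ord0 addr0 -(_ : 1 = lift _ _) //; apply: val_inj. Qed.

Lemma msubst_comp N N' P :
  msubst N (msubst N' P) = msubst (fun i => N i *m N' i) P.
Proof.
rewrite [msubst N' P]comp_mpolyEX linear_sum [RHS]comp_mpolyEX.
apply: eq_bigr => m _; rewrite linearZ /= !comp_mpolyX.
congr (_ *: _); rewrite /msubst rmorph_prod /=; apply: eq_bigr => l _.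
rewrite rmorphXn /= !tnth_mktuple.
congr (_ ^+ _); rewrite -/(msubst N _) /msubst_var.
by case: (fintype.split l) => i; rewrite linearD !linearZ /= msubst_varX msubst_varY;
  rewrite !mx22E !scalerDr !scalerDl !scalerA addrACA ![_ * N' _ _ _]mulrC.
Qed.

End Polynomials.

Section Valuations.
Variables (F : fieldType) (v : F -> rat).

(* v is only meaningful on nonzero elements; v 0 = +oo is built into v_ge. *)
Definition is_valuation : Prop :=
  (forall x y, x != 0 -> y != 0 -> v (x * y) = v x + v y) /\
  (forall x y, x != 0 -> y != 0 -> x + y != 0 ->
     Num.min (v x) (v y) <= v (x + y)).

Definition v_ge (N : rat) (x : F) : bool := (x == 0) || (N <= v x).
Definition v_int (x : F) : bool := v_ge 0 x.
Definition v_max (x : F) : bool := (x == 0) || (0 < v x).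

Definition v_complete : Prop := forall u : nat -> F,
  (forall N : nat, exists n0, forall m n, (n0 <= m)%N -> (n0 <= n)%N ->
     v_ge N%:R (u m - u n)) ->
  exists l, forall N : nat, exists n0, forall n, (n0 <= n)%N -> v_ge N%:R (u n - l).

Definition int_morph (R : nzRingType) (j : F -> R) : Prop :=
  [/\ j 1 = 1,
      forall x y, v_int x -> v_int y -> j (x + y) = j x + j y &
      forall x y, v_int x -> v_int y -> j (x * y) = j x * j y].

(* k is an extension of the residue field of v, by means of j. *)
Definition residue_morph (k : fieldType) (j : F -> k) : Prop :=
  int_morph j /\ forall x, v_int x -> (j x = 0 <-> v_max x).

Hypothesis val_v : is_valuation.

Lemma v1 : v 1 = 0.
Proof.
have [vM _] := val_v; have := vM 1 1 (oner_neq0 _) (oner_neq0 _).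
by rewrite mulr1 -{1}[v 1]addr0 => /addrI.
Qed.
Lemma vN1 : v (-1) = 0.
Proof.
have [vM _] := val_v; have nz : (-1 : F) != 0 by rewrite oppr_eq0 oner_neq0.
have := vM _ _ nz nz; rewrite mulrNN mulr1 v1 => /esym/eqP.
by rewrite -mulr2n mulrn_eq0 => /eqP.
Qed.
Lemma v_intM x y : v_int x -> v_int y -> v_int (x * y).
Proof.
rewrite /v_int /v_ge mulf_eq0.
have [//|nx] := eqVneq x 0; have [//|ny] := eqVneq y 0 => /= hx hy.
by rewrite (proj1 val_v) // addr_ge0.
Qed.
Lemma v_intD x y : v_int x -> v_int y -> v_int (x + y).
Proof.
rewrite /v_int /v_ge.
have [->|nx] := eqVneq x 0; first by rewrite add0r.
have [->|ny] := eqVneq y 0; first by rewrite addr0 (negbTE nx).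
have [//|nxy] := eqVneq (x + y) 0 => /= hx hy.
by apply: le_trans (proj2 val_v _ _ nx ny nxy); rewrite le_min hx.
Qed.
Lemma v_int1 : v_int 1. Proof. by rewrite /v_int /v_ge v1 lexx orbT. Qed.
Lemma v_int0 : v_int 0. Proof. by rewrite /v_int /v_ge eqxx. Qed.
Lemma v_intN x : v_int x -> v_int (- x).
Proof.
rewrite -mulN1r => hx; apply: v_intM => //.
by rewrite /v_int /v_ge vN1 lexx orbT.
Qed.
Lemma v_intX x n : v_int x -> v_int (x ^+ n).
Proof.
by move=> hx; elim: n => [|n ih]; rewrite ?v_int1 // exprS v_intM.
Qed.
Lemma v_max_int x : v_max x -> v_int x.
Proof. by case/orP => [/eqP->|/ltW h]; rewrite /v_int /v_ge ?eqxx ?h ?orbT. Qed.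
Lemma vV x : x != 0 -> v x^-1 = - v x.
Proof.
move=> nx; have [vM _] := val_v; apply/eqP; rewrite -addr_eq0.
by rewrite -vM ?invr_eq0 // mulVf // v1.
Qed.
Lemma vXz x (n : int) : x != 0 -> v (x ^ n) = n%:~R * v x.
Proof.
move=> nx; have [vM _] := val_v.
have vX m : v (x ^+ m) = m%:R * v x.
  elim: m => [|m ih]; first by rewrite expr0 v1 mul0r.
  by rewrite exprS vM ?expf_neq0 // ih -nat1r mulrDl mul1r.
case: n => m; first by rewrite -exprnP vX.
by rewrite NegzE -exprnN vV ?expf_neq0 // vX mulrNz mulNr.
Qed.
End Valuations.

(* A model of Q_p: the completion of the rationals for the p-adic valuation. *)
Record padic_field (p : nat) := PadicField {
  qp_field :> fieldType;
  qp_val : qp_field -> rat;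
  _ : is_valuation qp_val;
  _ : (p%:R : qp_field) != 0;
  _ : qp_val p%:R = 1;
  _ : v_complete qp_val;
  _ : forall x (N : nat), exists a : rat, v_ge qp_val N%:R (x - ratr a) }.

(* A model of the unramified extension of Q_p of degree f (ramification index 1
   and residue degree f), with its residue field F_q, its Teichmueller lifts and
   its Frobenius automorphism; all the data is unique up to isomorphism. *)
Record unramified (p f : nat) := Unramified {
  ur_base : padic_field p;
  ur_field :> fieldExtType ur_base;
  ur_dim : \dim {: ur_field} = f;
  ur_val : ur_field -> rat;
  ur_valP : is_valuation ur_val;
  ur_val_ext : forall x : ur_base, x != 0 -> ur_val x%:A = qp_val x;
  ur_val_int : forall x, x != 0 -> ur_val x \is a Num.int;
  ur_res : finFieldType;
  ur_res_card : #|ur_res| = (p ^ f)%N;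
  ur_red : ur_field -> ur_res;
  ur_redP : residue_morph ur_val ur_red;
  ur_red_surj : forall l, exists2 x, v_int ur_val x & ur_red x = l;
  teich : ur_res -> ur_field;
  teich_int : forall l, v_int ur_val (teich l);
  teich_red : forall l, ur_red (teich l) = l;
  teich_unity : forall l, teich l ^+ (p ^ f) = teich l;
  frob : {rmorphism ur_field -> ur_field};
  frobP : forall x, v_int ur_val x -> v_max ur_val (frob x - x ^+ p) }.

(* A finite extension E of Q_{p^f} and a field k receiving its residue field k_E
   (k may be k_E itself or an algebraic closure of F_p). *)
Record coef_field (p f : nat) (L : unramified p f) := CoefField {
  cf_field :> fieldExtType L;
  cf_val : cf_field -> rat;
  cf_valP : is_valuation cf_val;
  cf_val_ext : forall x : L, x != 0 -> cf_val x%:A = ur_val x;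
  cf_res : fieldType;
  cf_red : cf_field -> cf_res;
  cf_redP : residue_morph cf_val cf_red }.

Section GL2.
Variable F : fieldType.

Record GL2 : Type := GL2Elt { GL2val :> 'M[F]_2; _ : GL2val \in unitmx }.
HB.instance Definition _ := [isSub for GL2val].
HB.instance Definition _ := [Choice of GL2 by <:].

Implicit Types g h : GL2.
Definition GL2_one : GL2 := GL2Elt (unitmx1 _ _).
Fact GL2_mul_subproof g h : val g *m val h \in unitmx.
Proof. by rewrite unitmx_mul (valP g) (valP h). Qed.
Definition GL2_mul g h : GL2 := GL2Elt (GL2_mul_subproof g h).
Fact GL2_inv_subproof g : invmx (val g) \in unitmx.
Proof. by rewrite unitmx_inv (valP g). Qed.
Definition GL2_inv g : GL2 := GL2Elt (GL2_inv_subproof g).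

Fact GL2_mulA : associative GL2_mul.
Proof. by move=> x y z; apply: val_inj; rewrite /= mulmxA. Qed.
Fact GL2_mul1 : left_id GL2_one GL2_mul.
Proof. by move=> x; apply: val_inj; rewrite /= mul1mx. Qed.
Fact GL2_mul1r : right_id GL2_one GL2_mul.
Proof. by move=> x; apply: val_inj; rewrite /= mulmx1. Qed.
Fact GL2_mulV : left_inverse GL2_one GL2_inv GL2_mul.
Proof. by move=> x; apply: val_inj; rewrite /= mulVmx // (valP x). Qed.
Fact GL2_mulVr : right_inverse GL2_one GL2_inv GL2_mul.
Proof. by move=> x; apply: val_inj; rewrite /= mulmxV // (valP x). Qed.
HB.instance Definition _ := isGroup.Build GL2
  GL2_mulA GL2_mul1 GL2_mul1r GL2_mulV GL2_mulVr.

Definition mx22 (R : Type) (a b c d : R) : 'M[R]_2 :=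
  \matrix_(i, j) if i == 0 then if j == 0 then a else b
                 else if j == 0 then c else d.

(* mx22 a b c d as an element of GL2, when it is invertible. *)
Definition gl22 (a b c d : F) : GL2 := insubd GL2_one (mx22 a b c d).
End GL2.

Section KZ.
Variables (p f : nat) (L : unramified p f).
Implicit Types g h : GL2 L.
Notation v := (@ur_val p f L).

Definition mx_int (A : 'M[L]_2) : Prop := forall i j, v_int v (A i j).

Definition in_K g : Prop := mx_int (val g) /\ mx_int (val g^-1%g).

(* The center consists of the nonzero scalar matrices. *)
Definition in_KZ : pred (GL2 L) := fun g =>
  `[< exists (k : GL2 L) (z : L), [/\ in_K k, z != 0 & val g = z *: val k] >].

Lemma mx_intM A B : mx_int A -> mx_int B -> mx_int (A *m B).
Proof.
move=> hA hB i j; rewrite mx22E; have hv := @ur_valP p f L.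
by apply: v_intD => //; apply: v_intM.
Qed.

Lemma in_KM g h : in_K g -> in_K h -> in_K (g * h)%g.
Proof.
case=> g1 g2 [h1 h2]; split; first exact: mx_intM.
by rewrite invgM; apply: mx_intM.
Qed.

Lemma in_K1 : in_K 1%g.
Proof.
have h : mx_int 1%:M.
  by move=> i j; rewrite mxE; case: eqP => _; [apply/v_int1/ur_valP | apply: v_int0].
by split; rewrite ?invg1.
Qed.

Lemma in_KV g : in_K g -> in_K g^-1%g.
Proof. by case=> g1 g2; split=> //; rewrite invgK. Qed.

Lemma val_GL2V g : val g^-1%g = invmx (val g). Proof. by []. Qed.

Lemma in_KZ_closed : group_closed in_KZ.
Proof.
split.
  apply/asboolP; exists 1%g, 1; split; [exact: in_K1|exact: oner_neq0|].
  by rewrite scale1r.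
move=> g h /asboolP[k [z [Kk z0 gE]]] /asboolP[k' [z' [Kk' z0' hE]]].
apply/asboolP; exists (k * k'^-1)%g, (z / z'); split.
- by apply: in_KM => //; apply: in_KV.
- by rewrite mulf_neq0 // invr_eq0.
rewrite /= gE hE invmxZ; last by rewrite -hE (valP h).
by rewrite -scalemxAl -scalemxAr scalerA.
Qed.

Record KZ : Type := KZElt { KZval :> GL2 L; _ : in_KZ KZval }.
HB.instance Definition _ := [isSub for KZval].
HB.instance Definition _ := [Choice of KZ by <:].
HB.instance Definition _ := SubChoice_isSubGroup.Build (GL2 L) in_KZ KZ in_KZ_closed.

(* For g = k p^n in KZ with k in K, v (det g) = 2 n and K_part g = k. *)
Definition K_part g : 'M[L]_2 :=
  p%:R ^ (- Num.floor (v (\det (val g)) / 2%:R)) *: val g.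

Lemma p_neq0 : (p%:R : L) != 0.
Proof.
have := fmorph_eq0 (in_alg L) (p%:R : ur_base L); rewrite rmorph_nat => ->.
by case: (ur_base L).
Qed.

Lemma v_p : v p%:R = 1.
Proof.
have nz : (p%:R : ur_base L) != 0 by case: (ur_base L).
have := ur_val_ext nz; rewrite -[(p%:R)%:A]/(in_alg L p%:R) rmorph_nat => ->.
by case: (ur_base L).
Qed.

Lemma mx_int_det A : mx_int A -> v_int v (\det A).
Proof.
move=> hA; have hv := @ur_valP p f L; rewrite /determinant.
apply: (big_ind (v_int v)) => [|x y|s _]; [exact: v_int0|exact: v_intD|].
apply: v_intM => //; first by apply/v_intX/v_intN/v_int1.
by apply: (big_ind (v_int v)) => [|x y|i _]; [exact: v_int1|exact: v_intM|].
Qed.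

Lemma in_K_det g : in_K g -> v (\det (val g)) = 0.
Proof.
case=> h1 h2; have hv := @ur_valP p f L.
have nz : \det (val g) != 0 by rewrite -unitfE -unitmxE (valP g).
have e := mx_int_det h1; have e' := mx_int_det h2.
move: e'; rewrite val_GL2V det_inv /v_int /v_ge invr_eq0 (negbTE nz) vV //=.
move: e; rewrite /v_int /v_ge (negbTE nz) /= oppr_ge0 => a b.
by apply/eqP; rewrite eq_le a b.
Qed.

Lemma KZ_exp g (k : GL2 L) (z : L) : in_K k -> z != 0 -> val g = z *: val k ->
  v z = (Num.floor (v (\det (val g)) / 2%:R))%:~R.
Proof.
move=> Kk z0 gE; have hv := @ur_valP p f L.
have nz : \det (val k) != 0 by rewrite -unitfE -unitmxE (valP k).
rewrite gE detZ (proj1 hv) ?expf_neq0 // in_K_det // addr0 expr2.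
rewrite (proj1 hv) // -mulr2n -[_ *+ 2]mulr_natr mulfK ?pnatr_eq0 //.
by apply/esym/eqP; rewrite -intrEfloor; apply: ur_val_int.
Qed.

Lemma K_part_int g : in_KZ g -> mx_int (K_part g).
Proof.
case/asboolP=> k [z [Kk z0 gE]] i j; rewrite /K_part mxE gE mxE mulrA.
have hv := @ur_valP p f L; apply: v_intM => //; last by case: Kk.
rewrite /v_int /v_ge; apply/orP; right.
rewrite -gE (proj1 hv) ?expfz_neq0 ?p_neq0 // vXz ?p_neq0 // v_p mulr1.
by rewrite (KZ_exp Kk z0 gE) mulrNz addNr.
Qed.

Lemma K_partM g h : in_KZ g -> in_KZ h -> K_part (g * h)%g = K_part g *m K_part h.
Proof.
case/asboolP=> k [z [Kk z0 gE]] /asboolP[k' [z' [Kk' z0' hE]]].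
have hv := @ur_valP p f L.
have ghE : val (g * h)%g = (z * z') *: val (k * k')%g.
  by rewrite /= gE hE -scalemxAl -scalemxAr scalerA.
have := KZ_exp (in_KM Kk Kk') (mulf_neq0 z0 z0') ghE.
rewrite (proj1 hv) // (KZ_exp Kk z0 gE) (KZ_exp Kk' z0' hE) -intrD.
move/(@intr_inj rat); rewrite /K_part => <-.
rewrite -scalemxAl -scalemxAr scalerA opprD expfzDr ?p_neq0 //.
Qed.

Lemma K_part1 : K_part 1%g = 1%:M.
Proof.
have hv := @ur_valP p f L.
by rewrite /K_part /= det1 v1 // mul0r floor0 oppr0 expr0z scale1r.
Qed.

Lemma frob_int n x : v_int v x -> v_int v (iter n (@frob p f L) x).
Proof.
have hv := @ur_valP p f L; move=> hx; elim: n => //= n ih.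
rewrite -[frob _ _](subrK (iter n (@frob p f L) x ^+ p)).
apply: v_intD => //; last exact: v_intX.
exact/v_max_int/frobP.
Qed.

(* V(R), for an O_L-algebra R with structure map j; the scalar p acts trivially. *)
Section Weight.
Variables (R : comNzRingType) (j : L -> R) (r : 'I_f -> nat).
Hypothesis jP : int_morph v j.

Definition K_subst (A : 'M[L]_2) (i : 'I_f) : 'M[R]_2 :=
  map_mx (fun x => j (iter i (@frob p f L) x)) A.

Definition V_act (g : KZ) : Vpoly R r -> Vpoly R r :=
  Vsubst (K_subst (K_part g)).

Lemma iter_frobD n x y :
  iter n (@frob p f L) (x + y) = iter n (@frob p f L) x + iter n (@frob p f L) y.
Proof. by elim: n => //= n ->; rewrite rmorphD. Qed.
Lemma iter_frobM n x y :
  iter n (@frob p f L) (x * y) = iter n (@frob p f L) x * iter n (@frob p f L) y.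
Proof. by elim: n => //= n ->; rewrite rmorphM. Qed.
Lemma iter_frob1 n : iter n (@frob p f L) 1 = 1.
Proof. by elim: n => //= n ->; rewrite rmorph1. Qed.
Lemma iter_frob0 n : iter n (@frob p f L) 0 = 0.
Proof. by elim: n => //= n ->; rewrite rmorph0. Qed.

Lemma int_morph0 : j 0 = 0.
Proof.
have [_ jD _] := jP; have := jD 0 0 (v_int0 _) (v_int0 _).
by rewrite addr0 -{1}[j 0]addr0 => /addrI.
Qed.

Fact V_act_linear (g : KZ) : linear (V_act g).
Proof. by move=> a P Q; apply: val_inj; rewrite /= linearP. Qed.

Fact V_act1 P : V_act 1%g P = P.
Proof.
apply: val_inj; rewrite /= -[RHS]msubst1 /K_subst K_part1.
congr (msubst _ _); apply: funext => i; apply/matrixP => a b; rewrite !mxE.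
have [j1 _ _] := jP; case: (a == b); first by rewrite iter_frob1 j1.
by rewrite iter_frob0 int_morph0.
Qed.

Fact V_actM (g h : KZ) P : V_act (g * h)%g P = V_act g (V_act h P).
Proof.
have hv := @ur_valP p f L; have [_ jD jM] := jP.
apply: val_inj; rewrite /= msubst_comp; congr (msubst _ _); apply: funext => i.
have ig := K_part_int (valP g); have ih := K_part_int (valP h).
apply/matrixP => a b; rewrite /K_subst K_partM ?(valP g) ?(valP h) //.
rewrite [RHS]mx22E 5![map_mx _ _ _ _]mxE mx22E iter_frobD !iter_frobM.
by rewrite jD ?jM //; do ?[apply: v_intM => //]; apply: frob_int.
Qed.

Definition Vrep : rep R KZ := Rep V_act_linear V_act1 V_actM.
End Weight.
End KZ.

Section RepConstructions.
Variables (R : comNzRingType) (G : groupType).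

Section Coker.
Variables (M N : rep R G) (h : rep_hom M N).
Definition image_of (y : N) : Prop := exists x, y = h x.
Fact image_of_stable g y : image_of y -> image_of (ract g y).
Proof. by case=> x ->; exists (ract g x); rewrite hom_act. Qed.
Definition coker : rep R G := quot_rep image_of_stable.
Definition coker_pi : rep_hom N coker := quot_pi image_of_stable.
End Coker.

Section MinusScalar.
Variables (M : rep R G) (T : rep_hom M M) (a : R).
Definition minus_scalar (x : M) : M := T x - a *: x.
Fact minus_scalar_linear : linear minus_scalar.
Proof.
move=> b x y; rewrite /minus_scalar linearP scalerBr scalerDr !scalerA.
by rewrite [b * a]mulrC opprD addrACA.
Qed.
HB.instance Definition _ :=
  GRing.isLinear.Build R M M *:%R minus_scalar minus_scalar_linear.
Fact minus_scalar_act g x : minus_scalar (ract g x) = ract g (minus_scalar x).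
Proof.
rewrite /minus_scalar hom_act [RHS]linearB.
congr (_ - _); exact: esym (linearZ_LR (@ract R G M g) a x).
Qed.
Definition hom_minus_scalar : rep_hom M M := RepHom minus_scalar_act.
End MinusScalar.

Definition triv_act (g : G) (x : R^o) : R^o := x.
Fact triv_act_linear g : linear (triv_act g). Proof. by []. Qed.
Fact triv_act1 x : triv_act 1%g x = x. Proof. by []. Qed.
Fact triv_actM g h x : triv_act (g * h)%g x = triv_act g (triv_act h x).
Proof. by []. Qed.
Definition triv_rep : rep R G := Rep triv_act_linear triv_act1 triv_actM.

End RepConstructions.

Definition onto (A B : Type) (h : A -> B) : Prop := forall y, exists x, h x = y.

Section Hecke.
Variables (p f : nat) (L : unramified p f) (R : comNzRingType).

(* T is the Hecke operator of ind W with
     T [g, w] = sum_l [g (p [l] ; 0 1), A l w] + [g (1 0 ; 0 p), B w]. *)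
Definition is_hecke (W : rep R (KZ L)) (A : ur_res L -> W -> W) (B : W -> W)
    (T : rep_hom (ind W) (ind W)) : Prop :=
  forall (g : GL2 L) (w : W),
    T (ind_elem g w) =
      \sum_(l : ur_res L) ind_elem (g * gl22 p%:R (teich l) 0 1)%g (A l w)
      + ind_elem (g * gl22 1 0 0 p%:R)%g (B w).

(* In weight 0 the polynomials are constant and no substitution moves them. *)
Definition is_hecke_triv
    (T : rep_hom (ind (triv_rep R (KZ L))) (ind (triv_rep R (KZ L)))) : Prop :=
  is_hecke (fun _ c => c) (fun c => c) T.

End Hecke.

Section Setting.
Variables (p f : nat) (L : unramified p f) (C : coef_field L) (r : 'I_f -> nat).
Notation E := (cf_field C).
Notation k := (cf_res C).
Notation red := (@cf_red p f L C).
Notation vE := (@cf_val p f L C).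

Lemma E_morph : int_morph (@ur_val p f L) (fun x : L => x%:A : E).
Proof.
split; first exact: rmorph1 (in_alg E).
  by move=> x y _ _; exact: rmorphD (in_alg E) _ _.
by move=> x y _ _; exact: rmorphM (in_alg E) _ _.
Qed.

Lemma E_int (x : L) : v_int (@ur_val p f L) x -> v_int vE x%:A.
Proof.
rewrite /v_int /v_ge; have [->|nx] := eqVneq x 0.
  by rewrite scale0r eqxx.
by rewrite cf_val_ext //= => ->; rewrite orbT.
Qed.

Lemma k_morph : int_morph (@ur_val p f L) (fun x : L => red x%:A).
Proof.
have [[r1 rD rM] _] := @cf_redP p f L C; have [e1 eD eM] := E_morph.
split; first by rewrite e1.
  by move=> x y hx hy; rewrite eD // rD //; apply: E_int.
by move=> x y hx hy; rewrite eM // rM //; apply: E_int.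
Qed.

Definition V_E : rep E (KZ L) := Vrep r E_morph.
Definition V_k : rep k (KZ L) := Vrep r k_morph.

Definition V_lam (l : ur_res L) (P : Vpoly E r) : Vpoly E r :=
  Vsubst (fun i : 'I_f => mx22 1 ((- (teich l)%:A) ^+ (p ^ i)) 0 p%:R) P.
Definition V_inf (P : Vpoly E r) : Vpoly E r :=
  Vsubst (fun=> mx22 p%:R 0 0 1) P.

Definition is_hecke_E (T : rep_hom (ind V_E) (ind V_E)) : Prop :=
  @is_hecke p f L E V_E V_lam V_inf T.

(* Membership in ind V(O_E). *)
Definition integral_fun (F : ind V_E) : Prop :=
  forall (g : GL2 L) (m : 'X_{1..f + f}), v_int vE (Vval ((F : ind_car V_E) g))@_m.

(* F' is the reduction of F, for F in ind V(O_E). *)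
Definition reduces_to (F : ind V_E) (F' : ind V_k) : Prop :=
  forall (g : GL2 L) (m : 'X_{1..f + f}),
    (Vval ((F' : ind_car V_k) g))@_m = red (Vval ((F : ind_car V_E) g))@_m.

Section Theta.
Variables (T : rep_hom (ind V_E) (ind V_E)) (a : E).

Definition Pi : rep E (GL2 L) := coker (hom_minus_scalar T a).
Definition Pi_pi : rep_hom (ind V_E) Pi := coker_pi (hom_minus_scalar T a).

Definition in_Theta (x : Pi) : Prop :=
  exists2 F : ind V_E, integral_fun F & x = Pi_pi F.

Fact in_Theta_stable g x : in_Theta x -> in_Theta (ract g x).
Proof.
case=> F iF ->; exists (ract g F); first by move=> h m; apply: iF.
by rewrite hom_act.
Qed.

Definition Theta : choiceType := lattice in_Theta.

Definition Theta_bar : rep k (GL2 L) :=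
  tens_rep (v_int vE) red in_Theta_stable.

Definition Theta_class (F : ind V_E) (iF : integral_fun F) : Theta :=
  exist _ (Pi_pi F)
    (introT (asboolP (in_Theta (Pi_pi F))) (ex_intro2 _ _ F iF erefl)).

(* The natural map from ind V_r to Theta_bar sends the reduction of F in
   ind V(O_E) to the class of F tensor 1. *)
Definition is_natural (pr : rep_hom (ind V_k) Theta_bar) : Prop :=
  forall (F : ind V_E) (iF : integral_fun F) (F' : ind V_k),
    reduces_to F F' -> pr F' = tens (v_int vE) red in_Theta_stable (Theta_class iF) 1.
End Theta.

Definition theta_poly (i : 'I_f) : {mpoly k[f + f]} :=
  varX k i * varY k (ord_pred i) ^+ p - varY k i * varX k (ord_pred i) ^+ p.

Definition V_star (P : V_k) : Prop :=
  exists Q : 'I_f -> {mpoly k[f + f]},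
    Vval P = \sum_(i < f) theta_poly i * Q i.

(* K acts on V_r through its quotient Gamma and p acts trivially, so that the
   Gamma-submodule generated by an element is spanned by its KZ-orbit. *)
Definition X_sub : {pred V_k} := span_of (fun P : V_k =>
  exists (g : KZ L) (P0 : V_k),
    Vval P0 = \prod_(i < f) varX k i ^+ r i /\ P = ract g P0).

(* e identifies Q = V_r / (V_r^* + X_r) with the trivial representation. *)
Definition presents_Q (e : rep_hom V_k (triv_rep k (KZ L))) : Prop :=
  onto e /\
  forall P : V_k, e P = 0 <->
    exists P1 P2 : V_k, [/\ V_star P1, P2 \in X_sub & P = P1 + P2].

End Setting.

(* Main.v *)
Require Import Defs.
From HB Require Import structures.
From mathcomp Require Import all_boot all_order all_algebra all_field.
From mathcomp Require Import generic_quotient ring_quotient boolp.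
From mathcomp Require monalg.
From mathcomp Require Import mpoly.

(** A null function is one of the form (T - a_p) F0 + F1 with the coefficients
    of F1 in the maximal ideal; integral null functions die in Theta_bar.  Since
    T [g, v] = a_p [g, v] in Pi, the class [g, v] is null as soon as T [g, v / a_p]
    is.  The coefficients of v (X, mu X + p Y) are divisible by p, except that of
    X^r, which is v (1, mu); as v(a_p) < 1 this kills the multiples of the theta_i.
    For M = X^(p-1) Y^(r-p+1) it also gives a_p^-1 [g beta, Y^r] = - [g, M] modulo
    null functions, where beta = diag(1, p); in particular Y^r and X_r die.

    The elements of V_r^* are those that vanish on F_q^2 (the exponents of X can be
    reduced to base-p digits modulo the theta_i), and Q is identified with the
    trivial representation by P |-> - sum of the values of P on F_q^2, which maps
    M to -1.

    By the relation above, the image of the Hecke operator of ind 1 at M is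
    a_p^-1 [1, U] up to sign, with U = sum_l ([l] X + Y)^r + X^r.  All coefficients
    of U (X, mu X + p Y) and U (p X, Y) are divisible by p^2, except those of X^r
    and Y^r, which are divisible by p: the sum over F_q of an odd power vanishes
    and r is even.  Hence T [1, U / a_p^2] is null, and so is [1, U / a_p]. *)

Set Implicit Arguments.
Unset Strict Implicit.
Unset Printing Implicit Defensive.

Import Order.TTheory GRing.Theory Num.Theory.
Local Open Scope ring_scope.

(** * Compact induction *)

(** The relation between Y^r and M is used in both directions. From M to Y^r it rewrites the Hecke
    sum: [alpha l * beta] lies in KZ and moves Y^r to ([l] X + Y)^r. The remaining coset resists, as
    beta^2 is not in KZ; there [beta] is replaced by [beta * kap] with [kap] in KZ, which does not
    affect the class because KZ acts trivially on Q, and beta kap beta = w0 moves Y^r to X^r. This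
    is where U comes from. From Y^r to M it settles the coefficients that have a single factor p,
    too little in general for two divisions by a_p: if p divides s, then s a_p^-2 [h, Y^r] is - (s /
    a_p) [h beta^-1, M] modulo null functions, and s / a_p is in the maximal ideal. The exponents p
    - 1 of M are the digits of q - 1, so Y^r and M agree exactly at the points (1, mu) with mu^q =
    mu. Two features of the coefficients shape the rest. E may be ramified, so congruences that must
    give a factor p are proved in L. And k may exceed the residue field of E, so elements of V_r
    need not lift; the maps out of V_r are therefore defined on monomials. *)

Lemma lpi_gen (R : nzRingType) (V : lmodType R) (A : V -> Prop) x :
  A x -> lpi A x = 0.
Proof.
by move=> Ax; apply/eqP; rewrite -(linear0 (lpi A)) lpi_eq subr0; apply: span_of_gen.
Qed.

Lemma rep_hom_exists (R : nzRingType) (G : groupType) (M N : rep R G)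
    (h : M -> N) :
  linear h -> (forall g x, h (ract g x) = ract g (h x)) ->
  exists h' : rep_hom M N, h' =1 h.
Proof.
move=> hL hG; pose hl : {linear M -> N} := HB.pack h (GRing.isLinear.Build R M N *:%R h hL).
by exists (@RepHom R G M N hl hG).
Qed.

Lemma linear_exists (R : nzRingType) (V W : lmodType R) (h : V -> W) :
  linear h -> exists h' : {linear V -> W}, h' =1 h.
Proof.
move=> hL; pose hl : {linear V -> W} := HB.pack h (GRing.isLinear.Build R V W *:%R h hL).
by exists hl.
Qed.

Lemma quot_rep_factor (R : nzRingType) (G : groupType) (M N : rep R G)
    (A : M -> Prop) (stabA : forall g x, A x -> A (ract g x)) (h : rep_hom M N) :
  (forall x, A x -> h x = 0) ->
  exists h' : rep_hom (quot_rep stabA) N, forall x, h' (lpi A x) = h x.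
Proof.
move=> hA; pose h0 (u : lquot A) : N := h (repr (u : Quotient.quot (span_closed A))).
have h0pi x : h0 (lpi A x) = h x.
  apply/eqP; rewrite -subr_eq0 /h0 -linearB.
  have /asboolP := etrans (esym (lpi_eq A _ _)) (introT eqP (reprK (lpi A x))).
  move=> /(_ (fun y => h y = 0)) ->; rewrite ?linear0 //.
  by move=> a u v hu hv; rewrite linearP hu hv scaler0 addr0.
have [|g u|h' h'E] := @rep_hom_exists R G (quot_rep stabA) N h0.
- move=> a u v; case: (lpiP u) => x ->; case: (lpiP v) => y ->.
  by rewrite -linearP !h0pi linearP.
- case: (lpiP u) => x ->; rewrite /ract /= qact_pi // !h0pi.
  exact: hom_act.
- by exists h' => x; rewrite h'E h0pi.
Qed.

Section CompactInductionTheory.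
Variables (R : nzRingType) (G : groupType) (S : pred G) (H : subGroupType S).

Lemma ind_act_elem (W : rep R H) g h (w : W) :
  ract g (ind_elem h w) = ind_elem (g * h)%g w.
Proof.
by apply: val_inj; apply: funext => x; rewrite /= /ind_shift /ind_elem_fun mulgA.
Qed.

Lemma ind_elem_sub (W : rep R H) g (k : H) (w : W) :
  ind_elem (g * val k)%g w = ind_elem g (ract k w).
Proof.
apply: val_inj; apply: funext => x; rewrite /= /ind_elem_fun mulgA.
case: (insubP H (x * g)%g) => [u Su uE|nS].
  have Sk : S (val (u * k)%g) by apply: valP.
  rewrite -uE -valM insubT -ractM; congr (ract _ _).
  by apply: val_inj; rewrite SubK.
rewrite insubF //; apply/negbTE; apply: contra nS => Sxgk.
pose u : H := Sub _ Sxgk.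
have <- : val (u * k^-1)%g = (x * g)%g; last exact: valP.
by rewrite valM SubK -[LHS]mulgA -valM mulgV val1 mulg1.
Qed.

Fact ind_elem_linear (W : rep R H) g : linear (@ind_elem R G S H W g).
Proof.
move=> a u v; apply: val_inj; apply: funext => x /=.
rewrite -[RHS]/(a *: ind_elem_fun g u x + ind_elem_fun g v x) /ind_elem_fun.
by case: (insub _) => [k|]; rewrite ?linearP // scaler0 addr0.
Qed.
HB.instance Definition _ (W : rep R H) g :=
  GRing.isLinear.Build R W (ind W) *:%R (@ind_elem R G S H W g) (ind_elem_linear g).

Definition covers (W : rep R H) (F : ind W) (s : seq G) :=
  forall g, (F : ind_car W) g <> 0 ->
    exists2 h, h \in s & exists k : H, g = (val k * h)%g.

(** A duplicate-free list of representatives of pairwise distinct cosets H h. *)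
Definition left_free (s : seq G) :=
  uniq s /\ forall h h' (k : H), h \in s -> h' \in s -> h = (val k * h')%g -> h = h'.

Lemma left_transversal (s : seq G) : exists s', left_free s' /\
  forall h, h \in s -> exists2 h', h' \in s' & exists k : H, h = (val k * h')%g.
Proof.
elim: s => [|h s [s' [[us ls] cs]]]; first by exists [::].
have [[h0 h0s [k hE]]|no] :=
  pselect (exists2 h', h' \in s' & exists k : H, h = (val k * h')%g).
  exists s'; split=> // x; rewrite in_cons => /predU1P[->|/cs//].
  by exists h0 => //; exists k.
exists (h :: s'); split=> [|x].
  split=> [|x y k] /=.
    rewrite us andbT; apply/negP => hs; apply: no; exists h => //.
    by exists 1%g; rewrite val1 mul1g.
  rewrite !in_cons => /predU1P[->|xs] /predU1P[->|ys] // xE.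
  - by case: no; exists y => //; exists k.
  - case: no; exists x => //; exists k^-1%g.
    by rewrite xE mulgA -valM mulVg val1 mul1g.
  - exact: ls xE.
rewrite in_cons => /predU1P[->|/cs[h' h's hE]].
  by exists h; rewrite ?mem_head //; exists 1%g; rewrite val1 mul1g.
by exists h' => //; rewrite in_cons h's orbT.
Qed.

Lemma covers_exists2 (W : rep R H) (F F' : ind W) :
  exists s, [/\ covers F s, covers F' s & left_free s].
Proof.
have raw (E : ind W) : exists s, covers E s.
  by have /asboolP[_ [s Hs]] := valP (E : ind_car W); exists s.
have [t ct] := raw F; have [t' ct'] := raw F'.
have [s [ls cs]] := left_transversal (t ++ t'); exists s; split=> // g nz.
  have [h hs [k ->]] := ct g nz; have [|h' h's [k' ->]] := cs h.
    by rewrite mem_cat hs.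
  by exists h' => //; exists (k * k')%g; rewrite valM mulgA.
have [h hs [k ->]] := ct' g nz; have [|h' h's [k' ->]] := cs h.
  by rewrite mem_cat hs orbT.
by exists h' => //; exists (k * k')%g; rewrite valM mulgA.
Qed.

Lemma covers_exists (W : rep R H) (F : ind W) :
  exists s, covers F s /\ left_free s.
Proof. by have [s [cs _ ls]] := covers_exists2 F F; exists s. Qed.

Lemma ind_funM (W : rep R H) (F : ind W) (k : H) g :
  (F : ind_car W) (val k * g)%g = ract k ((F : ind_car W) g).
Proof. by case: (F) => F0 /= /asboolP[]. Qed.

Lemma ind_fun_sum (W : rep R H) (I : Type) (t : seq I) (Fs : I -> ind W) x :
  (\sum_(i <- t) Fs i : ind_car W) x = \sum_(i <- t) (Fs i : ind_car W) x.
Proof.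
elim: t => [|i t ih]; first by rewrite !big_nil.
by rewrite !big_cons -ih.
Qed.

(** At a point x of the coset H h only the term of h contributes, since the other terms are
    supported on other cosets. *)
Lemma ind_expand (W : rep R H) (F : ind W) s : covers F s -> left_free s ->
  F = \sum_(h <- s) ind_elem h^-1%g ((F : ind_car W) h).
Proof.
move=> cs [us ls]; apply: val_inj; apply: funext => x.
rewrite [RHS]ind_fun_sum /=.
have zero h : (forall k : H, x <> (val k * h)%g) ->
    ind_elem_fun h^-1%g ((F : ind_car W) h) x = 0.
  move=> no; rewrite /ind_elem_fun; case: insubP => // u _ uE.
  by case: (no u); rewrite uE mulgVK.
have [[h hs [k xE]]|no] :=
    pselect (exists2 h, h \in s & exists k : H, x = (val k * h)%g).
  rewrite (bigD1_seq h) //= [X in _ + X]big1_seq ?addr0.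
    rewrite xE ind_funM /ind_elem_fun mulgK insubT ?(valP k) // => Sk.
    by congr (ract _ _); apply: val_inj; rewrite SubK.
  move=> h' /andP[ne h's]; apply: zero => k' xE'; case/eqP: ne.
  apply: (ls _ _ (k'^-1 * k)%g) => //.
  by rewrite valM -mulgA -xE xE' mulgA -valM mulVg val1 mul1g.
rewrite big1_seq; last first.
  by move=> h /andP[_ hs]; apply: zero => k xE; apply: no; exists h => //; exists k.
by apply: contra_notP no => nz; apply: cs.
Qed.

Lemma ind_ind (W : rep R H) (Q : ind W -> Prop) :
  Q 0 -> (forall u v, Q u -> Q v -> Q (u + v)) ->
  (forall g w, Q (ind_elem g w)) -> forall F, Q F.
Proof.
move=> Q0 QD Qe F; have [s [cs ls]] := covers_exists F.
by rewrite (ind_expand cs ls); apply: big_ind.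
Qed.

Lemma ind_elem1 (W : rep R H) g (w : W) :
  (ind_elem g w : ind_car W) g^-1%g = w.
Proof.
rewrite /= /ind_elem_fun mulVg insubT; first by rewrite -(val1 H) valP.
move=> S1; rewrite -[RHS]ract1; congr (ract _ _).
by apply: val_inj; rewrite SubK val1.
Qed.

Lemma ind_map_elem (W W' : rep R H) (e : rep_hom W W') g (w : W) :
  ind_map e (ind_elem g w) = ind_elem g (e w).
Proof.
apply: val_inj; apply: funext => x /=; rewrite /ind_elem_fun.
by case: insub => [k|]; rewrite ?hom_act ?linear0.
Qed.

(** [Phi] sends F to the sum of the h^-1 phi (F h), one h for each coset H h that meets the support.
    By [smk] the summand depends only on the coset, so the sum does not depend on the
    transversal. *)
Theorem Frobenius_reciprocity (W : rep R H) (M : rep R G) (phi : {linear W -> M}) :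
  (forall (k : H) w, phi (ract k w) = ract (val k) (phi w)) ->
  exists Phi : rep_hom (ind W) M, forall g w, Phi (ind_elem g w) = ract g (phi w).
Proof.
move=> phiK.
pose sm (F : ind W) s := \sum_(h <- s) ract h^-1%g (phi ((F : ind_car W) h)).
have smk (F : ind W) (k : H) h :
    ract (val k * h)^-1%g (phi ((F : ind_car W) (val k * h)%g)) =
    ract h^-1%g (phi ((F : ind_car W) h)).
  rewrite ind_funM phiK invgM ractM; congr (ract _ _).
  by rewrite -ractM mulVg ract1.
have smE F s s' : covers F s -> left_free s -> covers F s' -> left_free s' ->
    sm F s = sm F s'.
  move=> cs [us ls] cs' [us' ls'].
  have nz h : (F : ind_car W) h = 0 -> ract h^-1%g (phi ((F : ind_car W) h)) = 0.
    by move=> ->; rewrite !linear0.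
  (* [rho h] is the element of [s'] in the coset of [h]; it maps the part of [s] in the support
     bijectively onto that of [s']. *)
  pose rho h := nth h s' (find (fun h' => `[< exists k : H, h = (val k * h')%g >]) s').
  have rhoP h : (F : ind_car W) h <> 0 ->
      rho h \in s' /\ exists k : H, h = (val k * rho h)%g.
    move=> /cs'[h' h's' hk].
    have hs' : has (fun h' => `[< exists k : H, h = (val k * h')%g >]) s'.
      by apply/hasP; exists h' => //; apply/asboolP.
    split; first by rewrite mem_nth // -has_find.
    by have /asboolP := nth_find h hs'.
  rewrite /sm.
  rewrite (bigID (fun h => (F : ind_car W) h != 0)) /= [X in _ + X]big1 ?addr0; last first.
    by move=> h /negPn/eqP/nz.
  rewrite [RHS](bigID (fun h => (F : ind_car W) h != 0)) /= [X in _ = _ + X]big1 ?addr0; last first.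
    by move=> h /negPn/eqP/nz.
  rewrite -big_filter -[RHS]big_filter.
  transitivity (\sum_(h <- map rho [seq h <- s | (F : ind_car W) h != 0])
      ract h^-1%g (phi ((F : ind_car W) h))).
    rewrite big_map; apply: eq_big_seq => h.
    rewrite mem_filter => /andP[/eqP/rhoP[_ [k hE]] _].
    by rewrite {1 2}hE smk.
  apply: perm_big; apply: uniq_perm; last 1 first.
  - move=> h; apply/mapP/idP => [[h0]|].
      rewrite mem_filter => /andP[/eqP nz0 _ ->].
      have [rs [k hE]] := rhoP _ nz0; rewrite mem_filter rs andbT.
      by apply/eqP => r0; apply: nz0; rewrite hE ind_funM r0 linear0.
    rewrite mem_filter => /andP[/eqP nzh hs'].
    have [h0 h0s [k hE]] := cs _ nzh.
    have nz0 : (F : ind_car W) h0 <> 0.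
      by move=> z; apply: nzh; rewrite hE ind_funM z linear0.
    exists h0; first by rewrite mem_filter h0s andbT; apply/eqP.
    have [rs [k' h0E]] := rhoP _ nz0.
    by apply: (ls' _ _ (k * k')%g) => //; rewrite valM -mulgA -h0E.
  - rewrite map_inj_in_uniq ?filter_uniq // => x y.
    rewrite !mem_filter => /andP[/eqP/rhoP[_ [k xE]] xs] /andP[/eqP/rhoP[_ [k' yE]] ys] e.
    apply: (ls _ _ (k * k'^-1)%g) => //.
    rewrite {1}xE e valM -mulgA; congr (_ * _)%g.
    by rewrite {2}yE mulgA -valM mulVg val1 mul1g.
  - exact: filter_uniq.
pose Phi (F : ind W) := sm F (projT1 (cid (covers_exists F))).
have PhiE F s : covers F s -> left_free s -> Phi F = sm F s.
  move=> cs ls; rewrite /Phi; case: (cid _) => s' [cs' ls'] /=.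
  exact: smE.
have Phil : linear Phi.
  (* A transversal covering both supports also covers that of the combination, so the three sums run
     over one list. *)
  move=> a u v; have [s [cu cv ls]] := covers_exists2 u v.
  rewrite (PhiE _ _ cu ls) (PhiE _ _ cv ls) (PhiE (a *: u + v) s) //.
    rewrite /sm scaler_sumr -big_split; apply: eq_bigr => h _.
    rewrite -[(a *: u + v : ind_car W) h]/(a *: (u : ind_car W) h + (v : ind_car W) h).
    by rewrite !linearP.
  move=> g nz; have [u0|/eqP nzu] := eqVneq ((u : ind_car W) g) 0; last exact: cu.
  apply: cv => v0; apply: nz.
  by rewrite -[LHS]/(a *: (u : ind_car W) g + (v : ind_car W) g) u0 v0 scaler0 addr0.
have lf1 (g : G) : left_free [:: g].
  by split=> // x y k; rewrite !inE => /eqP-> /eqP->.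
have Phie g w : Phi (ind_elem g w) = ract g (phi w).
  rewrite (PhiE _ [:: g^-1%g]) //; first by rewrite /sm big_seq1 invgK ind_elem1.
  move=> x /=; rewrite /ind_elem_fun; case: insubP => [k _ kE _|//].
  by exists g^-1%g; rewrite ?mem_head //; exists k; rewrite kE mulgK.
have PhiG g F : Phi (ract g F) = ract g (Phi F).
  have [L LE] := linear_exists Phil.
  rewrite -!LE; elim/ind_ind: F => [|u v hu hv|h w]; first by rewrite !linear0.
    by rewrite !linearD hu hv.
  by rewrite !LE ind_act_elem !Phie ractM.
have [h hE] := rep_hom_exists Phil PhiG.
by exists h => g w; rewrite hE Phie.
Qed.

End CompactInductionTheory.

(** * Multihomogeneous polynomials *)

Lemma mx22_00 (R : Type) (a b c d : R) : mx22 a b c d 0 0 = a. Proof. by rewrite mxE. Qed.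
Lemma mx22_01 (R : Type) (a b c d : R) : mx22 a b c d 0 1 = b. Proof. by rewrite mxE. Qed.
Lemma mx22_10 (R : Type) (a b c d : R) : mx22 a b c d 1 0 = c. Proof. by rewrite mxE. Qed.
Lemma mx22_11 (R : Type) (a b c d : R) : mx22 a b c d 1 1 = d. Proof. by rewrite mxE. Qed.
Definition mx22C := (mx22_00, mx22_01, mx22_10, mx22_11).

Lemma ord2P (Q : 'I_2 -> Prop) : Q 0 -> Q 1 -> forall i, Q i.
Proof.
move=> Q0 Q1 [[|[|//]] lti].
  by have -> : Ordinal lti = 0 by apply: val_inj.
by have -> : Ordinal lti = 1 by apply: val_inj.
Qed.

Lemma mx22P (R : Type) (A B : 'M[R]_2) : A 0 0 = B 0 0 -> A 0 1 = B 0 1 ->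
  A 1 0 = B 1 0 -> A 1 1 = B 1 1 -> A = B.
Proof. by move=> *; apply/matrixP; apply: ord2P; apply: ord2P. Qed.

Lemma det_mx22 (R : comNzRingType) (A : 'M[R]_2) :
  \det A = A 0 0 * A 1 1 - A 0 1 * A 1 0.
Proof.
rewrite (expand_det_row _ 0) !big_ord_recl big_ord0 addr0 /cofactor !det_mx11 !mxE /=.
rewrite expr0 expr1 mul1r mulN1r mulrN.
by congr (A _ _ * A _ _ - A _ _ * A _ _); apply: val_inj.
Qed.

Lemma det_mx22E (R : comNzRingType) (a b c d : R) :
  \det (mx22 a b c d) = a * d - b * c.
Proof. by rewrite det_mx22 !mx22C. Qed.

Lemma mulmx22 (R : comNzRingType) (a b c d a' b' c' d' : R) :
  mx22 a b c d *m mx22 a' b' c' d' =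
  mx22 (a * a' + b * c') (a * b' + b * d') (c * a' + d * c') (c * b' + d * d').
Proof. by apply: mx22P; rewrite mx22E !mx22C. Qed.

Lemma scalemx22 (R : comNzRingType) (z a b c d : R) :
  z *: mx22 a b c d = mx22 (z * a) (z * b) (z * c) (z * d).
Proof. by apply: mx22P; rewrite mxE !mx22C. Qed.

Section Monomials.
Variable f : nat.
Implicit Types (a b r : 'I_f -> nat) (m : 'X_{1..f + f}).

Definition mXY a b : 'X_{1..f + f} :=
  [multinom match fintype.split l with inl i => a i | inr i => b i end | l < f + f].

Lemma mXYl a b i : mXY a b (lshift f i) = a i.
Proof. by rewrite mnmE (unsplitK (inl i)). Qed.
Lemma mXYr a b i : mXY a b (rshift f i) = b i.
Proof. by rewrite mnmE (unsplitK (inr i)). Qed.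
Definition mXYE := (mXYl, mXYr).

Lemma lrshiftP (Q : 'I_(f + f) -> Prop) :
  (forall i, Q (lshift f i)) -> (forall i, Q (rshift f i)) -> forall l, Q l.
Proof.
move=> hl hr l; case: (splitP l) => i e.
  by have -> : l = lshift f i by apply: val_inj.
by have -> : l = rshift f i by apply: val_inj.
Qed.

Lemma mnmXY m1 m2 : (forall i, m1 (lshift f i) = m2 (lshift f i)) ->
  (forall i, m1 (rshift f i) = m2 (rshift f i)) -> m1 = m2.
Proof. by move=> hl hr; apply/mnmP; apply: lrshiftP. Qed.

Definition mhom r m := [forall i, m (lshift f i) + m (rshift f i) == r i]%N.

Lemma mhomP r m :
  reflect (forall i, (m (lshift f i) + m (rshift f i))%N = r i) (mhom r m).
Proof. exact: 'forall_eqP. Qed.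

Lemma mhom_eqX r m : mhom r m ->
  (m == mXY r (fun=> 0%N)) = [forall i, m (rshift f i) == 0%N].
Proof.
move=> /mhomP hm; apply/eqP/'forall_eqP => [-> i|m0]; first by rewrite mXYE.
by apply: mnmXY => i; rewrite mXYE // -hm m0 addn0.
Qed.

Lemma mhom_eqY r m : mhom r m ->
  (m == mXY (fun=> 0%N) r) = [forall i, m (lshift f i) == 0%N].
Proof.
move=> /mhomP hm; apply/eqP/'forall_eqP => [-> i|m0]; first by rewrite mXYE.
by apply: mnmXY => i; rewrite mXYE // -hm m0.
Qed.

Lemma mdeg_mhom r m : mhom r m -> mdeg m = (\sum_i r i)%N.
Proof.
by move=> /mhomP hm; rewrite mdegE big_split_ord /= -big_split; apply: eq_bigr => i _.
Qed.

End Monomials.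

Section Polynomials.
Variables (f : nat) (R : comNzRingType).
Implicit Types (a b r : 'I_f -> nat) (m : 'X_{1..f + f}) (P : {mpoly R[f + f]}).
Implicit Types (x y : 'I_f -> R) (N : 'I_f -> 'M[R]_2).

Lemma multihomE r P : reflect (forall m, ~~ mhom r m -> P@_m = 0) (P \in multihom r).
Proof.
apply: (iffP idP) => [/allP hP m|hP].
  by apply: contraNeq; rewrite -mcoeff_msupp => /hP.
by apply/allP => m; rewrite mcoeff_msupp; apply: contraR => /hP->.
Qed.

Lemma mpolyX_multihom r m : mhom r m -> 'X_[m] \in @multihom f R r.
Proof.
move=> hm; apply/multihomE => m'; rewrite mcoeffX.
by case: eqP => // <-; rewrite hm.
Qed.

Definition pt2 x y : 'I_(f + f) -> R :=
  fun l => match fintype.split l with inl i => x i | inr i => y i end.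

Lemma pt2l x y i : pt2 x y (lshift f i) = x i.
Proof. by rewrite /pt2 (unsplitK (inl i)). Qed.
Lemma pt2r x y i : pt2 x y (rshift f i) = y i.
Proof. by rewrite /pt2 (unsplitK (inr i)). Qed.

Lemma meval_pt2X x y m : 'X_[m].@[pt2 x y] =
  (\prod_i x i ^+ m (lshift f i)) * \prod_i y i ^+ m (rshift f i).
Proof.
rewrite mevalX big_split_ord /=.
by congr (_ * _); apply: eq_bigr => i _; rewrite ?pt2l ?pt2r.
Qed.

Lemma meval_pt2XY x y a b : 'X_[mXY a b].@[pt2 x y] =
  (\prod_i x i ^+ a i) * \prod_i y i ^+ b i.
Proof.
by rewrite meval_pt2X; congr (_ * _); apply: eq_bigr => i _; rewrite mXYE.
Qed.

Lemma mpolyXYE a b :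
  'X_[mXY a b] = (\prod_i varX R i ^+ a i) * \prod_i varY R i ^+ b i.
Proof.
rewrite mpolyXE_id big_split_ord /=.
by congr (_ * _); apply: eq_bigr => i _; rewrite mXYE.
Qed.

Lemma meval_msubst N P x y : (msubst N P).@[pt2 x y] =
  P.@[pt2 (fun i => x i * N i 0 0 + y i * N i 1 0)
          (fun i => x i * N i 0 1 + y i * N i 1 1)].
Proof.
rewrite /msubst comp_mpoly_meval; apply: meval_eq => l; rewrite tnth_mktuple.
rewrite /msubst_var /pt2; case: (fintype.split l) => i.
  by rewrite mevalD !mevalZ !mevalXU -/(pt2 x y _) pt2l -/(pt2 x y _) pt2r ![_ * N _ _ _]mulrC.
by rewrite mevalD !mevalZ !mevalXU -/(pt2 x y _) pt2l -/(pt2 x y _) pt2r ![_ * N _ _ _]mulrC.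
Qed.

Lemma msubstX N m : msubst N 'X_[m] =
  (\prod_i (N i 0 0 *: varX R i + N i 1 0 *: varY R i) ^+ m (lshift f i)) *
  \prod_i (N i 0 1 *: varX R i + N i 1 1 *: varY R i) ^+ m (rshift f i).
Proof.
rewrite /msubst comp_mpolyX big_split_ord /=.
by congr (_ * _); apply: eq_bigr => i _; rewrite tnth_mktuple /msubst_var
  ?(unsplitK (inl i)) ?(unsplitK (inr i)).
Qed.

Lemma mcoeff_msubst_diag (c d : 'I_f -> R) P m :
  (msubst (fun i => mx22 (c i) 0 0 (d i)) P)@_m =
  (\prod_i c i ^+ m (lshift f i)) * (\prod_i d i ^+ m (rshift f i)) * P@_m.
Proof.
have step m' : msubst (fun i => mx22 (c i) 0 0 (d i)) 'X_[m'] =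
    ((\prod_i c i ^+ m' (lshift f i)) * (\prod_i d i ^+ m' (rshift f i))) *: 'X_[m'].
  rewrite msubstX [X in _ *: X]mpolyXE_id big_split_ord /=.
  rewrite -scalerA scalerAr scalerAl -!scaler_prod.
  by congr (_ * _); apply: eq_bigr => i _; rewrite !mxE /= scale0r ?addr0 ?add0r exprZn.
rewrite {1}[P]mpolyE (linear_sum (msubst _)) (linear_sum (mcoeff m)) /=.
rewrite [in RHS](mpolyE P) (linear_sum (mcoeff m)) mulr_sumr /=.
apply: eq_bigr => m' _; rewrite linearZ /= step !mcoeffZ mcoeffX mulrCA.
by case: eqP => [->//|_]; rewrite !mulr0.
Qed.

(** The matrix is diag(1, c) times a unipotent one, and the diagonal substitution multiplies the
    coefficient of [m] by c to the Y-degree of [m]. With c = p this is the source of the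
    divisibility by p. *)
Lemma mcoeff_msubst_upper x (c : R) P m :
  (msubst (fun i => mx22 1 (x i) 0 c) P)@_m = c ^+ (\sum_i m (rshift f i)) *
    (msubst (fun i => mx22 1 (x i) 0 1) P)@_m.
Proof.
have -> : msubst (fun i => mx22 1 (x i) 0 c) P =
    msubst (fun=> mx22 1 0 0 c) (msubst (fun i => mx22 1 (x i) 0 1) P).
  rewrite msubst_comp; congr (msubst _ _); apply: funext => i; rewrite mulmx22.
  by rewrite !(mul0r, mulr0, mul1r, mulr1, addr0, add0r).
rewrite (mcoeff_msubst_diag (fun=> 1) (fun=> c)) big1 ?mul1r ?prodrXr // => i _.
exact: expr1n.
Qed.

Lemma mcoeff_msubst_scaleX (c : R) P m :
  (msubst (fun=> mx22 c 0 0 1) P)@_m = c ^+ (\sum_i m (lshift f i)) * P@_m.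
Proof.
rewrite (mcoeff_msubst_diag (fun=> c) (fun=> 1)) [X in _ * X * _]big1 ?mulr1 ?prodrXr // => i _.
exact: expr1n.
Qed.

(* prod_i (X_i + Y_i)^(r_i) *)
Definition binpoly r : {mpoly R[f + f]} :=
  msubst (fun=> mx22 1 1 0 1) 'X_[mXY (fun=> 0%N) r].

(** The image of Y^r is the product of the (b_i X_i + d_i Y_i)^(r_i), a diagonal substitution
    applied to [binpoly r]. The binomial coefficients stay inside one integral polynomial and are
    never computed. *)
Lemma mcoeff_msubst_Y r N m : (msubst N 'X_[mXY (fun=> 0%N) r])@_m =
  (\prod_i N i 0 1 ^+ m (lshift f i)) * (\prod_i N i 1 1 ^+ m (rshift f i)) *
  (binpoly r)@_m.
Proof.
rewrite -(mcoeff_msubst_diag (fun i => N i 0 1) (fun i => N i 1 1)) /binpoly msubst_comp.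
rewrite !msubstX; congr (_ * _)@_m.
  by apply: eq_bigr => i _; rewrite mXYE.
apply: eq_bigr => i _; congr ((_ *: _ + _ *: _) ^+ _); rewrite mx22E !mx22C.
  by rewrite mul0r mulr1 addr0.
by rewrite mul0r mulr1 add0r.
Qed.

Lemma msubst_X r N : (forall i, N i 0 0 = 1) -> (forall i, N i 1 0 = 0) ->
  msubst N 'X_[mXY r (fun=> 0%N)] = 'X_[mXY r (fun=> 0%N)].
Proof.
move=> N0 N1; rewrite msubstX mpolyXYE; congr (_ * _).
  by apply: eq_bigr => i _; rewrite N0 N1 mXYE scale1r scale0r addr0.
by rewrite !big1 // => i _; rewrite mXYE.
Qed.

Lemma meval_theta_up x y m i j n :
  'X_[(m + (U_(lshift f i) + U_(rshift f j) *+ n))%MM].@[pt2 x y] =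
  'X_[m].@[pt2 x y] * (x i * y j ^+ n).
Proof. by rewrite !mpolyXD -mpolyXn !mevalM rmorphXn /= !mevalXU pt2l pt2r. Qed.

Lemma meval_theta_dn x y m i j n :
  'X_[(m + (U_(rshift f i) + U_(lshift f j) *+ n))%MM].@[pt2 x y] =
  'X_[m].@[pt2 x y] * (y i * x j ^+ n).
Proof. by rewrite !mpolyXD -mpolyXn !mevalM rmorphXn /= !mevalXU pt2l pt2r. Qed.

Lemma meval_pt1XY y a b :
  'X_[mXY a b].@[pt2 (fun=> 1) y] = \prod_i y i ^+ b i.
Proof. by rewrite meval_pt2XY big1 ?mul1r // => i _; rewrite expr1n. Qed.

Lemma multihom_meval10 r P : P \in multihom r ->
  P.@[pt2 (fun=> 1) (fun=> 0)] = P@_(mXY r (fun=> 0%N)).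
Proof.
move=> /multihomE hP; rewrite [in LHS](mpolyE P) [in RHS](mpolyE P) (linear_sum (meval _)) (linear_sum (mcoeff _)) /=.
apply: eq_bigr => m _; rewrite mevalZ mcoeffZ mcoeffX.
have [hm|/hP->] := boolP (mhom r m); last by rewrite !mul0r.
rewrite (mhom_eqX hm) meval_pt2X big1 ?mul1r => [|i _]; last by rewrite expr1n.
case: forallP => [m0|/forallP].
  by rewrite big1 // => i _; rewrite (eqP (m0 i)).
rewrite negb_forall => /existsP[i nz].
by rewrite (bigD1 i) //= expr0n (negbTE nz) mul0r.
Qed.

Lemma mcoeff_binpolyX r : (binpoly r)@_(mXY r (fun=> 0%N)) = 1.
Proof.
rewrite -multihom_meval10; last first.
  apply/msubst_multihom/mpolyX_multihom/mhomP => i; first by rewrite !mXYE.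
rewrite meval_msubst meval_pt2XY !big1 ?mulr1 // => i _.
by rewrite !mx22C mulr1 mul0r addr0 expr1n.
Qed.

(* [mono r m = 0] when 'X_[m] does not have multidegree r. *)
Definition mono r m : Vpoly R r := insubd 0 'X_[m].

Lemma val_mono r m : Vval (mono r m) = if mhom r m then 'X_[m] else 0.
Proof.
rewrite /mono -/(val _) val_insubd.
case: ifP; case: ifP => // hm; last by rewrite mpolyX_multihom.
move/multihomE/(_ m); rewrite hm mcoeffX eqxx => /(_ isT)/eqP.
by rewrite oner_eq0.
Qed.

Lemma monoE r m : mhom r m -> Vval (mono r m) = 'X_[m].
Proof. by move=> hm; rewrite val_mono hm. Qed.

Lemma mono_out r m : ~~ mhom r m -> mono r m = 0.
Proof. by move=> /negbTE hm; apply: val_inj; rewrite /= val_mono hm. Qed.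

Lemma Vval_is_linear r : linear (@Vval f R r). Proof. by []. Qed.
HB.instance Definition _ r :=
  GRing.isLinear.Build R (Vpoly R r) {mpoly R[f + f]} *:%R (@Vval f R r) (@Vval_is_linear r).

Definition mbound r := (\sum_i r i).+1.

Lemma mhom_bound r m : mhom r m -> (mdeg m < mbound r)%N.
Proof. by move/mdeg_mhom->. Qed.

Lemma multihom_msize r P : P \in multihom r -> (msize P <= mbound r)%N.
Proof.
move=> /multihomE hP; rewrite msizeE; apply/bigmax_leqP_seq => m mP _.
apply: mhom_bound; apply: contraT => /hP/eqP.
by rewrite mcoeff_eq0 mP.
Qed.

Lemma Vpoly_expand r (P : Vpoly R r) :
  P = \sum_(m : bmultinom (f + f) (mbound r)) (Vval P)@_m *: mono r m.
Proof.
apply: val_inj; rewrite /= [RHS](linear_sum (@Vval f R r)) /=.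
rewrite {1}[Vval P](mpolywE (multihom_msize (valP P))); apply: eq_bigr => m _.
rewrite (val_mono r m); case: ifP => // /negbT hm.
by have /multihomE-> := valP P => //; rewrite !scale0r.
Qed.

Lemma Vpoly_mono_ind r (Q : Vpoly R r -> Prop) :
  (forall c u v, Q u -> Q v -> Q (c *: u + v)) -> (forall m, Q (mono r m)) ->
  forall P : Vpoly R r, Q P.
Proof.
move=> QD Qm P; rewrite [P]Vpoly_expand.
have Q0 : Q 0.
  rewrite -(addNr (mono r 0%MM)) -scaleN1r; exact: QD.
by elim/big_rec: _ => // m u _ Qu; apply: QD.
Qed.

End Polynomials.

(** * Valuations and Teichmueller lifts *)

Section ValuationTheory.
Variables (F : fieldType) (v : F -> rat).
Hypothesis val_v : is_valuation v.

Lemma v_ge0 N : v_ge v N 0. Proof. by rewrite /v_ge eqxx. Qed.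

Lemma v_geD N x y : v_ge v N x -> v_ge v N y -> v_ge v N (x + y).
Proof.
rewrite /v_ge.
have [->|nx] := eqVneq x 0; first by rewrite add0r.
have [->|ny] := eqVneq y 0; first by rewrite addr0 (negbTE nx).
have [//|nxy] := eqVneq (x + y) 0 => /= hx hy.
by apply: le_trans (proj2 val_v _ _ nx ny nxy); rewrite le_min hx.
Qed.

Lemma v_geM N M x y : v_ge v N x -> v_ge v M y -> v_ge v (N + M) (x * y).
Proof.
rewrite /v_ge mulf_eq0.
have [//|nx] := eqVneq x 0; have [//|ny] := eqVneq y 0 => /= hx hy.
by rewrite (proj1 val_v) // lerD.
Qed.

Lemma v_geMl N x y : v_int v x -> v_ge v N y -> v_ge v N (x * y).
Proof. by move=> hx hy; rewrite -[N]add0r; apply: v_geM. Qed.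

Lemma v_geMr N x y : v_ge v N x -> v_int v y -> v_ge v N (x * y).
Proof. by move=> hx hy; rewrite mulrC; apply: v_geMl. Qed.

Lemma v_ge_sum N (I : Type) (s : seq I) (Q : pred I) (G : I -> F) :
  (forall i, Q i -> v_ge v N (G i)) -> v_ge v N (\sum_(i <- s | Q i) G i).
Proof. by move=> hG; apply: (big_ind (v_ge v N)) => //; [exact: v_ge0 | exact: v_geD]. Qed.

Lemma v_int_prod (I : Type) (s : seq I) (Q : pred I) (G : I -> F) :
  (forall i, Q i -> v_int v (G i)) -> v_int v (\prod_(i <- s | Q i) G i).
Proof. by move=> hG; apply: (big_ind (v_int v)) => //; [exact: v_int1 | exact: v_intM]. Qed.

Lemma v_int_nat n : v_int v n%:R.
Proof.
elim: n => [|n ih]; first exact: v_int0.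
by rewrite -nat1r; apply: v_intD => //; apply: v_int1.
Qed.

Lemma v_max0 : v_max v 0. Proof. by rewrite /v_max eqxx. Qed.

Lemma v_maxD x y : v_max v x -> v_max v y -> v_max v (x + y).
Proof.
rewrite /v_max.
have [->|nx] := eqVneq x 0; first by rewrite add0r.
have [->|ny] := eqVneq y 0; first by rewrite addr0 (negbTE nx).
have [//|nxy] := eqVneq (x + y) 0 => /= hx hy.
by apply: lt_le_trans (proj2 val_v _ _ nx ny nxy); rewrite lt_min hx.
Qed.

Lemma v_maxMl x y : v_int v x -> v_max v y -> v_max v (x * y).
Proof.
rewrite /v_int /v_ge /v_max mulf_eq0.
have [//|nx] := eqVneq x 0; have [//|ny] := eqVneq y 0 => /= hx hy.
by rewrite (proj1 val_v) // ltr_wpDl.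
Qed.

Lemma v_maxMr x y : v_max v x -> v_int v y -> v_max v (x * y).
Proof. by move=> hx hy; rewrite mulrC; apply: v_maxMl. Qed.

Variables (k : fieldType) (j : F -> k).
Hypothesis jP : residue_morph v j.

Lemma resD x y : v_int v x -> v_int v y -> j (x + y) = j x + j y.
Proof. by have [[_ jD _] _] := jP; apply: jD. Qed.
Lemma resM x y : v_int v x -> v_int v y -> j (x * y) = j x * j y.
Proof. by have [[_ _ jM] _] := jP; apply: jM. Qed.
Lemma res1 : j 1 = 1. Proof. by have [[]] := jP. Qed.
Lemma res0 : j 0 = 0.
Proof. by have [_ j0] := jP; apply/j0; [exact: v_int0 | exact: v_max0]. Qed.
Lemma res_eq0 x : v_int v x -> j x = 0 <-> v_max v x.
Proof. by have [_] := jP; apply. Qed.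
Lemma resN x : v_int v x -> j (- x) = - j x.
Proof.
by move=> hx; apply/eqP; rewrite -addr_eq0 -resD ?addNr ?res0 //; apply: v_intN.
Qed.
Lemma resX x n : v_int v x -> j (x ^+ n) = j x ^+ n.
Proof.
by move=> hx; elim: n => [|n ih]; rewrite ?res1 // !exprS resM ?ih //; apply: v_intX.
Qed.
Lemma res_sum (I : Type) (s : seq I) (Q : pred I) (G : I -> F) :
  (forall i, Q i -> v_int v (G i)) ->
  j (\sum_(i <- s | Q i) G i) = \sum_(i <- s | Q i) j (G i).
Proof.
move=> hG; suff [] : v_int v (\sum_(i <- s | Q i) G i) /\
  j (\sum_(i <- s | Q i) G i) = \sum_(i <- s | Q i) j (G i) by [].
elim/big_ind2: _ => [|x1 x2 y1 y2 [i1 <-] [i2 <-]|i Qi].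
- by rewrite res0; split=> //; apply: v_int0.
- by rewrite resD //; split=> //; apply: v_intD.
- by split=> //; apply: hG.
Qed.
Lemma res_prod (I : Type) (s : seq I) (Q : pred I) (G : I -> F) :
  (forall i, Q i -> v_int v (G i)) ->
  j (\prod_(i <- s | Q i) G i) = \prod_(i <- s | Q i) j (G i).
Proof.
move=> hG; suff [] : v_int v (\prod_(i <- s | Q i) G i) /\
  j (\prod_(i <- s | Q i) G i) = \prod_(i <- s | Q i) j (G i) by [].
elim/big_ind2: _ => [|x1 x2 y1 y2 [i1 <-] [i2 <-]|i Qi].
- by rewrite res1; split=> //; apply: v_int1.
- by rewrite resM //; split=> //; apply: v_intM.
- by split=> //; apply: hG.
Qed.
Lemma res_nat n : j n%:R = n%:R.
Proof.
elim: n => [|n ih]; first exact: res0.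
by rewrite -[in LHS]nat1r resD ?v_int_nat ?v_int1 // ih res1 nat1r.
Qed.
Lemma res_eq x y : v_int v x -> v_int v y -> j x = j y <-> v_max v (x - y).
Proof.
move=> hx hy; have hN := v_intN val_v hy.
rewrite -res_eq0 ?v_intD // resD // resN //.
by split=> [->|/eqP]; [rewrite subrr | rewrite subr_eq0 => /eqP].
Qed.

End ValuationTheory.

Section Unramified.
Variables (p f : nat) (p_prime : prime p) (p_gt2 : (2 < p)%N) (f_gt0 : (0 < f)%N).
Variable L : unramified p f.
Notation v := (@ur_val p f L).
Notation red := (@ur_red p f L).
Let hv : is_valuation v := @ur_valP p f L.
Let hred : residue_morph v red := @ur_redP p f L.

Lemma p_odd : odd p.
Proof. by case: (even_prime p_prime) p_gt2 => // ->. Qed.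

Lemma q_odd : odd (p ^ f). Proof. by rewrite oddX p_odd orbT. Qed.

Lemma q_gt1 : (1 < p ^ f)%N.
Proof.
by apply: (leq_trans (prime_gt1 p_prime)); rewrite -[leqLHS]expn1 leq_pexp2l ?(prime_gt0 p_prime).
Qed.

Lemma q_split : (p ^ f = p * p ^ f.-1)%N.
Proof. by rewrite -expnS prednK. Qed.

(** Valuations in L are integers, so vanishing in the residue field means divisibility by p. This
    fails in a ramified E, which is why power sums are evaluated in L before being sent to E. *)
Lemma v_max_ge1 x : v_max v x -> v_ge v 1 x.
Proof.
rewrite /v_max /v_ge; have [//|nx] := eqVneq x 0 => /=.
by have /intrP[n ->] := ur_val_int nx; rewrite ltr0z ler1z -gtz0_ge1.
Qed.

Lemma v_p_max : v_max v p%:R.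
Proof. by rewrite /v_max v_p ltr01 orbT. Qed.

Lemma res_pchar : p \in [pchar (ur_res L)].
Proof.
rewrite inE p_prime -(res_nat hv hred); apply/eqP/(res_eq0 hred).
  exact: v_int_nat.
exact: v_p_max.
Qed.

Lemma v_q_ge1 : v_ge v 1 (p ^ f)%:R.
Proof.
rewrite q_split natrM; apply: v_geMr => //; last exact: v_int_nat.
exact/v_max_ge1/v_p_max.
Qed.

(* If x^q = x and y^q = y then x - y is a multiple of x - y by an element
   congruent to q x^(q-1) = 0. *)
Lemma root_unity_inj x y : v_int v x -> v_int v y ->
  x ^+ (p ^ f) = x -> y ^+ (p ^ f) = y -> red x = red y -> x = y.
Proof.
move=> ix iy xq yq e; have := subrXX x y (p ^ f); rewrite xq yq.
set s := \sum_(i < _) _ => sE.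
have is_ : v_int v s.
  by apply: v_ge_sum => // i _; apply: v_intM => //; apply: v_intX.
have s0 : red s = 0.
  rewrite (res_sum hv hred) => [|i _]; last by apply: v_intM => //; apply: v_intX.
  under eq_bigr => i _ do rewrite (resM hred) ?v_intX // !(resX hv hred) // e -exprD.
  rewrite (eq_bigr (fun=> red y ^+ (p ^ f).-1)) => [|i _].
    rewrite sumr_const card_ord -mulr_natl q_split natrM.
    by rewrite (pcharf0 res_pchar) !mul0r.
  by rewrite subnK // -ltnS (ltn_predK (ltn_ord i)).
have [//|] := eqVneq x y; rewrite -subr_eq0 => nxy.
have s1 : s = 1 by apply: (mulfI nxy); rewrite mulr1 -sE.
by move: s0; rewrite s1 (res1 hred) => /eqP; rewrite oner_eq0.
Qed.

Lemma teich_eq x l : v_int v x -> x ^+ (p ^ f) = x -> red x = l -> x = teich l.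
Proof.
move=> ix xq e; apply: root_unity_inj => //; rewrite ?teich_unity ?teich_red //.
exact: teich_int.
Qed.

Lemma teichN l : teich (- l) = - teich l :> L.
Proof.
have il := @teich_int p f L l.
apply/esym/teich_eq; first exact: v_intN.
  by rewrite exprNn -signr_odd q_odd expr1 mulN1r teich_unity.
by rewrite (resN hv hred) ?teich_red.
Qed.

Lemma teich0 : teich 0 = 0 :> L.
Proof.
apply/esym/teich_eq; first exact: v_int0.
  by rewrite expr0n gtn_eqF // ltnW ?q_gt1.
exact: res0 hred.
Qed.

Lemma frob_red x : v_int v x -> red (@frob p f L x) = red x ^+ p.
Proof.
move=> ix; rewrite -(resX hv hred) //; apply/(res_eq hv hred).
- exact: (@frob_int p f L 1).
- exact: v_intX.
- exact: frobP.
Qed.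

(** On a Teichmueller lift, Frobenius and the p-th power agree: both values are fixed by the q-th
    power and have the same reduction. *)
Lemma frob_teich i l : iter i (@frob p f L) (teich l) = teich l ^+ (p ^ i).
Proof.
elim: i => [|i ih]; first by rewrite expn0 expr1.
rewrite iterS ih rmorphXn /= expnS exprM; congr (_ ^+ _).
have il := @teich_int p f L l.
apply: root_unity_inj; first exact: (@frob_int p f L 1).
- exact: v_intX.
- by rewrite -rmorphXn teich_unity.
- by rewrite exprAC teich_unity.
- by rewrite frob_red // (resX hv hred).
Qed.

Lemma iter_frob_red i x : v_int v x -> red (iter i (@frob p f L) x) = red x ^+ (p ^ i).
Proof.
move=> ix; elim: i => [|i ih]; first by rewrite expn0 expr1.
by rewrite iterS frob_red ?frob_int // ih -exprM expnSr.
Qed.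

(** * Power sums over the residue field *)

Notation Fq := (ur_res L).

Lemma expq (x : Fq) : x ^+ (p ^ f) = x.
Proof. by rewrite -(@ur_res_card p f L) expf_card. Qed.

Lemma expr_mulq (x : Fq) n : (0 < n)%N -> (p ^ f - 1 %| n)%N -> x ^+ n = (x != 0)%:R.
Proof.
move=> n0 /dvdnP[c nE]; have [->|nx] := eqVneq x 0; first by rewrite expr0n gtn_eqF.
rewrite nE mulnC exprM; suff -> : x ^+ (p ^ f - 1) = 1 by rewrite expr1n.
by apply: (mulfI nx); rewrite -exprS subn1 prednK ?expq ?mulr1 // ltnW ?q_gt1.
Qed.

(** Positivity of n makes the term at 0 vanish; the q - 1 other terms are 1. *)
Lemma sum_expr_mulq n : (0 < n)%N -> (p ^ f - 1 %| n)%N -> \sum_(x : Fq) x ^+ n = -1.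
Proof.
move=> n0 dn; under eq_bigr do rewrite expr_mulq //.
rewrite (bigD1 0) //= eqxx add0r (eq_bigr (fun=> 1)) => [|x ->//].
rewrite sumr_const (eq_card (B := predC1 0)) //.
rewrite cardC1 ur_res_card -subn1 natrB ?(ltnW q_gt1) //.
by rewrite q_split natrM (pcharf0 res_pchar) mul0r sub0r.
Qed.

(** The substitution x -> - x changes the sign of the sum, and 2 is invertible. *)
Lemma sum_expr_odd n : odd n -> \sum_(x : Fq) x ^+ n = 0.
Proof.
move=> on; set s := \sum_(x : Fq) _.
have sN : s = - s.
  rewrite /s {1}(reindex_inj (@oppr_inj Fq)) /= -sumrN.
  by apply: eq_bigr => x _; rewrite exprNn -signr_odd on expr1 mulN1r.
have n2 : (2%:R : Fq) != 0.
  by rewrite -(dvdn_pcharf res_pchar) gtnNdvd.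
move/eqP: sN; rewrite -addr_eq0 -mulr2n -mulr_natl mulf_eq0 (negbTE n2).
by move/eqP.
Qed.

End Unramified.

(** * Base-p expansions *)

Section Digits.
Variables (p : nat) (p_gt0 : (0 < p)%N).

Lemma digits_lt f (a : 'I_f -> nat) : (forall i, a i < p)%N ->
  (\sum_i a i * p ^ i < p ^ f)%N.
Proof.
elim: f a => [|f ih] a ha; first by rewrite big_ord0.
rewrite big_ord_recr /= expnS.
apply: (@leq_trans ((a ord_max).+1 * p ^ f)); last by rewrite leq_mul.
by rewrite mulSn ltn_add2r; apply: (ih (fun i => a (widen_ord (leqnSn f) i))).
Qed.

Lemma digits_inj f (a b : 'I_f -> nat) : (forall i, a i < p)%N ->
  (forall i, b i < p)%N ->
  (\sum_i a i * p ^ i = \sum_i b i * p ^ i)%N -> a =1 b.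
Proof.
elim: f a b => [|f ih] a b ha hb; first by move=> _ [].
rewrite !big_ord_recl expn0 !muln1.
have E (c : 'I_f.+1 -> nat) : (\sum_(i < f) c (lift ord0 i) * p ^ bump 0 i =
    (\sum_(i < f) c (lift ord0 i) * p ^ i) * p)%N.
  by rewrite big_distrl; apply: eq_bigr => i _; rewrite /= expnSr mulnA.
rewrite !E => e.
have e0 : a ord0 = b ord0.
  by have := congr1 (modn^~ p) e; rewrite /= ![(_ + _ * p)%N]addnC !modnMDl !modn_small.
move: e; rewrite e0 => /addnI/eqP; rewrite eqn_pmul2r // => /eqP.
move/(ih (fun i => a (lift ord0 i)) (fun i => b (lift ord0 i))) => IH i.
by case: (unliftP ord0 i) => [j ->|->] //; apply: IH.
Qed.

End Digits.

(** * Recognizing elements of KZ *)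

Section KZelements.
Variables (p f : nat) (L : unramified p f).
Notation v := (@ur_val p f L).
Let hv : is_valuation v := @ur_valP p f L.

(** The inverse of A is integral, being the adjugate divided by a unit; n is recovered as half the
    valuation of det g. *)
Lemma KZ_intro (g : GL2 L) (A : 'M[L]_2) (n : int) :
  mx_int A -> \det A != 0 -> v (\det A) = 0 -> val g = p%:R ^ n *: A ->
  in_KZ g /\ K_part g = A.
Proof.
move=> iA nz v0 gE; have uA : A \in unitmx by rewrite unitmxE unitfE.
pose k := GL2Elt uA; have pn : (p%:R : L) ^ n != 0 by rewrite expfz_neq0 // p_neq0.
have Kk : in_K k.
  split=> // i j; rewrite val_GL2V /= /invmx uA mxE; apply: v_intM => //.
    by rewrite /v_int /v_ge vV // v0 oppr0 lexx orbT.
  rewrite mxE /cofactor; apply: v_intM => //.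
    by apply: v_intX => //; apply: v_intN => //; apply: v_int1.
  by rewrite det_mx11 !mxE.
split; first by apply/asboolP; exists k, (p%:R ^ n).
have := KZ_exp Kk pn gE; rewrite vXz ?p_neq0 // v_p mulr1 => /(@intr_inj rat) e.
by rewrite /K_part -e gE scalerA -expfzDr ?p_neq0 // addNr expr0z scale1r.
Qed.

Lemma gl22E (F : fieldType) (a b c d : F) : a * d - b * c != 0 ->
  val (gl22 a b c d) = mx22 a b c d.
Proof. by move=> nz; rewrite /gl22 insubdK // -topredE /= -/(_ \in unitmx) unitmxE det_mx22E unitfE. Qed.

Lemma mx_int22 a b c d : v_int v a -> v_int v b -> v_int v c -> v_int v d ->
  mx_int (mx22 a b c d).
Proof. by move=> *; apply: ord2P; apply: ord2P; rewrite !mx22C. Qed.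

End KZelements.

(** * The quotient Q *)

Lemma prod_frob_expr (R : comNzRingType) (p f : nat) (z : R) (n : 'I_f -> nat) :
  \prod_(i < f) (z ^+ (p ^ i)) ^+ n i = z ^+ (\sum_(i < f) n i * p ^ i).
Proof. by rewrite -prodrXr; apply: eq_bigr => i _; rewrite -exprM mulnC. Qed.

Lemma mulrv22 (R : comNzRingType) (w : 'rV[R]_2) (A : 'M[R]_2) j :
  (w *m A) 0 j = w 0 0 * A 0 j + w 0 1 * A 1 j.
Proof.
rewrite mxE !big_ord_recl big_ord0 addr0.
by congr (_ + w _ _ * A _ _); apply: val_inj.
Qed.

Section Residue.
Variables (p f : nat) (L : unramified p f) (C : coef_field L).
Notation v := (@ur_val p f L).
Notation vE := (@cf_val p f L C).
Notation k := (cf_res C).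
Notation Fq := (ur_res L).
Notation redL := (@ur_red p f L).
Notation redE := (@cf_red p f L C).
Let hv : is_valuation v := @ur_valP p f L.
Let hvE : is_valuation vE := @cf_valP p f L C.
Let hred : residue_morph v redL := @ur_redP p f L.
Let hredE : residue_morph vE redE := @cf_redP p f L C.

Lemma E_ge N (x : L) : v_ge v N x -> v_ge vE N (x%:A : C).
Proof.
rewrite /v_ge; have [->|nx] := eqVneq x 0; first by rewrite scale0r eqxx.
by rewrite cf_val_ext //= => ->; rewrite orbT.
Qed.

Lemma E_max (x : L) : v_max v x -> v_max vE (x%:A : C).
Proof.
rewrite /v_max; have [->|nx] := eqVneq x 0; first by rewrite scale0r eqxx.
by rewrite cf_val_ext //= => ->; rewrite orbT.
Qed.

(** The embedding of F_q in k. On integers of L, [redE] depends only on the reduction, so any lift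
    would do; the Teichmueller lift is a definite choice. *)
Definition res_emb_fun (l : Fq) : k := redE ((teich l)%:A).

Lemma res_emb_red (x : L) : v_int v x -> redE (x%:A) = res_emb_fun (redL x).
Proof.
move=> ix; have it := @teich_int p f L (redL x).
apply/(res_eq hvE hredE); try exact: E_int.
rewrite -(rmorphB (in_alg C)); apply: E_max.
by apply/(res_eq hv hred) => //; rewrite teich_red.
Qed.

Fact res_emb_zmod : zmod_morphism res_emb_fun.
Proof.
move=> x y; have ix := @teich_int p f L x; have iy := @teich_int p f L y.
have iN := v_intN hv iy.
rewrite -{1}[x](@teich_red p f L) -{1}[y](@teich_red p f L).
rewrite -(resN hv hred) // -(resD hred) // -res_emb_red; last exact: v_intD.
rewrite scalerBl (resD hredE) ?(resN hvE hredE) //; try exact: E_int.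
by apply: v_intN => //; apply: E_int.
Qed.
Fact res_emb_monoid : monoid_morphism res_emb_fun.
Proof.
split; first by rewrite -{1}(res1 hred) -res_emb_red ?scale1r ?(res1 hredE) //; apply: v_int1.
move=> x y; have ix := @teich_int p f L x; have iy := @teich_int p f L y.
rewrite -{1}[x](@teich_red p f L) -{1}[y](@teich_red p f L).
rewrite -(resM hred) // -res_emb_red; last exact: v_intM.
rewrite [(_ * _)%:A](rmorphM (in_alg C)) (resM hredE) //; exact: E_int.
Qed.
HB.instance Definition _ := GRing.isZmodMorphism.Build Fq k res_emb_fun res_emb_zmod.
HB.instance Definition _ := GRing.isMonoidMorphism.Build Fq k res_emb_fun res_emb_monoid.
Definition res_emb : {rmorphism Fq -> k} := res_emb_fun.

Lemma redE_alg (x : L) : v_int v x -> redE (x%:A) = res_emb (redL x).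
Proof. exact: res_emb_red. Qed.

(** The i-th pair of variables is evaluated at the i-th Frobenius twist of w, the twist through
    which K acts on the i-th tensor factor. *)
Definition ptw (w : 'rV[Fq]_2) : 'I_(f + f) -> k :=
  pt2 (fun i => res_emb (w 0 0) ^+ (p ^ i)) (fun i => res_emb (w 0 1) ^+ (p ^ i)).

Definition row2 (x y : Fq) : 'rV[Fq]_2 := \row_j (if j == 0 then x else y).
Lemma row2_0 x y : row2 x y 0 0 = x. Proof. by rewrite mxE. Qed.
Lemma row2_1 x y : row2 x y 0 1 = y. Proof. by rewrite mxE. Qed.
Lemma row2P (u w : 'rV[Fq]_2) : u 0 0 = w 0 0 -> u 0 1 = w 0 1 -> u = w.
Proof. by move=> e0 e1; apply/rowP; apply: ord2P. Qed.

Lemma sum_row2 (G : 'rV[Fq]_2 -> k) : \sum_w G w = \sum_x \sum_y G (row2 x y).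
Proof.
rewrite pair_bigA /=; apply: (reindex (fun u : Fq * Fq => row2 u.1 u.2)).
exists (fun w : 'rV[Fq]_2 => (w 0 0, w 0 1)) => [[x y]|w] _ /=.
  by rewrite row2_0 row2_1.
by apply: row2P; rewrite ?row2_0 ?row2_1.
Qed.

(** * Elements of V_r as functions on F_q^2 *)

Section Weights.
Hypotheses (p_prime : prime p) (p_gt2 : (2 < p)%N) (f_gt0 : (0 < f)%N).
Variable r : 'I_f -> nat.
Hypothesis r_ge : forall i, (p <= r i)%N.
Let rsum := (\sum_(i < f) r i * p ^ i)%N.
Hypothesis r_dvd : (p ^ f - 1 %| rsum)%N.

Let r_gt0 i : (0 < r i)%N. Proof. exact: leq_trans (prime_gt0 p_prime) (r_ge i). Qed.
Let i0 : 'I_f := Ordinal f_gt0.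

Lemma rsum_gt0 : (0 < rsum)%N.
Proof.
rewrite /rsum (bigD1 i0) //= ltn_addr // muln_gt0 r_gt0 expn_gt0.
by rewrite prime_gt0.
Qed.

Lemma frobD (x y : Fq) i : (x + y) ^+ (p ^ i) = x ^+ (p ^ i) + y ^+ (p ^ i).
Proof.
apply: exprDn_pchar; rewrite pnatX; apply/orP; left.
by rewrite pnatE //; apply: res_pchar.
Qed.

(** The i-th matrix of the substitution is the i-th twist of g mod p. Frobenius powers are additive
    on F_q, so the twist can be taken outside, which leaves the product of the row w by g mod p. *)
Lemma ptw_act (g : KZ L) (P : {mpoly k[f + f]}) w :
  (msubst (K_subst (fun x : L => redE x%:A) (K_part g)) P).@[ptw w] =
  P.@[ptw (w *m map_mx redL (K_part g))].
Proof.
have iK := K_part_int (valP g).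
have e i a b : K_subst (fun x : L => redE x%:A) (K_part g) i a b =
    res_emb (redL (K_part g a b) ^+ (p ^ i)).
  by rewrite mxE redE_alg ?iter_frob_red //; apply: frob_int.
rewrite meval_msubst; apply: meval_eq; apply: lrshiftP => i.
  rewrite /ptw !pt2l !e -!(rmorphXn res_emb) -!rmorphM -rmorphD -!exprMn -frobD.
  congr (res_emb (_ ^+ _)).
  by rewrite mulrv22 [in RHS]mxE [X in _ = _ + _ * X]mxE.
rewrite /ptw !pt2r !e -!(rmorphXn res_emb) -!rmorphM -rmorphD -!exprMn -frobD.
congr (res_emb (_ ^+ _)).
by rewrite mulrv22 [in RHS]mxE [X in _ = _ + _ * X]mxE.
Qed.

Lemma pred_frob (z : Fq) (i : 'I_f) : (z ^+ (p ^ ord_pred i)) ^+ p = z ^+ (p ^ i).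
Proof.
rewrite -exprM -expnSr /=; case: i => -[|i] lti /=.
  (* For i = 0 the predecessor is f - 1 and the exponent is p^f = q, which acts trivially on F_q. *)
  have e : ((0 + f).-1 %% f).+1 = f by rewrite add0n modn_small ?prednK // ltn_predL.
  by rewrite e expn0 expr1 expq.
by rewrite modnDr modn_small // ltnW.
Qed.

Lemma theta_ptw i w : (theta_poly C i).@[ptw w] = 0.
Proof.
rewrite /theta_poly /ptw mevalB !mevalM !rmorphXn /= !mevalXU !pt2l !pt2r -!rmorphXn /=.
by rewrite !pred_frob !rmorphXn mulrC subrr.
Qed.

Definition in_theta (P : {mpoly k[f + f]}) :=
  exists Q, P = \sum_(i < f) theta_poly C i * Q i.

Lemma in_theta0 : in_theta 0.
Proof. by exists (fun=> 0); rewrite big1 // => i _; rewrite mulr0. Qed.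

Lemma in_thetaD P Q : in_theta P -> in_theta Q -> in_theta (P + Q).
Proof.
case=> P' -> [Q' ->]; exists (fun i => P' i + Q' i); rewrite -big_split.
by apply: eq_bigr => i _; rewrite mulrDr.
Qed.

Lemma in_thetaZ c P : in_theta P -> in_theta (c *: P).
Proof.
case=> P' ->; exists (fun i => c *: P' i); rewrite scaler_sumr.
by apply: eq_bigr => i _; rewrite scalerAr.
Qed.

Lemma in_theta_gen i P : in_theta (theta_poly C i * P).
Proof.
exists (fun j => if j == i then P else 0); rewrite (bigD1 i) //= eqxx big1 ?addr0 //.
by move=> j /negbTE->; rewrite mulr0.
Qed.

(* A carry replaces X_{i-1}^p Y_i by Y_{i-1}^p X_i; the X-degree drops by p - 1,
   and when no carry is possible the X-exponents are base-p digits, or m is X^r. *)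
Lemma theta_normal_form m : mhom r m -> exists m', [/\ mhom r m',
  in_theta ('X_[m] - 'X_[m']) &
  m' = mXY r (fun=> 0%N) \/ forall i, (m' (lshift f i) < p)%N].
Proof.
have [n] := ubnP (\sum_i m (lshift f i)).
elim: n m => // n ih m ltn hm; have /mhomP hm' := hm.
have [/existsP[i /andP[ai bi]]|no] := boolP [exists i,
    (p <= m (lshift f (ord_pred i)))%N && (0 < m (rshift f i))%N].
  pose dn := (U_(rshift f i) + U_(lshift f (ord_pred i)) *+ p)%MM.
  pose up := (U_(lshift f i) + U_(rshift f (ord_pred i)) *+ p)%MM.
  have dnl j : dn (lshift f j) = ((ord_pred i == j) * p)%N.
    by rewrite mnmDE mulmnE !mnm1E eq_rlshift (inj_eq (@lshift_inj _ _)).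
  have dnr j : dn (rshift f j) = (i == j).
    by rewrite mnmDE mulmnE !mnm1E eq_lrshift (inj_eq (@rshift_inj _ _)) addn0.
  have upl j : up (lshift f j) = (i == j).
    by rewrite mnmDE mulmnE !mnm1E eq_rlshift (inj_eq (@lshift_inj _ _)) addn0.
  have upr j : up (rshift f j) = ((ord_pred i == j) * p)%N.
    by rewrite mnmDE mulmnE !mnm1E eq_lrshift (inj_eq (@rshift_inj _ _)).
  have le : (dn <= m)%MM.
    apply/mnm_lepP; apply: lrshiftP => j; rewrite ?dnl ?dnr.
      by case: eqP => [<-|_]; rewrite ?mul1n ?mul0n.
    by case: eqP => [<-|_].
  pose m1 := (m - dn + up)%MM.
  have E j : ((m - dn)%MM (lshift f j) + dn (lshift f j))%N = m (lshift f j).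
    by rewrite -mnmDE submK.
  have E' j : ((m - dn)%MM (rshift f j) + dn (rshift f j))%N = m (rshift f j).
    by rewrite -mnmDE submK.
  have m1l j : m1 (lshift f j) = ((m - dn)%MM (lshift f j) + (i == j))%N.
    by rewrite -upl -mnmDE.
  have m1r j : m1 (rshift f j) = ((m - dn)%MM (rshift f j) + (ord_pred i == j) * p)%N.
    by rewrite -upr -mnmDE.
  have [||m' [hm1 t1 nf]] := ih m1.
  - rewrite ltnS in ltn; apply: (leq_trans _ ltn).
    under eq_bigr do rewrite m1l; under [X in (_ < X)%N]eq_bigr do rewrite -E dnl.
    rewrite !big_split /= -!addnS leq_add2l.
    rewrite (bigD1 i) //= eqxx big1 ?addn0 => [|j]; last by rewrite eq_sym => /negbTE->.
    rewrite (bigD1 (ord_pred i)) //= eqxx big1 ?addn0 ?mul1n ?prime_gt1 // => j.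
    by rewrite eq_sym => /negbTE->.
  - apply/mhomP => j; rewrite m1l m1r -hm' -E -E' dnl dnr.
    by rewrite addnACA [RHS]addnACA; congr (_ + _)%N; rewrite addnC.
  exists m'; split=> //.
  have -> : 'X_[m] - 'X_[m'] = ('X_[m] - 'X_[m1]) + ('X_[m1] - 'X_[m']) :> {mpoly k[f + f]}.
    by rewrite addrA subrK.
  apply: in_thetaD => //.
  have -> : 'X_[m] - 'X_[m1] = theta_poly C i * (- 'X_[m - dn]) :> {mpoly k[f + f]}.
    rewrite -{1}(submK le) /m1 !mpolyXD -!mpolyXn /theta_poly /varX /varY.
    by rewrite -mulrBr mulrN -mulNr opprB mulrC.
  exact: in_theta_gen.
exists m; split=> //; first by rewrite subrr; apply: in_theta0.
have no' i : (p <= m (lshift f (ord_pred i)))%N -> m (rshift f i) = 0%N.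
  move=> le; move/existsPn: no => /(_ i); rewrite le /=.
  by rewrite -eqn0Ngt => /eqP.
have [/existsP[i bi]|small] := boolP [exists i, (p <= m (lshift f i))%N]; last first.
  by right=> i; move/existsPn: small => /(_ i); rewrite -ltnNge.
left; apply/eqP; rewrite (mhom_eqX hm); apply/'forall_eqP.
(* When no carry is possible, a large X-exponent at j forces the Y-exponent at j + 1 to be 0, so the
   X-exponent there is the whole of r_(j+1), again at least p. Going round the cycle, all
   Y-exponents vanish. *)
have step j : (p <= m (lshift f j))%N -> (p <= m (lshift f (ordS j)))%N.
  move=> le; have := hm' (ordS j); rewrite no' ?ordSK // addn0 => ->.
  exact: r_ge.
have all_big n' : (p <= m (lshift f (iter n' (@ordS f) i)))%N.
  by elim: n' => //= n' h; apply: step.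
move=> j; apply: no'.
(* The number of steps from i to the predecessor of j; adding f keeps the subtraction of i exact in
   the natural numbers. *)
have -> : ord_pred j = iter (ord_pred j + f - i)%N (@ordS f) i; last exact: all_big.
have it n' : iter n' (@ordS f) i = ((i + n') %% f)%N :> nat.
  elim: n' => [|n' h] /=; first by rewrite addn0 modn_small.
  by rewrite h -[in LHS]addn1 modnDml addn1 addnS.
apply: val_inj; rewrite /= it subnKC ?modnDr ?modn_mod //.
by apply: leq_trans (ltnW (ltn_ord i)) (leq_addl _ _).
Qed.

Lemma ptw10 : ptw (row2 1 0) =1 pt2 (fun=> 1) (fun=> 0).
Proof.
move=> l; elim/lrshiftP: l => i; rewrite /ptw ?pt2l ?pt2r ?row2_0 ?row2_1.
  by rewrite rmorph1 expr1n.
by rewrite rmorph0 expr0n expn_eq0 (gtn_eqF (prime_gt0 p_prime)).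
Qed.

Lemma in_theta_ptw P w : in_theta P -> P.@[ptw w] = 0.
Proof.
by case=> Q ->; rewrite rmorph_sum big1 // => i _; rewrite rmorphM /= theta_ptw mul0r.
Qed.

(** In normal form, the coefficient of X^r is the value at (1, 0), hence 0. The other monomials have
    base-p digits as X-exponents, so on the points (x, 1) they restrict to distinct powers of x of
    degree less than q. A polynomial of degree less than q with q roots is 0. *)
Lemma in_theta_ker P : P \in multihom r -> (forall w, P.@[ptw w] = 0) -> in_theta P.
Proof.
move=> /multihomE hP P0.
have [nf nfP] : exists nf : 'X_{1..f + f} -> 'X_{1..f + f}, forall m, mhom r m ->
    [/\ mhom r (nf m), in_theta ('X_[m] - 'X_[nf m]) &
    nf m = mXY r (fun=> 0%N) \/ forall i, (nf m (lshift f i) < p)%N].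
  suff /choice[nf nfP] : forall m, exists m', mhom r m -> [/\ mhom r m',
    in_theta ('X_[m] - 'X_[m']) &
    m' = mXY r (fun=> 0%N) \/ forall i, (m' (lshift f i) < p)%N] by exists nf.
  move=> m; have [/theta_normal_form[m' hm']|] := boolP (mhom r m); last by exists m.
  by exists m'.
have hom m : m \in msupp P -> mhom r m.
  by move=> mP; apply: contraT => /hP/eqP; rewrite mcoeff_eq0 mP.
pose D := \sum_(m <- msupp P) P@_m *: ('X_[nf m] : {mpoly k[f + f]}).
have PD : in_theta (P - D).
  rewrite {1}[P]mpolyE -sumrB big_seq; apply: big_ind => [|? ?|m mP].
  - exact: in_theta0.
  - exact: in_thetaD.
  - by rewrite -scalerBr; apply: in_thetaZ; case: (nfP m (hom m mP)).
have Dhom : D \in multihom r.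
  rewrite /D big_seq; apply: rpred_sum => m mP; apply: rpredZ.
  by apply: mpolyX_multihom; case: (nfP m (hom m mP)).
have Dsupp m : m \in msupp D -> mhom r m /\
    (m = mXY r (fun=> 0%N) \/ forall i, (m (lshift f i) < p)%N).
  rewrite mcoeff_msupp => nz.
  have [m0 m0P e] : exists2 m0, m0 \in msupp P & nf m0 = m.
    apply: contrapT => no; case/eqP: nz; rewrite /D (linear_sum (mcoeff m)) /=.
    rewrite big1_seq // => m0 /andP[_ m0P]; rewrite mcoeffZ mcoeffX.
    by case: eqP => [e|_]; [case: no; exists m0 | rewrite mulr0].
  by rewrite -e; case: (nfP m0 (hom m0 m0P)).
have D0 w : D.@[ptw w] = 0.
  have := in_theta_ptw w PD.
  by rewrite mevalB P0 sub0r => /eqP; rewrite oppr_eq0 => /eqP.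
have DX : D@_(mXY r (fun=> 0%N)) = 0.
  by rewrite -(multihom_meval10 Dhom) -(meval_eq D ptw10).
have Dsmall m : m \in msupp D -> forall i, (m (lshift f i) < p)%N.
  move=> mD; case: (Dsupp m mD) => _ [mX|//].
  by move: mD; rewrite mcoeff_msupp mX DX eqxx.
pose A (m : 'X_{1..f + f}) := (\sum_i m (lshift f i) * p ^ i)%N.
have Ainj : {in msupp D &, injective A}.
  move=> m m' mD mD' eA.
  have e := digits_inj (prime_gt0 p_prime) (Dsmall m mD) (Dsmall m' mD') eA.
  have [/mhomP h _] := Dsupp m mD; have [/mhomP h' _] := Dsupp m' mD'.
  by apply: mnmXY => // i; apply: (@addnI (m (lshift f i))); rewrite h e h'.
pose G : {poly k} := \sum_(m <- msupp D) D@_m *: 'X^(A m).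
have G0 : G = 0.
  apply/eqP; apply: contraT => nzG.
  have := @max_poly_roots _ G [seq res_emb x | x <- enum Fq] nzG.
  rewrite size_map -cardE ur_res_card map_inj_uniq ?enum_uniq; last exact: fmorph_inj.
  have -> : all (root G) [seq res_emb x | x <- enum Fq].
    apply/allP => _ /mapP[x _ ->]; apply/eqP.
    rewrite -[RHS](D0 (row2 x 1)) [in RHS](mpolyE D) (linear_sum (meval _)) horner_sum /=.
    apply: eq_bigr => m _; rewrite hornerZ hornerXn mevalZ /ptw meval_pt2X.
    rewrite row2_0 row2_1 rmorph1 prod_frob_expr [X in _ * (_ * X)]big1 ?mulr1 //.
    by move=> i _; rewrite !expr1n.
  move=> /(_ isT isT); rewrite ltnNge.
  have -> // : (size G <= p ^ f)%N.
  rewrite (leq_trans (size_sum _ _ _)) //; apply/bigmax_leqP_seq => m mD _.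
  rewrite (leq_trans (size_scale_leq _ _)) // size_polyXn.
  exact: digits_lt (Dsmall m mD).
suff D00 : D = 0 by rewrite -[P]subr0 -D00.
apply/mpolyP => m; rewrite mcoeff0; apply/eqP; rewrite mcoeff_eq0.
apply/negP => mD; have := congr1 (fun q : {poly k} => q`_(A m)) G0.
rewrite coef0 coef_sum (bigD1_seq m) ?msupp_uniq //= coefZ coefXn eqxx mulr1.
rewrite big1_seq ?addr0 => [e|m' /andP[ne m'D]].
  by move: mD; rewrite mcoeff_msupp e eqxx.
rewrite coefZ coefXn; case: eqP => [/Ainj e|]; last by rewrite mulr0.
by case/eqP: ne; rewrite e.
Qed.

Definition ev_sum (P : V_k C r) : k^o := - \sum_w (Vval P).@[ptw w].

Lemma map_redM A B : mx_int A -> mx_int B ->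
  map_mx redL (A *m B) = map_mx redL A *m map_mx redL B.
Proof.
move=> hA hB; apply/matrixP => i j; rewrite mx22E mxE mx22E.
rewrite (resD hred); try by apply: v_intM.
by rewrite !(resM hred) //; congr (_ * _ + _ * _); rewrite mxE.
Qed.

Lemma ev_sum_act (g : KZ L) P : ev_sum (ract g P) = ev_sum P.
Proof.
rewrite /ev_sum; congr (- _).
pose A := map_mx redL (K_part (val g)); pose B := map_mx redL (K_part (val g^-1%g)).
have Kg := valP g; have Kg' := valP g^-1%g.
have r1 : map_mx redL (1%:M : 'M[L]_2) = 1%:M.
  by apply/matrixP => i j; rewrite !mxE; case: (i == j); rewrite ?(res1 hred) ?(res0 hred).
have AB : A *m B = 1%:M.
  by rewrite -map_redM -?K_partM -?valM ?mulgV ?val1 ?K_part1 //; apply: K_part_int.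
have BA : B *m A = 1%:M.
  by rewrite -map_redM -?K_partM -?valM ?mulVg ?val1 ?K_part1 //; apply: K_part_int.
rewrite [RHS](reindex (fun w => w *m A)) /=; last first.
  by exists (fun w => w *m B) => w _; rewrite -mulmxA ?AB ?BA mulmx1.
by apply: eq_bigr => w _; rewrite ptw_act.
Qed.

Lemma multihom_ptwZ P c w : P \in multihom r ->
  P.@[ptw (c *: w)] = res_emb (c ^+ rsum) * P.@[ptw w].
Proof.
move=> /multihomE hP; pose d i := res_emb c ^+ (p ^ i).
have e : msubst (fun i => mx22 (d i) 0 0 (d i)) P = res_emb (c ^+ rsum) *: P.
  apply/mpolyP => m; rewrite mcoeff_msubst_diag mcoeffZ -big_split /=.
  have [/mhomP hm|/hP->] := boolP (mhom r m); last by rewrite !mulr0.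
  under eq_bigr do rewrite -exprD hm.
  by rewrite prod_frob_expr rmorphXn.
rewrite -mevalZ -e meval_msubst; apply: meval_eq => l.
by elim/lrshiftP: l => i; rewrite /ptw ?pt2l ?pt2r !mx22C !mxE rmorphM exprMn
  !(mulr0, addr0, add0r) mulrC.
Qed.

Lemma multihom_ptw0 P : P \in multihom r -> P.@[ptw 0] = 0.
Proof.
move=> hP; rewrite -[0](scale0r 0) multihom_ptwZ // expr0n gtn_eqF ?rsum_gt0 //.
by rewrite rmorph0 mul0r.
Qed.

Lemma mhomX : mhom r (mXY r (fun=> 0%N)).
Proof. by apply/mhomP => i; rewrite !mXYE addn0. Qed.
Lemma mhomY : mhom r (mXY (fun=> 0%N) r).
Proof. by apply/mhomP => i; rewrite !mXYE. Qed.

(** The function w -> (a w_0 + c w_1)^rsum, that is the twisted product (a X + c Y)^r. Only the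
    first columns act on X^r; zero second columns keep the definition uniform, even at a = c = 0. *)
Definition linpow (a c : Fq) : V_k C r :=
  Vsubst (fun i => mx22 (res_emb a ^+ (p ^ i)) 0 (res_emb c ^+ (p ^ i)) 0)
    (mono k r (mXY r (fun=> 0%N))).

Lemma linpow_ptw a c w :
  (Vval (linpow a c)).@[ptw w] = res_emb ((w 0 0 * a + w 0 1 * c) ^+ rsum).
Proof.
rewrite /= (monoE _ mhomX) meval_msubst meval_pt2XY [X in _ * X]big1 ?mulr1 //.
rewrite rmorphXn -prod_frob_expr; apply: eq_bigr => i _; rewrite !mx22C.
by rewrite -!(rmorphXn res_emb) -!rmorphM -rmorphD -!exprMn -frobD -(rmorphXn res_emb).
Qed.

(** The column ([a], [c]) is completed by (0, 1) or (1, 0) to a matrix of K; its determinant is, up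
    to sign, the lift of a nonzero element. *)
Lemma linpow_X_sub a c : (a != 0) || (c != 0) -> linpow a c \in @X_sub p f L C r.
Proof.
move=> nz.
have [A [iA A00 A10 vA nA]] : exists A : 'M[L]_2, [/\ mx_int A, A 0 0 = teich a,
    A 1 0 = teich c, v (\det A) = 0 & \det A != 0].
  have u0 : v_int v (0 : L) by apply: v_int0.
  have u1 : v_int v (1 : L) by apply: v_int1.
  have vt (x : Fq) : x != 0 -> teich x != 0 :> L /\ v (teich x) = 0.
    move=> nx; have := @teich_int p f L x; rewrite /v_int /v_ge.
    have := res_eq0 hred (@teich_int p f L x); rewrite teich_red /v_max.
    case: eqP => [_ [_ /(_ isT) x0]|_ /=]; first by rewrite x0 eqxx in nx.
    move=> [_ h] ge; split=> //; apply/eqP; rewrite eq_le ge andbT leNgt.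
    by apply/negP => /h x0; rewrite x0 eqxx in nx.
  have [a0|na] := eqVneq a 0; last first.
    exists (mx22 (teich a) 0 (teich c) 1); rewrite det_mx22E !mx22C mulr1 mul0r subr0.
    by have [nt vt0] := vt a na; split=> //; apply: mx_int22 => //; apply: teich_int.
  move: nz; rewrite a0 eqxx /= => nc; have [nt vt0] := vt c nc.
  exists (mx22 (teich 0) 1 (teich c) 0); rewrite det_mx22E !mx22C mulr0 mul1r sub0r.
  split=> //; first by apply: mx_int22 => //; apply: teich_int.
    by rewrite -mulN1r (proj1 hv) ?vN1 ?oppr_eq0 ?oner_eq0 // add0r.
  by rewrite oppr_eq0.
have uA : A \in unitmx by rewrite unitmxE unitfE.
have [|Kg KE] := @KZ_intro p f L (GL2Elt uA) A 0 iA nA vA; first by rewrite scale1r.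
apply: span_of_gen; exists (KZElt Kg), (mono k r (mXY r (fun=> 0%N))); split.
  rewrite monoE ?mhomX // mpolyXYE [X in _ * X]big1 ?mulr1 //.
apply: val_inj; rewrite /= (monoE _ mhomX) !msubstX.
rewrite [X in _ * X]big1 => [|i _]; last by rewrite mXYE expr0.
rewrite [X in _ = _ * X]big1 => [|i _]; last by rewrite mXYE expr0.
congr (_ * _); apply: eq_bigr => i _; rewrite !mx22C KE.
have e x : redE ((iter i (@frob p f L) (teich x))%:A) = res_emb x ^+ (p ^ i).
  rewrite redE_alg; last by apply/frob_int/teich_int.
  by rewrite iter_frob_red ?teich_red ?rmorphXn //; apply: teich_int.
by rewrite /K_subst [map_mx _ _ 0 0]mxE [map_mx _ _ 1 0]mxE A00 A10 !e.
Qed.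

(** On the line of z one has P (c z) = c^rsum P (z), and the sum of c^rsum over F_q is -1. *)
Lemma sum_colinear (P : {mpoly k[f + f]}) (z : 'rV[Fq]_2) : P \in multihom r -> z != 0 ->
  \sum_(w : 'rV[Fq]_2 | z 0 0 * w 0 1 - z 0 1 * w 0 0 == 0) P.@[ptw w] = - P.@[ptw z].
Proof.
move=> hP nz.
(* The scalar c with w = c z, read off from a nonzero coordinate of z. *)
pose inv (w : 'rV[Fq]_2) := if z 0 0 != 0 then w 0 0 / z 0 0 else w 0 1 / z 0 1.
have nz1 : z 0 0 = 0 -> z 0 1 != 0.
  by move=> z0; apply: contraNneq nz => z1; apply/eqP/row2P; rewrite mxE.
rewrite (reindex_onto (fun c => c *: z) inv) /=.
  rewrite (eq_bigl predT) => [|c].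
    under eq_bigr do rewrite multihom_ptwZ //.
    by rewrite -mulr_suml -rmorph_sum sum_expr_mulq ?rsum_gt0 // rmorphN1 mulN1r.
  rewrite !mxE mulrCA [z 0 1 * _]mulrCA [z 0 1 * _]mulrC subrr eqxx /= /inv !mxE.
  have [z0|n0] := eqVneq (z 0 0) 0; last by rewrite mulfK // eqxx.
  by rewrite /= mulfK ?eqxx // nz1.
move=> w; rewrite subr_eq0 => /eqP e; rewrite /inv.
have [z0|n0] := eqVneq (z 0 0) 0; apply: row2P; rewrite mxE /=.
- move: e; rewrite z0 mul0r mulr0 => /esym/eqP.
  by rewrite mulf_eq0 (negbTE (nz1 z0)) => /eqP.
- by rewrite divfK // nz1.
- by rewrite divfK.
- by rewrite mulrAC -[w 0 0 * _]mulrC -e mulrAC mulfV // mul1r.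
Qed.

(** Since (z_0 w_1 - z_1 w_0)^rsum is 0 when w is proportional to z and 1 otherwise, [P2] at z is
    the sum of P (w) over the w off the line of z. The sum over all w is 0, so this is minus the sum
    over the line, which is P (z) by [sum_colinear]. Hence P - P2 vanishes on F_q^2. *)
Lemma ev_sum_ker (P : V_k C r) : ev_sum P = 0 ->
  exists P1 P2 : V_k C r, [/\ V_star P1, P2 \in @X_sub p f L C r & P = P1 + P2].
Proof.
move=> /eqP; rewrite oppr_eq0 => /eqP eP; have hP : Vval P \in multihom r := valP P.
pose P2 : V_k C r := \sum_w (Vval P).@[ptw w] *: linpow (w 0 1) (- w 0 0).
exists (P - P2), P2; split; last by rewrite subrK.
  apply: in_theta_ker; first exact: valP.
  move=> z; rewrite /= mevalB; apply/eqP; rewrite subr_eq0; apply/eqP.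
  have -> : Vval P2 = \sum_w (Vval P).@[ptw w] *: Vval (linpow (w 0 1) (- w 0 0)).
    exact: (linear_sum (@Vval f k r)).
  rewrite (linear_sum (meval _)) /=.
  under eq_bigr do rewrite mevalZ linpow_ptw mulrN expr_mulq ?rsum_gt0 //.
  have [->|nz] := eqVneq z 0.
    rewrite multihom_ptw0 // big1 // => w _.
    by rewrite !mxE !mul0r subr0 eqxx rmorph0 mulr0.
  rewrite -[LHS]opprK -sum_colinear // -[LHS]add0r -{1}eP.
  rewrite [X in X - _](bigID (fun w : 'rV[Fq]_2 => z 0 0 * w 0 1 - z 0 1 * w 0 0 == 0)) /=.
  rewrite addrAC subrr add0r big_mkcond; apply: eq_bigr => w _.
  by case: eqP => _; rewrite ?rmorph0 ?rmorph1 ?mulr0 ?mulr1.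
apply: rpred_sum => w _; have [->|nw] := eqVneq w 0.
  by rewrite multihom_ptw0 // scale0r rpred0.
apply: rpredZ; apply: linpow_X_sub; rewrite oppr_eq0.
apply: contraNT nw; rewrite negb_or !negbK => /andP[/eqP w1 /eqP w0].
by apply/eqP/row2P; rewrite mxE.
Qed.

Definition mM := mXY (fun _ : 'I_f => p.-1) (fun i => r i - p.-1)%N.

Lemma pred_lt_r i : (p.-1 < r i)%N.
Proof. by rewrite (leq_trans _ (r_ge i)) // prednK // prime_gt0. Qed.

Lemma mhomM : mhom r mM.
Proof. by apply/mhomP => i; rewrite !mXYE subnKC // ltnW // pred_lt_r. Qed.

Let Bsum := (\sum_(i < f) (r i - p.-1) * p ^ i)%N.

Lemma sum_digitsM : (\sum_(i < f) p.-1 * p ^ i = p ^ f - 1)%N.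
Proof. by rewrite -big_distrr /= subn1 predn_exp. Qed.

Lemma Bsum_gt0 : (0 < Bsum)%N.
Proof.
rewrite /Bsum (bigD1 i0) //= ltn_addr // muln_gt0 subn_gt0 pred_lt_r expn_gt0.
by rewrite prime_gt0.
Qed.

Lemma rsum_split : rsum = (p ^ f - 1 + Bsum)%N.
Proof.
rewrite -sum_digitsM /Bsum -big_split; apply: eq_bigr => i _ /=.
by rewrite -mulnDl subnKC // ltnW // pred_lt_r.
Qed.

(** At (x, y) the monomial takes the value x^(q-1) y^B with B a positive multiple of q - 1, so the
    double sum is (-1) (-1). *)
Lemma ev_sum_M : ev_sum (mono k r mM) = -1.
Proof.
rewrite /ev_sum (monoE _ mhomM) sum_row2; congr (- _).
have e x y : 'X_[mM].@[ptw (row2 x y)] = res_emb (x ^+ (p ^ f - 1)) * res_emb (y ^+ Bsum).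
  by rewrite /ptw meval_pt2XY !prod_frob_expr row2_0 row2_1 sum_digitsM !rmorphXn.
under eq_bigr do under eq_bigr do rewrite e.
under eq_bigr do rewrite -mulr_sumr.
rewrite -mulr_suml -!rmorph_sum !sum_expr_mulq ?Bsum_gt0 ?subn_gt0 ?q_gt1 //.
  by rewrite rmorphN1 mulrNN mulr1.
by rewrite -(dvdn_addr _ (dvdnn _)) -rsum_split.
Qed.

Lemma ev_sum_star P : V_star P -> ev_sum P = 0.
Proof. by move=> tP; rewrite /ev_sum big1 ?oppr0 // => w _; apply: in_theta_ptw. Qed.

Fact ev_sum_linear : linear ev_sum.
Proof.
move=> a P Q; rewrite /ev_sum scalerN -opprD scaler_sumr -big_split; congr (- _).
by apply: eq_bigr => w _; rewrite /= mevalD mevalZ.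
Qed.

(** The value at (x, y) does not depend on y, so the sum over y produces a factor q = 0. *)
Lemma ev_sum_X : ev_sum (mono k r (mXY r (fun=> 0%N))) = 0.
Proof.
rewrite /ev_sum (monoE _ mhomX) sum_row2 big1 ?oppr0 // => x _.
rewrite (eq_bigr (fun=> res_emb x ^+ rsum)) => [|y _]; last first.
  by rewrite /ptw meval_pt2XY prod_frob_expr row2_0 [X in _ * X]big1 ?mulr1.
rewrite sumr_const ur_res_card -mulr_natl -(rmorph_nat res_emb) (q_split p f_gt0) natrM.
by rewrite (pcharf0 (res_pchar p_prime L)) mul0r rmorph0 mul0r.
Qed.

Lemma presents_Q_exists : exists e : rep_hom (V_k C r) (triv_rep k (KZ L)),
  presents_Q e /\ e (mono k r mM) = -1.
Proof.
have [e eE] := @rep_hom_exists _ _ (V_k C r) (triv_rep k (KZ L)) _ ev_sum_linear ev_sum_act.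
exists e; split; last by rewrite eE ev_sum_M.
split=> [c|P].
  exists (- c *: mono k r mM); rewrite linearZ /= eE ev_sum_M.
  by rewrite -[LHS]/(- c * -1) mulrNN mulr1.
split=> [|[P1 [P2 [s1 /asboolP s2 ->]]]]; first by rewrite eE; apply: ev_sum_ker.
rewrite linearD /= eE ev_sum_star // add0r.
apply: (s2 (fun P => e P = 0)) => [|a u w hu hw|_ [g [P0 [P0E ->]]]]; first by rewrite linear0.
  by rewrite linearP hu hw scaler0 addr0.
rewrite hom_act eE.
have -> : P0 = mono k r (mXY r (fun=> 0%N)); last exact: ev_sum_X.
apply: val_inj; rewrite /= P0E (monoE _ mhomX) mpolyXYE [X in _ = _ * X]big1 ?mulr1 //.
Qed.

End Weights.
End Residue.

(** * Reduction and null functions *)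

Section ExtensionTheory.
Import monalg.
Variables (E k : fieldType) (O : pred E) (red : E -> k).
Variables (G : groupType) (M : rep E G) (Theta : M -> Prop).
Hypothesis stabT : forall g x, Theta x -> Theta (ract g x).
Local Notation tns := (tens O red stabT).
Implicit Types x y z : lattice Theta.

Lemma tens1 x : tns x 1 = lpi (@tens_rel E k O red G M Theta) (monalg.mkmalgU x 1).
Proof. by congr (lpi _ _); rewrite scale1r. Qed.

Lemma tensD x y z : sval z = sval x + sval y -> tns z 1 = tns x 1 + tns y 1.
Proof.
move=> zE; have /lpi_gen : tens_rel O red (monalg.mkmalgU z 1 -
    monalg.mkmalgU x 1 - monalg.mkmalgU y 1) by left; exists x, y, z.
rewrite !linearB /= => /eqP; rewrite -addrA -opprD subr_eq0 => /eqP e.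
rewrite !tens1; exact: e.
Qed.

Lemma tensZ c x z : O c -> sval z = c *: sval x -> tns z 1 = red c *: tns x 1.
Proof.
move=> Oc zE; have /lpi_gen : tens_rel O red (monalg.mkmalgU z 1 -
    red c *: monalg.mkmalgU x 1) by right; exists c, x, z.
rewrite linearB linearZ /= => /eqP; rewrite subr_eq0 => /eqP e.
rewrite !tens1; exact: e.
Qed.

Lemma tens_act g x : tns (lattice_act stabT g x) 1 = ract g (tns x 1).
Proof.
rewrite !tens1 [RHS]qact_pi; last exact: tens_rel_stable.
by rewrite [ract g _]malg_actU.
Qed.

Lemma tens_ind (Q : tens_rep O red stabT -> Prop) : Q 0 ->
  (forall u v, Q u -> Q v -> Q (u + v)) -> (forall c x, Q (c *: tns x 1)) ->
  forall u, Q u.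
Proof.
move=> Q0 QD Qc u; case: (lpiP u) => m ->; rewrite [m]malg_expand linear_sum.
apply: big_ind => // x _; rewrite linearZ /=.
have := Qc (monalg.mcoeff x m) x; rewrite tens1; exact.
Qed.
End ExtensionTheory.

Section Reduction.
Variables (p f : nat) (L : unramified p f) (C : coef_field L).
Notation vE := (@cf_val p f L C).
Notation E := (cf_field C).
Notation k := (cf_res C).
Notation redE := (@cf_red p f L C).
Let hvE : is_valuation vE := @cf_valP p f L C.
Let hredE : residue_morph vE redE := @cf_redP p f L C.

(** Integrality and the value of the reduction in one relation, so that closure under substitution
    is proved once: [pint] is its first half and [psmall] is reduction to 0. *)
Definition reds (P : {mpoly E[f + f]}) (P' : {mpoly k[f + f]}) := forall m, v_int vE P@_m /\ P'@_m = redE P@_m.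
Definition pint (P : {mpoly E[f + f]}) := forall m, v_int vE P@_m.
Definition psmall (P : {mpoly E[f + f]}) := forall m, v_max vE P@_m.

Lemma reds_int P P' : reds P P' -> pint P. Proof. by move=> h m; case: (h m). Qed.

Lemma psmallE P : psmall P <-> reds P 0.
Proof.
split=> h m.
  have im := v_max_int (h m); split=> //.
  by rewrite mcoeff0; apply/esym/(res_eq0 hredE).
by have [im] := h m; rewrite mcoeff0 => /esym/(res_eq0 hredE); apply.
Qed.

Lemma redsD P Q P' Q' : reds P P' -> reds Q Q' -> reds (P + Q) (P' + Q').
Proof.
move=> hP hQ m; have [iP eP] := hP m; have [iQ eQ] := hQ m.
rewrite !mcoeffD eP eQ (resD hredE) //; split=> //; exact: v_intD.
Qed.

Lemma reds0 : reds 0 0.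
Proof. by move=> m; rewrite !mcoeff0 (res0 hredE); split=> //; exact: v_int0. Qed.

Lemma redsM P Q P' Q' : reds P P' -> reds Q Q' -> reds (P * Q) (P' * Q').
Proof.
move=> hP hQ m; rewrite !mcoeffM.
have i (x : bmultinom (f + f) (mdeg m).+1 * bmultinom (f + f) (mdeg m).+1) : v_int vE (P@_x.1 * Q@_x.2).
  by apply: v_intM => //; [case: (hP x.1) | case: (hQ x.2)].
split; first by apply: v_ge_sum => // x _; apply: i.
rewrite (res_sum hvE hredE) //; apply: eq_bigr => x _.
have [iP ->] := hP x.1; have [iQ ->] := hQ x.2.
by rewrite (resM hredE).
Qed.

Lemma redsX m : reds 'X_[m] 'X_[m].
Proof.
move=> m'; rewrite !mcoeffX (res_nat hvE hredE); split=> //; exact: v_int_nat.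
Qed.

Lemma redsZ c P P' : v_int vE c -> reds P P' -> reds (c *: P) (redE c *: P').
Proof.
move=> ic hP m; have [iP eP] := hP m; rewrite !mcoeffZ eP (resM hredE) //.
by split=> //; exact: v_intM.
Qed.

Lemma reds1 : reds 1 1. Proof. by rewrite -!mpolyX0; exact: redsX. Qed.

Lemma reds_prod (I : Type) (s : seq I) (F : I -> {mpoly E[f + f]}) F' :
  (forall i, reds (F i) (F' i)) -> reds (\prod_(i <- s) F i) (\prod_(i <- s) F' i).
Proof. by move=> h; elim/big_ind2: _ => [|? ? ? ? ? ?|//]; [exact: reds1 | apply: redsM]. Qed.

Lemma reds_sum (I : Type) (s : seq I) (F : I -> {mpoly E[f + f]}) F' :
  (forall i, reds (F i) (F' i)) -> reds (\sum_(i <- s) F i) (\sum_(i <- s) F' i).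
Proof. by move=> h; elim/big_ind2: _ => [|? ? ? ? ? ?|//]; [exact: reds0 | apply: redsD]. Qed.

Lemma redsXn P P' n : reds P P' -> reds (P ^+ n) (P' ^+ n).
Proof.
by move=> h; elim: n => [|n ih]; [exact: reds1 | rewrite !exprS; exact: redsM].
Qed.

Lemma reds_msubst (N : 'I_f -> 'M[E]_2) P P' :
  (forall i a b, v_int vE (N i a b)) -> reds P P' ->
  reds (msubst N P) (msubst (fun i => map_mx redE (N i)) P').
Proof.
(* P' may have a smaller support than P; a common degree bound expands both over the same
   monomials. *)
move=> hN hP; pose d := maxn (msize P) (msize P').
rewrite [in msubst N P](mpolywE (leq_maxl _ _ : (msize P <= d)%N)).
rewrite [X in reds _ (msubst _ X)](mpolywE (leq_maxr _ _ : (msize P' <= d)%N)).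
rewrite !linear_sum; apply: reds_sum => m; rewrite !linearZ /=.
have [iP ->] := hP m; apply: redsZ => //.
by rewrite !msubstX; apply: redsM; apply: reds_prod => i; apply: redsXn;
  apply: redsD; rewrite ![map_mx _ _ _ _]mxE; apply: redsZ => //; exact: redsX.
Qed.

Lemma pint_reds P : pint P -> exists P', reds P P'.
Proof.
move=> iP; exists (\sum_(m <- msupp P) redE P@_m *: 'X_[m]).
rewrite {1}[P]mpolyE; apply: reds_sum => m; apply: redsZ => //; exact: redsX.
Qed.

Lemma pint_msubst (N : 'I_f -> 'M[E]_2) P :
  (forall i a b, v_int vE (N i a b)) -> pint P -> pint (msubst N P).
Proof. by move=> hN /pint_reds[P' hP]; apply: reds_int (reds_msubst hN hP). Qed.

Lemma psmall_msubst (N : 'I_f -> 'M[E]_2) P :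
  (forall i a b, v_int vE (N i a b)) -> psmall P -> psmall (msubst N P).
Proof.
by move=> hN /psmallE hP; apply/psmallE; have := reds_msubst hN hP; rewrite linear0.
Qed.

Lemma pintX m : pint 'X_[m]. Proof. exact: reds_int (redsX m). Qed.

Lemma pint0 : pint 0. Proof. exact: reds_int reds0. Qed.

Lemma pintD P Q : pint P -> pint Q -> pint (P + Q).
Proof. by move=> hP hQ m; rewrite mcoeffD; apply: v_intD. Qed.

Lemma pintZ c P : v_int vE c -> pint P -> pint (c *: P).
Proof. by move=> hc hP m; rewrite mcoeffZ; apply: v_intM. Qed.

Lemma pintN P : pint P -> pint (- P).
Proof. by move=> hP m; rewrite mcoeffN; apply: v_intN. Qed.

Lemma psmall0 : psmall 0. Proof. by move=> m; rewrite mcoeff0 v_max0. Qed.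

Lemma psmallD P Q : psmall P -> psmall Q -> psmall (P + Q).
Proof. by move=> hP hQ m; rewrite mcoeffD; apply: v_maxD. Qed.

Lemma psmallZ c P : v_int vE c -> psmall P -> psmall (c *: P).
Proof. by move=> hc hP m; rewrite mcoeffZ; apply: v_maxMl. Qed.

Lemma psmallZint c P : v_max vE c -> pint P -> psmall (c *: P).
Proof. by move=> hc hP m; rewrite mcoeffZ; apply: v_maxMr. Qed.

Variable r : 'I_f -> nat.
Notation VE := (V_E C r).
Notation Vk := (V_k C r).

Lemma pint_mono m : pint (Vval (mono E r m)).
Proof. by rewrite val_mono; case: ifP => _; [exact: pintX | exact: pint0]. Qed.

Lemma reds_mono m : reds (Vval (mono E r m)) (Vval (mono k r m)).
Proof. by rewrite !val_mono; case: ifP => _; [exact: redsX | exact: reds0]. Qed.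

Lemma K_subst_int (g : KZ L) (i : 'I_f) a b :
  v_int vE (K_subst (fun x : L => x%:A : E) (K_part (val g)) i a b).
Proof. by rewrite mxE; apply/E_int/frob_int/K_part_int/valP. Qed.

Lemma reds_ract (g : KZ L) (P : VE) (P' : Vk) : reds (Vval P) (Vval P') ->
  reds (Vval (ract g P)) (Vval (ract g P')).
Proof.
move=> /(reds_msubst (K_subst_int g)) h; rewrite /= -/(msubst _ _).
suff -> : K_subst (fun x : L => redE (x%:A : E)) (K_part (val g)) =
  (fun i => map_mx redE (K_subst (fun x : L => x%:A : E) (K_part (val g)) i)) by [].
by apply: funext => i; apply/matrixP => a b; rewrite !mxE.
Qed.

Lemma pint_Vreds (P : VE) : pint (Vval P) -> exists P' : Vk, reds (Vval P) (Vval P').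
Proof.
move=> /pint_reds[P' hP]; have hP' : P' \in multihom r.
  apply/multihomE => m hm; have [_ ->] := hP m.
  by have /multihomE-> // := valP P; rewrite (res0 hredE).
by exists (VPoly hP').
Qed.

Lemma pint_ract (g : KZ L) (P : VE) : pint (Vval P) -> pint (Vval (ract g P)).
Proof. by move=> /pint_Vreds[P' /(reds_ract g)/reds_int]. Qed.

Lemma integral_elem g (P : VE) : pint (Vval P) -> integral_fun (ind_elem g P).
Proof.
move=> iP h; rewrite /= /ind_elem_fun; case: insub => [x|]; first exact: pint_ract.
by rewrite linear0; exact: pint0.
Qed.

Definition small_fun (F : ind VE) :=
  forall g, psmall (Vval ((F : ind_car VE) g)).

Lemma small_elem g (P : VE) : psmall (Vval P) -> small_fun (ind_elem g P).
Proof.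
move=> iP h; rewrite /= /ind_elem_fun; case: insub => [x|].
  by apply: psmall_msubst => //; exact: K_subst_int.
by rewrite linear0; exact: psmall0.
Qed.

Lemma integral0 : integral_fun (0 : ind VE).
Proof. by move=> g; exact: pint0. Qed.
Lemma integralD (F F' : ind VE) : integral_fun F -> integral_fun F' -> integral_fun (F + F').
Proof. by move=> h h' g m; exact: (pintD (h g) (h' g)). Qed.
Lemma integralZ c (F : ind VE) : v_int vE c -> integral_fun F -> integral_fun (c *: F).
Proof. by move=> hc h g m; exact: (pintZ hc (h g)). Qed.
Lemma integral_sum (I : Type) (s : seq I) (F : I -> ind VE) :
  (forall i, integral_fun (F i)) -> integral_fun (\sum_(i <- s) F i).
Proof. by move=> h; apply: big_ind => //; [exact: integral0 | exact: integralD]. Qed.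

(** * The map from ind V_r to Theta_bar, and null functions *)

Section ClassMap.
Variables (T : rep_hom (ind VE) (ind VE)) (a : E).
Notation TB := (Theta_bar T a).

(** Made total by the value 0 off the integral functions, so that it can be written under sums
    without carrying integrality proofs. *)
Definition cls (F : ind VE) : TB :=
  if pselect (integral_fun F) is left iF
  then tens (v_int vE) redE (@in_Theta_stable p f L C r T a) (Theta_class T a iF) 1
  else 0.

Lemma clsE F (iF : integral_fun F) :
  cls F = tens (v_int vE) redE (@in_Theta_stable p f L C r T a) (Theta_class T a iF) 1.
Proof.
rewrite /cls; case: pselect => [iF'|nF]; last by case: nF.
by rewrite (Prop_irrelevance iF' iF).
Qed.

Lemma cls_eq F F' : integral_fun F -> integral_fun F' ->
  Pi_pi T a F = Pi_pi T a F' -> cls F = cls F'.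
Proof.
move=> iF iF' e; rewrite (clsE iF) (clsE iF').
by have -> : Theta_class T a iF = Theta_class T a iF' by apply: val_inj.
Qed.

Lemma clsD F F' : integral_fun F -> integral_fun F' -> cls (F + F') = cls F + cls F'.
Proof.
move=> iF iF'; rewrite (clsE (integralD iF iF')) (clsE iF) (clsE iF').
by apply: tensD; rewrite /= linearD.
Qed.

Lemma clsZ c F : v_int vE c -> integral_fun F -> cls (c *: F) = redE c *: cls F.
Proof.
move=> ic iF; rewrite (clsE (integralZ ic iF)) (clsE iF).
by apply: tensZ; rewrite //= linearZ.
Qed.

Lemma cls0 : cls 0 = 0.
Proof. by rewrite -[0](scale0r 0) clsZ ?(res0 hredE) ?scale0r //; [exact: v_int0 | exact: integral0]. Qed.

Lemma cls_sum (I : Type) (s : seq I) (F : I -> ind VE) :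
  (forall i, integral_fun (F i)) -> cls (\sum_(i <- s) F i) = \sum_(i <- s) cls (F i).
Proof.
move=> h; elim: s => [|i s ih]; first by rewrite !big_nil cls0.
by rewrite !big_cons clsD ?ih //; apply: integral_sum.
Qed.

Lemma cls_act g F : integral_fun F -> cls (ract g F) = ract g (cls F).
Proof.
move=> iF; have iF' : integral_fun (ract g F) by move=> h; apply: iF.
rewrite (clsE iF) (clsE iF') -tens_act.
have -> // : Theta_class T a iF' = lattice_act (@in_Theta_stable p f L C r T a) g (Theta_class T a iF).
by apply: val_inj; exact: (hom_act (Pi_pi T a) g F).
Qed.

Lemma Theta_bar_ind (Q : TB -> Prop) : Q 0 -> (forall x y, Q x -> Q y -> Q (x + y)) ->
  (forall c F, integral_fun F -> Q (c *: cls F)) -> forall x, Q x.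
Proof.
move=> Q0 QD Qc; apply: tens_ind => // c [y hy]; case/asboolP: (hy) => F iF yE.
have := Qc c F iF; rewrite (clsE iF).
by have -> : Theta_class T a iF = exist _ y hy by apply: val_inj.
Qed.

(** Coefficients are taken in k and only the monomials are lifted to E. The map is defined on all
    polynomials and ignores monomials that are not of multidegree r, for which [mono] is 0; so a sum
    of the theta_i Q_i can be treated term by term although the Q_i are arbitrary. *)
Definition phi_poly (P : {mpoly k[f + f]}) : TB :=
  \sum_(m : bmultinom (f + f) (mbound r)) P@_m *: cls (ind_elem 1%g (mono E r m : VE)).

Fact phi_poly_linear : linear phi_poly.
Proof.
move=> c P Q; rewrite /phi_poly scaler_sumr -big_split; apply: eq_bigr => m _ /=.
by rewrite mcoeffD mcoeffZ scalerDl scalerA.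
Qed.
HB.instance Definition _ := GRing.isLinear.Build k {mpoly k[f + f]} TB *:%R
  phi_poly phi_poly_linear.

Lemma phi_polyX m : phi_poly 'X_[m] = cls (ind_elem 1%g (mono E r m : VE)).
Proof.
have [lt|ge] := ltnP (mdeg m) (mbound r).
  rewrite /phi_poly (bigD1 (BMultinom lt)) //= mcoeffX eqxx scale1r big1 ?addr0 //.
  move=> m' ne; rewrite mcoeffX; case: eqP => [e|_]; last by rewrite scale0r.
  by case/eqP: ne; apply: val_inj.
rewrite mono_out; last by apply: contraTN ge => /mhom_bound; rewrite ltnNge.
rewrite linear0 cls0 /phi_poly big1 // => m' _; rewrite mcoeffX.
case: eqP => [e|_]; last by rewrite scale0r.
by move: ge; rewrite e leqNgt (valP m').
Qed.

Lemma phi_reds (P : VE) (P' : Vk) : reds (Vval P) (Vval P') ->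
  phi_poly (Vval P') = cls (ind_elem 1%g P).
Proof.
move=> h; rewrite [P]Vpoly_expand linear_sum cls_sum => [|m].
  apply: eq_bigr => m _; have [im ->] := h m; rewrite linearZ /= clsZ //.
  by apply: integral_elem; exact: pint_mono.
rewrite linearZ /=; apply: integralZ; first by case: (h m).
by apply: integral_elem; exact: pint_mono.
Qed.

Definition phi_V (P : Vk) : TB := phi_poly (Vval P).
Fact phi_V_linear : linear phi_V.
Proof. by move=> c P Q; rewrite /phi_V /= linearP. Qed.
HB.instance Definition _ := GRing.isLinear.Build k Vk TB *:%R phi_V phi_V_linear.

Lemma cls_elem g (P : VE) (P' : Vk) : reds (Vval P) (Vval P') ->
  cls (ind_elem g P) = ract g (phi_V P').
Proof.
move=> h; rewrite /phi_V (phi_reds h) -cls_act ?ind_act_elem ?mulg1 //.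
by apply: integral_elem; apply: reds_int h.
Qed.

Lemma phi_V_act_reds (g : KZ L) (P : VE) (P' : Vk) : reds (Vval P) (Vval P') ->
  phi_V (ract g P') = ract (val g) (phi_V P').
Proof.
move=> h; have := cls_elem 1%g (reds_ract g h); rewrite ract1 => <-.
by rewrite -(cls_elem (val g) h) -ind_elem_sub mul1g.
Qed.

(** A vector with coefficients outside the image of [redE] has no integral lift; linearity reduces
    to monomials, which have one. *)
Lemma phi_V_act (g : KZ L) (P : Vk) : phi_V (ract g P) = ract (val g) (phi_V P).
Proof.
elim/Vpoly_mono_ind: P => [c u v hu hv|m]; last exact: phi_V_act_reds (reds_mono m).
have -> : ract g (c *: u + v : Vk) = c *: ract g (u : Vk) + ract g (v : Vk).
  exact: (@ract_linear _ _ Vk).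
rewrite (@phi_V_linear c (ract g (u : Vk)) (ract g (v : Vk))) hu hv.
rewrite (@phi_V_linear c u v); apply/esym; exact: (@ract_linear _ _ TB).
Qed.

Theorem natural_exists : exists pr : rep_hom (ind Vk) TB,
  [/\ is_natural pr, onto pr & forall g w, pr (ind_elem g w) = ract g (phi_V w)].
Proof.
have [pr prE] := @Frobenius_reciprocity _ _ _ _ Vk TB phi_V phi_V_act.
exists pr; split=> //.
  move=> F iF F' FF'; rewrite -clsE; have [s [cs ls]] := covers_exists F.
  have h g : reds (Vval ((F : ind_car VE) g)) (Vval ((F' : ind_car Vk) g)).
    by move=> m; split; [exact: iF | exact: FF'].
  (* The reduction vanishes wherever F does, so one transversal expands both. *)
  have cs' : covers F' s.
    move=> g nz; apply: cs => F0; apply: nz; apply: val_inj; apply/mpolyP => m.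
    have [_ ->] := h g m.
    by rewrite F0 -[Vval 0]/(0 : {mpoly E[f + f]}) !mcoeff0 (res0 hredE).
  rewrite (ind_expand cs' ls) linear_sum (ind_expand cs ls) cls_sum => [|g].
    by apply: eq_bigr => g _; rewrite /= prE (cls_elem _ (h g)).
  by apply: integral_elem => m; exact: iF.
elim/Theta_bar_ind => [|x y [x' <-] [y' <-]|c F iF].
- by exists 0; rewrite linear0.
- by exists (x' + y'); rewrite linearD.
have [s [cs ls]] := covers_exists F.
have /choice[w wE] : forall g : GL2 L, exists P' : Vk,
    reds (Vval ((F : ind_car VE) g)) (Vval P').
  by move=> g; apply: pint_Vreds => m; exact: iF.
exists (c *: \sum_(h <- s) ind_elem h^-1%g (w h)); rewrite linearZ linear_sum /=.
congr (_ *: _); rewrite [in RHS](ind_expand cs ls) cls_sum => [|g].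
  by apply: eq_bigr => g _; rewrite prE (cls_elem _ (wE g)).
by apply: integral_elem => m; exact: iF.
Qed.

Definition null (F : ind VE) := exists F0 F1 : ind VE,
  small_fun F1 /\ F = hom_minus_scalar T a F0 + F1.

Lemma null_small F : small_fun F -> null F.
Proof. by move=> h; exists 0, F; rewrite linear0 add0r. Qed.

Lemma null_elem g (P : VE) : psmall (Vval P) -> null (ind_elem g P).
Proof. by move=> h; apply/null_small/small_elem. Qed.

Lemma null0 : null 0. Proof. by apply: null_small => g; exact: psmall0. Qed.

Lemma nullD F F' : null F -> null F' -> null (F + F').
Proof.
case=> F0 [F1 [s1 ->]] [F0' [F1' [s1' ->]]]; exists (F0 + F0'), (F1 + F1').
split; first by move=> g m; exact: (psmallD (s1 g) (s1' g)).
by rewrite linearD addrACA.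
Qed.

Lemma nullZ c F : v_int vE c -> null F -> null (c *: F).
Proof.
move=> ic [F0 [F1 [s1 ->]]]; exists (c *: F0), (c *: F1).
split; first by move=> g m; exact: (psmallZ ic (s1 g)).
by rewrite linearZ scalerDr.
Qed.

Lemma nullN F : null F -> null (- F).
Proof. by rewrite -scaleN1r; apply: nullZ; apply: v_intN => //; exact: v_int1. Qed.

Lemma null_sum (I : Type) (s : seq I) (F : I -> ind VE) :
  (forall i, null (F i)) -> null (\sum_(i <- s) F i).
Proof. by move=> h; apply: big_ind => //; [exact: null0 | exact: nullD]. Qed.

Lemma null_hecke F : null (T F - a *: F).
Proof. by exists F, 0; split; [move=> g; exact: psmall0 | rewrite addr0]. Qed.

(** (T - a) F0 dies already in Pi, whether or not F0 is integral, so F and F1 define the same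
    element of Theta; F1 is a sum of elements [g, w] whose w reduce to 0. *)
Lemma cls_null F : integral_fun F -> null F -> cls F = 0.
Proof.
move=> iF [F0 [F1 [s1 FE]]].
have iF1 : integral_fun F1 by move=> g m; apply: v_max_int; exact: s1.
have -> : cls F = cls F1.
  apply: cls_eq => //; rewrite FE linearD -[RHS]add0r; congr (_ + _).
  by apply: lpi_gen; exists F0.
have [s [cs ls]] := covers_exists F1; rewrite (ind_expand cs ls) cls_sum => [|g].
  rewrite big1 // => g _; rewrite (@cls_elem _ _ 0) ?linear0 //.
  by apply/psmallE; exact: s1.
by apply: integral_elem => m; exact: iF1.
Qed.

End ClassMap.
End Reduction.

(** * Hecke relations *)

Section HeckeRelations.
Variables (p f : nat) (p_prime : prime p) (p_gt2 : (2 < p)%N) (f_gt0 : (0 < f)%N).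
Variables (L : unramified p f) (C : coef_field L) (r : 'I_f -> nat).
Hypothesis r_ge : forall i, (p <= r i)%N.
Let rsum := (\sum_(i < f) r i * p ^ i)%N.
Hypothesis r_dvd : (p ^ f - 1 %| rsum)%N.
Notation v := (@ur_val p f L).
Notation vE := (@cf_val p f L C).
Notation E := (cf_field C).
Notation k := (cf_res C).
Notation Fq := (ur_res L).
Notation redL := (@ur_red p f L).
Notation redE := (@cf_red p f L C).
Notation VE := (V_E C r).
Notation Vk := (V_k C r).
Let hv : is_valuation v := @ur_valP p f L.
Let hvE : is_valuation vE := @cf_valP p f L C.
Let hred : residue_morph v redL := @ur_redP p f L.
Let hredE : residue_morph vE redE := @cf_redP p f L C.
Variable a : E.
Hypotheses (a_neq0 : a != 0) (v_a : 0 < vE a < 1).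
Variable T : rep_hom (ind VE) (ind VE).
Hypothesis T_hecke : is_hecke_E T.

Notation ie := (@ind_elem _ _ _ _ VE).
Notation null := (null T a).
Notation b := (a^-1).
Notation mX := (mXY r (fun=> 0%N)).
Notation mY := (mXY (fun=> 0%N) r).
Notation oX := (mono E r mX).
Notation oY := (mono E r mY).
Notation oM := (mono E r (mM p r)).
Let alpha (l : Fq) : GL2 L := gl22 p%:R (teich l) 0 1.
Let beta : GL2 L := gl22 1 0 0 p%:R.

Definition pge N (P : {mpoly E[f + f]}) := forall m, v_ge vE N P@_m.

Lemma a_int : v_int vE a.
Proof. by case/andP: v_a => h _; rewrite /v_int /v_ge ltW ?orbT. Qed.

Lemma a_max : v_max vE a.
Proof. by case/andP: v_a => h _; rewrite /v_max h orbT. Qed.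

(** This and [divap2_max] are where v(a_p) < 1 enters: each factor p pays for one division by a_p,
    with something left over. *)
Lemma divap_max x : v_ge vE 1 x -> v_max vE (b * x).
Proof.
rewrite /v_ge /v_max; have [->|nx] := eqVneq x 0; first by rewrite mulr0 eqxx.
move=> /= h; rewrite (proj1 hvE) ?invr_eq0 // vV // addrC subr_gt0.
by case/andP: v_a => _ h1; rewrite (lt_le_trans h1 h) orbT.
Qed.

Lemma divap2_max x : v_ge vE 2%:R x -> v_max vE (b * (b * x)).
Proof.
rewrite /v_ge /v_max; have [->|nx] := eqVneq x 0; first by rewrite !mulr0 eqxx.
have nb : b != 0 by rewrite invr_eq0.
move=> /= h; rewrite !(proj1 hvE) ?mulf_neq0 // vV // addrA -opprD addrC subr_gt0.
case/andP: v_a => _ h1; rewrite (lt_le_trans _ h) ?orbT //.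
by rewrite -[2%:R]/(1 + 1) ltrD.
Qed.

Lemma T_elem g P :
  T (ie g P) = \sum_(l : Fq) ie (g * alpha l)%g (V_lam l P) + ie (g * beta)%g (V_inf P).
Proof. exact: T_hecke. Qed.

Lemma V_lamZ l c (P : Vpoly E r) : V_lam l (c *: P) = c *: V_lam l P :> Vpoly E r.
Proof. by apply: val_inj; rewrite /= linearZ. Qed.
Lemma V_infZ c (P : Vpoly E r) : V_inf (c *: P) = c *: V_inf P :> Vpoly E r.
Proof. by apply: val_inj; rewrite /= linearZ. Qed.

Lemma hecke_null g (P : Vpoly E r) :
  (forall l h, null (ie h (b *: V_lam l P))) ->
  (forall h, null (ie h (b *: V_inf P))) -> null (ie g P).
Proof.
move=> hl hi; have := null_hecke T a (ie g (b *: P)).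
rewrite T_elem -[a *: _]linearZ [a *: (b *: P)]scalerA mulfV // [1 *: P]scale1r => h.
have nl : null (\sum_(l : Fq) ie (g * alpha l)%g (V_lam l (b *: P)) +
    ie (g * beta)%g (V_inf (b *: P))).
  by apply: nullD; [apply: null_sum => l; rewrite V_lamZ | rewrite V_infZ].
by have := nullD nl (nullN h); rewrite opprB addrC subrK.
Qed.

Let mu (l : Fq) (i : 'I_f) : E := (- (teich l)%:A) ^+ (p ^ i).

Lemma muE l i : mu l i = ((teich (- l) : L) ^+ (p ^ i))%:A.
Proof. by rewrite /mu (teichN p_prime p_gt2 f_gt0) [RHS](rmorphXn (in_alg E)) [in RHS](rmorphN (in_alg E)). Qed.

Lemma mu_int l i : v_int vE (mu l i).
Proof. by rewrite muE; apply/E_int/v_intX/teich_int. Qed.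

Lemma p_ge1 : v_ge vE 1 (p%:R : E).
Proof.
have := E_ge C (v_max_ge1 (v_p_max L)).
by rewrite -[(p%:R)%:A]/(in_alg E p%:R) rmorph_nat.
Qed.

Lemma p_pow_ge N x : v_int vE x -> v_ge vE N%:R ((p%:R : E) ^+ N * x).
Proof.
move=> ix; elim: N => [|N ih]; first by rewrite mul1r.
by rewrite exprS -mulrA -nat1r; apply: v_geM => //; exact: p_ge1.
Qed.

Lemma V_lam_coef l (P : Vpoly E r) m :
  (Vval (V_lam l P))@_m = p%:R ^+ (\sum_i m (rshift f i)) *
    (msubst (fun i => mx22 1 (mu l i) 0 1) (Vval P))@_m.
Proof.
exact: mcoeff_msubst_upper.
Qed.

Lemma V_inf_coef (P : Vpoly E r) m :
  (Vval (V_inf P))@_m = p%:R ^+ (\sum_i m (lshift f i)) * (Vval P)@_m.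
Proof.
exact: mcoeff_msubst_scaleX.
Qed.

Lemma V_lam_coefX l (P : Vpoly E r) :
  (Vval (V_lam l P))@_mX = (Vval P).@[pt2 (fun=> 1) (mu l)].
Proof.
rewrite V_lam_coef big1 ?mul1r => [|i _]; last by rewrite mXYE.
rewrite -(multihom_meval10 (msubst_multihom _ (valP P))) meval_msubst.
apply: meval_eq => j; elim/lrshiftP: j => i; rewrite ?pt2l ?pt2r !mx22C.
  by rewrite mul0r addr0 mulr1.
by rewrite mul0r addr0 mul1r.
Qed.

Lemma unip_int l i x y : v_int vE (mx22 1 (mu l i) 0 1 x y).
Proof.
move: x y; apply: ord2P; apply: ord2P; rewrite !mx22C; first [exact: mu_int | exact: v_int0 | exact: v_int1].
Qed.

Lemma V_lam_pge1 l (P : Vpoly E r) : pint (Vval P) ->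
  (Vval P).@[pt2 (fun=> 1) (mu l)] = 0 -> pge 1 (Vval (V_lam l P)).
Proof.
move=> iP P0 m; have [hm|nm] := boolP (mhom r m); last first.
  by have /multihomE-> // := valP (V_lam l P); exact: v_ge0.
have [->|ne] := eqVneq m mX; first by rewrite V_lam_coefX P0 v_ge0.
rewrite V_lam_coef; have := pint_msubst (unip_int l) iP m.
case e : (\sum_i m (rshift f i))%N => [|n] iPm; last first.
  rewrite exprS -mulrA; apply: v_geMr => //; first exact: p_ge1.
  by apply: v_intM => //; apply: v_intX => //; exact: v_int_nat.
move: ne; rewrite (mhom_eqX hm) => /negP[]; apply/forallP => i.
by rewrite -leqn0 -e (bigD1 i) //= leq_addr.
Qed.

Lemma V_inf_pge1 (P : Vpoly E r) : pint (Vval P) ->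
  pge 1 (Vval (V_inf P - (Vval P)@_mY *: oY)).
Proof.
move=> iP m; have [hm|nm] := boolP (mhom r m); last first.
  by have /multihomE-> // := valP (V_inf P - (Vval P)@_mY *: oY); exact: v_ge0.
rewrite -[Vval _]/(Vval (V_inf P) - (Vval P)@_mY *: Vval oY) mcoeffB mcoeffZ.
rewrite (monoE _ (mhomY r)) mcoeffX V_inf_coef.
have [e|ne] := eqVneq mY m.
  rewrite -e mulr1 big1 ?mul1r ?subrr ?v_ge0 // => i _.
  by rewrite mXYE.
rewrite mulr0 subr0.
case e : (\sum_i m (lshift f i))%N => [|n]; last first.
  rewrite exprS -mulrA; apply: v_geMr => //; first exact: p_ge1.
  by apply: v_intM => //; apply: v_intX => //; exact: v_int_nat.
move: ne; rewrite eq_sym (mhom_eqY hm) => /negP[]; apply/forallP => i.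
by rewrite -leqn0 -e (bigD1 i) //= leq_addr.
Qed.

Lemma pge1_div P : pge 1 P -> psmall (b *: P).
Proof. by move=> h m; rewrite mcoeffZ; apply: divap_max. Qed.

Lemma pge2_div P : pge 2%:R P -> psmall (b *: (b *: P)).
Proof. by move=> h m; rewrite !mcoeffZ; apply: divap2_max. Qed.

Lemma null_div g (P : Vpoly E r) : pge 1 (Vval P) -> null (ie g (b *: P)).
Proof. by move=> h; apply: null_elem; exact: pge1_div h. Qed.

(** The conditions say that P vanishes at the lifts (1, mu) and (0, 1) of the points of the
    projective line over F_q. These values are the only coefficients of P (X, mu X + p Y) and P (p
    X, Y) without a factor p. *)
Lemma kernel_null g (P : Vpoly E r) : pint (Vval P) ->
  (forall l, (Vval P).@[pt2 (fun=> 1) (mu l)] = 0) -> (Vval P)@_mY = 0 ->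
  null (ie g P).
Proof.
move=> iP Pl PY; apply: hecke_null => [l h|h]; apply: null_div.
  exact: V_lam_pge1.
by have := V_inf_pge1 iP; rewrite PY [0 *: _]scale0r [_ - 0]subr0.
Qed.

(** Teichmueller lifts satisfy x^q = x exactly, which handles the wrap-around at i = 0. Hence
    theta_i, read in characteristic 0, vanishes at (1, mu) and not merely modulo p. *)
Lemma mu_pred l i : mu l (ord_pred i) ^+ p = mu l i.
Proof.
rewrite !muE -!(rmorphXn (in_alg E)); congr (in_alg E _).
rewrite /= -exprM -expnSr; case: i => -[|i] lti /=.
  have -> : ((0 + f).-1 %% f).+1 = f by rewrite add0n modn_small ?prednK // ltn_predL.
  by rewrite expn0 expr1 teich_unity.
by rewrite modnDr modn_small // ltnW.
Qed.

(** No degree condition on [m] is imposed: the two monomials have the same multidegree, and [mono]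
    turns both into 0 when it is not r. *)
Lemma theta_null g i m :
  null (ie g (mono E r (m + (U_(lshift f i) + U_(rshift f (ord_pred i)) *+ p))
            - mono E r (m + (U_(rshift f i) + U_(lshift f (ord_pred i)) *+ p)))).
Proof.
set up := (U_(lshift f i) + _)%MM; set dn := (U_(rshift f i) + _)%MM.
have upl j : up (lshift f j) = (i == j).
  by rewrite mnmDE mulmnE !mnm1E eq_rlshift (inj_eq (@lshift_inj _ _)) addn0.
have upr j : up (rshift f j) = ((ord_pred i == j) * p)%N.
  by rewrite mnmDE mulmnE !mnm1E eq_lrshift (inj_eq (@rshift_inj _ _)).
have dnl j : dn (lshift f j) = ((ord_pred i == j) * p)%N.
  by rewrite mnmDE mulmnE !mnm1E eq_rlshift (inj_eq (@lshift_inj _ _)).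
have dnr j : dn (rshift f j) = (i == j).
  by rewrite mnmDE mulmnE !mnm1E eq_lrshift (inj_eq (@rshift_inj _ _)) addn0.
have hE : mhom r (m + up)%MM = mhom r (m + dn)%MM.
  apply: eq_forallb => j; rewrite !(mnmDE _ m) upl upr dnl dnr.
  by rewrite addnACA [in RHS]addnACA [(((_ == _) * p) + _)%N]addnC.
have [hu|nu] := boolP (mhom r (m + up)%MM); last first.
  by rewrite mono_out // mono_out -?hE // subrr linear0; exact: null0.
have hd : mhom r (m + dn)%MM by rewrite -hE.
apply: kernel_null => [|l|].
- apply: pintD; first exact: pint_mono.
  by apply: pintN; exact: pint_mono.
- rewrite -[Vval _]/(Vval (mono E r (m + up)) - Vval (mono E r (m + dn))).
  rewrite !monoE // mevalB meval_theta_up meval_theta_dn.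
  by rewrite mu_pred expr1n mul1r mulr1 subrr.
- rewrite -[Vval _]/(Vval (mono E r (m + up)) - Vval (mono E r (m + dn))).
  rewrite !monoE // mcoeffB !mcoeffX.
  have -> : (m + up == mY)%MM = false.
    apply/eqP => /mnmP/(_ (lshift f i)); rewrite (mnmDE _ m) upl eqxx mXYE.
    by rewrite addn1.
  have -> : (m + dn == mY)%MM = false.
    apply/eqP => /mnmP/(_ (lshift f (ord_pred i))); rewrite (mnmDE _ m) dnl eqxx mXYE.
    by rewrite mul1n => /eqP; rewrite addn_eq0 [p == _]gtn_eqF ?andbF // prime_gt0.
  by rewrite subrr.
Qed.

Let addrB_cancel (V : zmodType) (s x y z : V) :
  s + x - z - (s + (x - y)) = y - z.
Proof. by rewrite -[s + x - z]addrA opprD addrACA subrr add0r opprB addrC addrA subrK. Qed.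

Lemma ieZ h c (P : Vpoly E r) : ie h (c *: P) = c *: ie h P.
Proof. exact: (linearZ_LR (ie h) c (P : VE)). Qed.
Lemma ieD h (P Q : Vpoly E r) : ie h (P + Q) = ie h P + ie h Q.
Proof. exact: (linearD (ie h) (P : VE) (Q : VE)). Qed.
Lemma ieB h (P Q : Vpoly E r) : ie h (P - Q) = ie h P - ie h Q.
Proof. exact: (linearB (ie h) (P : VE) (Q : VE)). Qed.
Lemma ie_sum h (I : finType) (P : I -> Vpoly E r) :
  ie h (\sum_i P i) = \sum_i ie h (P i).
Proof. exact: (linear_sum (ie h) _ _ (fun i => (P i : VE))). Qed.

(** The two values are mu^(q - 1 + B) and mu^B; they agree because mu^q = mu and B > 0. *)
Lemma monoYM_mu l : (Vval (oY - oM)).@[pt2 (fun=> 1) (mu l)] = 0.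
Proof.
rewrite -[Vval _]/(Vval oY - Vval oM) (monoE _ (mhomY r)) (monoE _ (mhomM p_prime r_ge)).
rewrite mevalB !meval_pt1XY /mu !prod_frob_expr (rsum_split p_prime r_ge).
set x := - _; set B := (\sum_(i < f) _)%N.
have xq : x ^+ (p ^ f) = x.
  by have := muE l (Ordinal f_gt0); rewrite /mu /= expn0 !expr1 -/x => ->;
    rewrite -(rmorphXn (in_alg E)) teich_unity.
have : (0 < B)%N := Bsum_gt0 p_prime f_gt0 r_ge.
case: B => // B _; rewrite addnS -addSn subn1 prednK ?expn_gt0 ?prime_gt0 //.
by rewrite exprD xq -exprS subrr.
Qed.

Lemma YM_int : pint (Vval (oY - oM)).
Proof. by apply: pintD; [exact: pint_mono | apply: pintN; exact: pint_mono]. Qed.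

Lemma mM_neqY : mM p r != mY.
Proof.
apply/eqP => /mnmP/(_ (lshift f (Ordinal f_gt0))); rewrite !mXYE => /eqP.
by rewrite -subn1 subn_eq0 leqNgt prime_gt1.
Qed.

Lemma YM_inf : pge 1 (Vval (V_inf (oY - oM) - oY)).
Proof.
have := V_inf_pge1 YM_int.
suff -> : (Vval (oY - oM))@_mY = 1 by rewrite [1 *: oY]scale1r.
rewrite -[Vval _]/(Vval oY - Vval oM) (monoE _ (mhomY r)) (monoE _ (mhomM p_prime r_ge)).
by rewrite mcoeffB !mcoeffX eqxx (negbTE mM_neqY) subr0.
Qed.

(** T - a is applied to a^-1 [g, Y^r - M]. The terms at [alpha l] are null by [monoYM_mu], and
    modulo p the term at [beta] retains only Y^r. *)
Lemma Y_relation g : null (b *: ie (g * beta)%g oY - ie g (oY - oM)).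
Proof.
have h := null_hecke T a (ie g (b *: (oY - oM))).
rewrite T_elem -[a *: _]linearZ [a *: (b *: _)]scalerA mulfV // [1 *: _]scale1r in h.
have nl : null (\sum_(l : Fq) ie (g * alpha l)%g (V_lam l (b *: (oY - oM))) +
    ie (g * beta)%g (b *: (V_inf (oY - oM) - oY))).
  apply: nullD; last by apply: null_div; exact: YM_inf.
  apply: null_sum => l; rewrite V_lamZ; apply: null_div.
  by apply: V_lam_pge1; [exact: YM_int | exact: monoYM_mu].
have := nullD h (nullN nl).
have -> : ie (g * beta)%g (b *: (V_inf (oY - oM) - oY)) =
    ie (g * beta)%g (b *: V_inf (oY - oM)) - b *: ie (g * beta)%g oY.
  by rewrite [b *: (_ - _)]scalerBr ieB [ie _ (b *: oY)]ieZ.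
rewrite V_infZ.
by rewrite addrB_cancel.
Qed.

Lemma small_scale h c (P : Vpoly E r) : v_max vE c -> pint (Vval P) -> null (c *: ie h P).
Proof.
move=> hc iP; rewrite -ieZ; apply: null_elem.
exact: psmallZint hc iP.
Qed.

(** After multiplying [Y_relation] by a, its second term a [g, Y^r - M] is small. *)
Lemma Y_null h : null (ie h oY).
Proof.
have := nullZ a_int (Y_relation (h * beta^-1)%g); rewrite mulgVK.
rewrite scalerBr scalerA mulfV // scale1r => h1.
by have := nullD h1 (small_scale (h * beta^-1)%g a_max YM_int); rewrite subrK.
Qed.

Lemma YM_relation g : null (b *: ie (g * beta)%g oY + ie g oM).
Proof.
have := nullD (Y_relation g) (Y_null g).
by rewrite ieB opprB -addrA subrK.
Qed.

(** * The matrices alpha, beta, kap and w0 *)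

Let pnz : (p%:R : L) != 0 := p_neq0 L.
Let kap : GL2 L := gl22 0 (p%:R)^-1 (p%:R)^-1 0.
Let w0 : GL2 L := gl22 0 1 1 0.

Lemma val_alpha l : val (alpha l) = mx22 p%:R (teich l) 0 1.
Proof. by rewrite gl22E // mulr1 mulr0 subr0. Qed.
Lemma val_beta : val beta = mx22 1 0 0 p%:R.
Proof. by rewrite gl22E // mul1r mulr0 subr0. Qed.
Lemma val_w0 : val w0 = mx22 0 1 1 0.
Proof. by rewrite gl22E // mul0r mul1r sub0r oppr_eq0 oner_eq0. Qed.
Lemma val_kap : val kap = mx22 0 (p%:R)^-1 (p%:R)^-1 0.
Proof. by rewrite gl22E // mul0r sub0r oppr_eq0 mulf_neq0 // invr_eq0. Qed.

Lemma beta_kap_beta : (beta * kap * beta)%g = w0.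
Proof.
apply: val_inj; rewrite /= val_beta val_kap val_w0 !mulmx22.
by rewrite !(mul0r, mulr0, mul1r, mulr1, addr0, add0r) mulVf // mulfV.
Qed.

Lemma klam_KZ l : in_KZ (alpha l * beta)%g /\ K_part (alpha l * beta)%g = mx22 1 (teich l) 0 1.
Proof.
have i0 := v_int0 v; have i1 := v_int1 hv; have it := @teich_int p f L l.
apply: (@KZ_intro p f L _ _ 1); rewrite ?det_mx22E ?mulr1 ?mulr0 ?subr0 ?oner_eq0 ?v1 //.
  exact: mx_int22.
rewrite /= val_alpha val_beta mulmx22 expr1z scalemx22.
by rewrite !(mul0r, mulr0, mul1r, mulr1, addr0, add0r) mulrC.
Qed.

Lemma w0_KZ : in_KZ w0 /\ K_part w0 = mx22 0 1 1 0.
Proof.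
have i0 := v_int0 v; have i1 := v_int1 hv.
apply: (@KZ_intro p f L _ _ 0); rewrite ?det_mx22E ?mulr0 ?mulr1 ?sub0r ?oppr_eq0 ?oner_eq0 ?vN1 //.
  exact: mx_int22.
by rewrite expr0z scale1r val_w0.
Qed.

Lemma kap_KZ : in_KZ kap.
Proof.
have i0 := v_int0 v; have i1 := v_int1 hv.
have [] // := @KZ_intro p f L kap (mx22 0 1 1 0) (-1);
  rewrite ?det_mx22E ?mulr0 ?mulr1 ?sub0r ?oppr_eq0 ?oner_eq0 ?vN1 //.
  exact: mx_int22.
by rewrite val_kap scalemx22 mulr0 mulr1 exprN1.
Qed.

Lemma ract_w0 : ract (KZElt (proj1 w0_KZ) : KZ L) (oY : VE) = oX.
Proof.
apply: val_inj; rewrite /= (monoE _ (mhomY r)) (monoE _ (mhomX r)) (proj2 w0_KZ).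
rewrite msubstX mpolyXYE mulrC; congr (_ * _).
  apply: eq_bigr => i _; rewrite mXYE /K_subst [map_mx _ _ 0 1]mxE [map_mx _ _ 1 1]mxE !mx22C.
  by rewrite iter_frob1 iter_frob0 !scale0r !scale1r addr0.
by rewrite !big1 // => i _; rewrite mXYE.
Qed.

Lemma elem_X h : ie h oX = ie (h * w0)%g oY.
Proof. by rewrite -ract_w0 -ind_elem_sub. Qed.

Lemma Y_null2 h s : v_ge vE 1 s -> null (ie h (b *: (b *: (s *: oY)))).
Proof.
move=> hs; have cm := divap_max hs.
have := nullZ (v_max_int cm) (YM_relation (h * beta^-1)%g); rewrite mulgVK scalerDr => h1.
have := nullD h1 (nullN (small_scale (h * beta^-1)%g cm (pint_mono C r (mM p r)))).
by rewrite addrK scalerA !ieZ !scalerA [b * b * s]mulrAC.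
Qed.

Lemma X_null2 h s : v_ge vE 1 s -> null (ie h (b *: (b *: (s *: oX)))).
Proof.
move=> hs; have := Y_null2 (h * w0)%g hs.
by rewrite !ieZ -elem_X.
Qed.

(** * The polynomial U modulo p^2 *)

Let tau (l : Fq) (i : 'I_f) : E := ((teich l : L) ^+ (p ^ i))%:A.

Lemma klam_subst l : K_subst (fun x : L => x%:A : E) (mx22 1 (teich l) 0 1) =
  (fun i : 'I_f => mx22 1 (tau l i) 0 1).
Proof.
apply: funext => i; apply: mx22P; rewrite /K_subst [LHS]mxE !mx22C.
- by rewrite iter_frob1 scale1r.
- by rewrite (frob_teich p_prime f_gt0).
- by rewrite iter_frob0 scale0r.
- by rewrite iter_frob1 scale1r.
Qed.

Definition klam l : KZ L := KZElt (proj1 (klam_KZ l)).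

Let U : Vpoly E r := \sum_(l : Fq) (ract (klam l) (oY : VE) : Vpoly E r) + oX.

Lemma val_U : Vval U =
  \sum_(l : Fq) msubst (fun i => mx22 1 (tau l i) 0 1) 'X_[mY] + 'X_[mX].
Proof.
rewrite /U -[Vval _]/(Vval (\sum_(l : Fq) _) + Vval oX) (monoE _ (mhomX r)).
congr (_ + _); rewrite [LHS](linear_sum (@Vval f E r)); apply: eq_bigr => l _.
by rewrite /= (monoE _ (mhomY r)) (proj2 (klam_KZ l)) klam_subst.
Qed.

(** Under Y -> mu X + p Y the summand ([l] X + Y)^r becomes ((tau + mu) X + p Y)^r, and X^r does not
    change. *)
Lemma V_lam_U_coef l' m : (Vval (V_lam l' U))@_m =
  p%:R ^+ (\sum_i m (rshift f i)) * ((binpoly E r)@_m *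
    \sum_(l : Fq) \prod_i (tau l i + mu l' i) ^+ m (lshift f i)) + (mX == m)%:R.
Proof.
rewrite -[Vval _]/(msubst (fun i => mx22 1 (mu l' i) 0 p%:R) (Vval U)) val_U.
rewrite linearD linear_sum /= msubst_X => [|i|i]; try by rewrite mx22C.
rewrite mcoeffD mcoeffX; congr (_ + _); rewrite (linear_sum (mcoeff m)) !mulr_sumr /=.
apply: eq_bigr => l _; rewrite msubst_comp mcoeff_msubst_Y.
rewrite (eq_bigr (fun i => (tau l i + mu l' i) ^+ m (lshift f i))); last first.
  by move=> i _; rewrite mx22E !mx22C mul1r mulr1.
rewrite [X in _ * X * _](eq_bigr (fun i => p%:R ^+ m (rshift f i))); last first.
  by move=> i _; rewrite mx22E !mx22C mul0r add0r mulr1.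
by rewrite prodrXr mulrCA mulrAC -mulrA mulrC -!mulrA.
Qed.

Lemma U_coef m : (Vval U)@_m = (binpoly E r)@_m *
    (\sum_(l : Fq) \prod_i tau l i ^+ m (lshift f i)) + (mX == m)%:R.
Proof.
rewrite val_U mcoeffD mcoeffX; congr (_ + _); rewrite (linear_sum (mcoeff m)) mulr_sumr /=.
apply: eq_bigr => l _; rewrite mcoeff_msubst_Y.
rewrite (eq_bigr (fun i => tau l i ^+ m (lshift f i))); last by move=> i _; rewrite mx22C.
rewrite [X in _ * X * _]big1 ?mulr1; first by rewrite mulrC.
by move=> i _; rewrite mx22C expr1n.
Qed.

(** In F_q the sum tau + mu becomes the p^i-th power of l - l', by additivity of Frobenius, and a
    translation of the summation index removes l'. The witness lies in L so that [v_max_ge1] applies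
    to it. *)
Lemma sum_tau_mu l' (n : 'I_f -> nat) : exists y : L, [/\ v_int v y,
  \sum_(l : Fq) \prod_i (tau l i + mu l' i) ^+ n i = y%:A &
  redL y = \sum_(x : Fq) x ^+ (\sum_(i < f) n i * p ^ i)].
Proof.
pose D (l : Fq) (i : 'I_f) : L := teich l ^+ (p ^ i) + teich (- l') ^+ (p ^ i).
have iD l i : v_int v (D l i).
  by apply: v_intD => //; apply: v_intX => //; apply: teich_int.
have iP l : v_int v (\prod_i D l i ^+ n i).
  by apply: v_int_prod => // i _; apply: v_intX.
exists (\sum_(l : Fq) \prod_i D l i ^+ n i); split.
- by apply: v_ge_sum => // l _; exact: iP.
- rewrite [RHS](rmorph_sum (in_alg E)); apply: eq_bigr => l _.
  rewrite [RHS](rmorph_prod (in_alg E)); apply: eq_bigr => i _.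
  by rewrite muE /tau [RHS](rmorphXn (in_alg E)) [in RHS](rmorphD (in_alg E)).
rewrite (res_sum hv hred) // (reindex_inj (addIr l')) /=; apply: eq_bigr => l _.
rewrite (res_prod hv hred) => [|i _]; last exact: v_intX.
rewrite -prod_frob_expr; apply: eq_bigr => i _; rewrite (resX hv hred) //.
have it x : v_int v (teich x ^+ (p ^ i) : L) by apply: v_intX => //; apply: teich_int.
rewrite (resD hred) // !(resX hv hred); try exact: teich_int.
by rewrite !teich_red -(frobD p_prime) addrK.
Qed.

Lemma odd_digits (n : 'I_f -> nat) : odd (\sum_(i < f) n i * p ^ i) = odd (\sum_i n i).
Proof.
elim/big_ind2: _ => // [x1 x2 y1 y2 e1 e2|i _]; first by rewrite !oddD e1 e2.
by rewrite oddM oddX (p_odd p_prime p_gt2) orbT andbT.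
Qed.

Lemma rsum_even : odd rsum = false.
Proof.
apply/negbTE; rewrite -dvdn2; apply: dvdn_trans r_dvd.
by rewrite dvdn2 oddB ?expn_gt0 ?prime_gt0 // (q_odd f p_prime p_gt2).
Qed.

Lemma sum_tau_mu_odd l' (n : 'I_f -> nat) : odd (\sum_i n i) ->
  v_ge vE 1 (\sum_(l : Fq) \prod_i (tau l i + mu l' i) ^+ n i).
Proof.
move=> on; have [y [iy -> ry]] := sum_tau_mu l' n; apply/E_ge/v_max_ge1.
by apply/(res_eq0 hred) => //; rewrite ry sum_expr_odd // odd_digits.
Qed.

Lemma mu0 i : mu 0 i = 0.
Proof.
rewrite muE oppr0 (teich0 p_prime f_gt0) expr0n gtn_eqF ?expn_gt0 ?prime_gt0 //.
by rewrite scale0r.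
Qed.

Lemma binpoly_int : pint (binpoly E r).
Proof.
apply: pint_msubst => [i|]; last exact: pintX.
apply: ord2P; apply: ord2P; rewrite !mx22C; first [exact: v_int0 | exact: v_int1].
Qed.

Lemma sum_tau_mu_int l' (n : 'I_f -> nat) :
  v_int vE (\sum_(l : Fq) \prod_i (tau l i + mu l' i) ^+ n i).
Proof. by have [y [iy -> _]] := sum_tau_mu l' n; apply: E_int. Qed.

(** The total degree is even: it has the parity of rsum because p is odd, and rsum is a multiple of
    the even number q - 1. *)
Lemma mhom_odd m : mhom r m -> odd (\sum_i m (lshift f i)) = odd (\sum_i m (rshift f i)).
Proof.
move=> /mhomP hm; have := rsum_even; rewrite /rsum odd_digits.
rewrite -(eq_bigr _ (fun i _ => hm i)) big_split oddD.
by case: (odd _); case: (odd _).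
Qed.

Lemma pM_ge2 n (x : E) : (n != 0)%N -> v_int vE x -> (odd n -> v_ge vE 1 x) ->
  v_ge vE 2%:R (p%:R ^+ n * x).
Proof.
case: n => [//|[|n]] _ ix ox.
  by rewrite -[2%:R]/(1 + 1); apply: v_geM => //; [exact: p_ge1 | apply: ox].
rewrite -[n.+2]/(2 + n)%N exprD -mulrA; apply: p_pow_ge; apply: v_intM => //.
by apply: v_intX => //; exact: v_int_nat.
Qed.

(** Apart from X^r, a monomial of Y-degree at least 2 has p^2 in its coefficient; Y-degree 1 makes
    the X-degree odd, and the odd power sum supplies the second p. *)
Lemma V_lam_U l : exists2 s : E, v_ge vE 1 s &
  pge 2%:R (Vval (V_lam l U - s *: oX)).
Proof.
(* Modulo p the coefficient of X^r is -1 + 1: the power sum of exponent rsum, and the summand X^r of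
   U. *)
exists (Vval (V_lam l U))@_mX => [|m].
  rewrite V_lam_U_coef eqxx big1 ?mul1r => [|i _]; last by rewrite mXYE.
  rewrite mcoeff_binpolyX mul1r.
  have [y [iy -> ry]] := sum_tau_mu l (fun i => mX (lshift f i)).
  have -> : y%:A + 1%:R = (y + 1)%:A :> E by rewrite scalerDl scale1r.
  apply/E_ge/v_max_ge1/(res_eq0 hred); first by apply: v_intD => //; apply: v_int1.
  rewrite (resD hred) ?(res1 hred) ?v_int1 // ry.
  rewrite (eq_bigr (fun i => r i * p ^ i)%N) => [|i _]; last by rewrite mXYE.
  by rewrite sum_expr_mulq ?addNr // (rsum_gt0 p_prime f_gt0 r_ge).
have [hm|nm] := boolP (mhom r m); last first.
  by have /multihomE-> // := valP (V_lam l U - (Vval (V_lam l U))@_mX *: oX); exact: v_ge0.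
rewrite -[Vval (_ - _)]/(Vval (V_lam l U) - (Vval (V_lam l U))@_mX *: Vval oX).
rewrite mcoeffB mcoeffZ (monoE _ (mhomX r)) mcoeffX.
have [->|ne] := eqVneq mX m; first by rewrite mulr1 subrr v_ge0.
rewrite mulr0 subr0 V_lam_U_coef (negbTE ne) addr0; apply: pM_ge2.
- move: ne; rewrite eq_sym (mhom_eqX hm); apply: contraNneq => e; apply/forallP => i.
  by rewrite -leqn0 -e (bigD1 i) //= leq_addr.
- by apply: v_intM => //; [exact: binpoly_int | exact: sum_tau_mu_int].
- move=> o; apply: v_geMl => //; first exact: binpoly_int.
  by apply: sum_tau_mu_odd; rewrite mhom_odd.
Qed.

Lemma sum_tauE (n : 'I_f -> nat) : \sum_(l : Fq) \prod_i tau l i ^+ n i =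
  \sum_(l : Fq) \prod_i (tau l i + mu 0 i) ^+ n i.
Proof. by apply: eq_bigr => l _; apply: eq_bigr => i _; rewrite mu0 addr0. Qed.

(** The same parity argument with X and Y exchanged. The coefficient of Y^r is a sum of q ones,
    hence divisible by p. *)
Lemma V_inf_U : exists2 s : E, v_ge vE 1 s &
  pge 2%:R (Vval (V_inf U - s *: oY)).
Proof.
have mXl : (1 < \sum_i mX (lshift f i))%N.
  rewrite (bigD1 (Ordinal f_gt0)) //= mXYE (leq_trans (prime_gt1 p_prime)) //.
  exact: leq_trans (r_ge _) (leq_addr _ _).
exists (Vval (V_inf U))@_mY => [|m].
  rewrite V_inf_coef big1 ?mul1r => [|i _]; last by rewrite mXYE.
  rewrite U_coef; have -> : (mX == mY) = false.
    apply/eqP => e; move: mXl; rewrite e big1 // => i _; by rewrite mXYE.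
  rewrite addr0; apply: v_geMl => //; first exact: binpoly_int.
  rewrite (eq_bigr (fun=> 1)) => [|l _]; last by rewrite big1 // => i _; rewrite mXYE.
  rewrite sumr_const ur_res_card.
  have := E_ge C (v_q_ge1 f_gt0 L).
  by rewrite -[(_%:R)%:A]/(in_alg E _%:R) rmorph_nat.
have [hm|nm] := boolP (mhom r m); last first.
  by have /multihomE-> // := valP (V_inf U - (Vval (V_inf U))@_mY *: oY); exact: v_ge0.
rewrite -[Vval (_ - _)]/(Vval (V_inf U) - (Vval (V_inf U))@_mY *: Vval oY).
rewrite mcoeffB mcoeffZ (monoE _ (mhomY r)) mcoeffX.
have [->|ne] := eqVneq mY m; first by rewrite mulr1 subrr v_ge0.
rewrite mulr0 subr0 V_inf_coef; apply: pM_ge2.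
- move: ne; rewrite eq_sym (mhom_eqY hm); apply: contraNneq => e; apply/forallP => i.
  by rewrite -leqn0 -e (bigD1 i) //= leq_addr.
- rewrite U_coef sum_tauE; apply: v_intD => //; last exact: v_int_nat.
  by apply: v_intM => //; [exact: binpoly_int | exact: sum_tau_mu_int].
- move=> o; have nX : (mX == m) = false.
    apply/eqP => e; move: o; rewrite mhom_odd // -e big1 // => i _.
    by rewrite mXYE.
  rewrite U_coef nX addr0 sum_tauE; apply: v_geMl => //; first exact: binpoly_int.
  exact: sum_tau_mu_odd.
Qed.

Lemma U_null g : null (ie g (b *: U)).
Proof.
apply: hecke_null => [l h|h].
  have [s hs W] := V_lam_U l; rewrite V_lamZ -[V_lam l U](subrK (s *: oX)).
  rewrite 2![b *: (_ + _)]scalerDr ieD; apply: nullD; last exact: X_null2.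
  by apply: null_elem; exact: pge2_div.
have [s hs W] := V_inf_U; rewrite V_infZ -[V_inf U](subrK (s *: oY)).
rewrite 2![b *: (_ + _)]scalerDr ieD; apply: nullD; last exact: Y_null2.
by apply: null_elem; exact: pge2_div.
Qed.

Theorem hecke_sum_null :
  null (\sum_(l : Fq) ie (alpha l) oM + ie (beta * kap)%g oM).
Proof.
have h1 : null (\sum_(l : Fq) (b *: ie (alpha l * beta)%g oY + ie (alpha l) oM)).
  by apply: null_sum => l; exact: YM_relation.
have h2 := YM_relation (beta * kap)%g; rewrite beta_kap_beta in h2.
have := nullD (nullD h1 h2) (nullN (U_null 1%g)).
suff -> : ie 1%g (b *: U) = \sum_(l : Fq) b *: ie (alpha l * beta)%g oY + b *: ie w0 oY.
  by rewrite big_split /= addrACA [X in X - _]addrC addrK.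
rewrite ieZ /U ieD scalerDr ie_sum scaler_sumr.
congr (_ + _ *: _); last by rewrite elem_X mul1g.
by apply: eq_bigr => l _; congr (_ *: _); rewrite -ind_elem_sub mul1g.
Qed.

(** * Descent to Theta_bar *)

Notation phiV := (@phi_V p f L C r T a).

Lemma phi_V_elem (P : VE) (P' : Vk) : reds (Vval P) (Vval P') -> null (ie 1%g P) ->
  phiV P' = 0.
Proof.
move=> h hn; rewrite -[LHS]ract1 -(cls_elem T a 1%g h); apply: cls_null => //.
by apply: integral_elem; exact: reds_int h.
Qed.

Lemma theta_polyX i m : theta_poly C i * 'X_[m] =
  'X_[(m + (U_(lshift f i) + U_(rshift f (ord_pred i)) *+ p))%MM] -
  'X_[(m + (U_(rshift f i) + U_(lshift f (ord_pred i)) *+ p))%MM].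
Proof. by rewrite !mpolyXD -!mpolyXn -mulrBr mulrC. Qed.

Notation phiP := (@phi_poly p f L C r T a).

Lemma phi_thetaX i m : phiP (theta_poly C i * 'X_[m]) = 0.
Proof.
rewrite theta_polyX.
set u := (m + _)%MM; set d := (m + (U_(rshift f i) + _))%MM.
have -> : phiP ('X_[u] - 'X_[d]) =
    cls T a (ie 1%g (mono E r u)) - cls T a (ie 1%g (mono E r d)).
  rewrite -[cls T a (ie 1%g (mono E r u))]phi_polyX.
  rewrite -[cls T a (ie 1%g (mono E r d))]phi_polyX; exact: (linearB phiP).
have id' := integral_elem 1%g (pint_mono C r d).
have iN : pint (Vval (mono E r u - mono E r d)).
  by apply: pintD; [exact: pint_mono | apply: pintN; exact: pint_mono].
have -> : cls T a (ie 1%g (mono E r u)) =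
    cls T a (ie 1%g (mono E r u - mono E r d)) + cls T a (ie 1%g (mono E r d)).
  rewrite -clsD //; first by rewrite -ieD subrK.
  exact: integral_elem iN.
rewrite addrK (cls_null _ (theta_null 1%g i m)) //.
exact: integral_elem iN.
Qed.

(** No homogeneity is asked of Q, in accordance with [V_star]; by linearity Q may be taken to be a
    monomial. *)
Lemma phi_theta i Q : phiP (theta_poly C i * Q) = 0.
Proof.
have -> : theta_poly C i * Q = \sum_(m <- msupp Q) Q@_m *: (theta_poly C i * 'X_[m]).
  by rewrite {1}[Q]mpolyE mulr_sumr; apply: eq_bigr => m _; rewrite scalerAr.
elim: (msupp Q) => [|m s ih]; first by rewrite big_nil; exact: (linear0 phiP).
by rewrite big_cons phi_poly_linear phi_thetaX ih scaler0 addr0.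
Qed.

Lemma phi_star (P : Vk) : V_star P -> phiV P = 0.
Proof.
case=> Q e; rewrite /phi_V e; elim/big_rec: _ => [|i u _ ih]; first exact: (linear0 phiP).
by rewrite -[_ * _]scale1r phi_poly_linear phi_theta ih scaler0 addr0.
Qed.

Lemma phi_X : phiV (mono k r mX) = 0.
Proof.
apply: (phi_V_elem (reds_mono C r mX)); rewrite elem_X; exact: Y_null.
Qed.

Lemma phi_X_sub (P : Vk) : P \in @X_sub p f L C r -> phiV P = 0.
Proof.
move=> /asboolP h; apply: (h (fun P => phiV P = 0)) => [|c u w hu hw|_ [g [P0 [P0E ->]]]].
- exact: (linear0 phiV).
- by rewrite (phi_V_linear T a c u w) hu hw scaler0 addr0.
rewrite (phi_V_act T a g P0).
have -> : P0 = mono k r mX.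
  apply: val_inj; rewrite /= P0E (monoE _ (mhomX r)) mpolyXYE [X in _ = _ * X]big1 ?mulr1 //.
by rewrite phi_X linear0.
Qed.

Variable e : rep_hom Vk (triv_rep k (KZ L)).
Hypothesis e_Q : presents_Q e.

Lemma phi_V_ker (P : Vk) : e P = 0 -> phiV P = 0.
Proof.
case: e_Q => _ kerE /kerE[P1 [P2 [s1 s2 ->]]].
have -> : phiV (P1 + P2) = phiV P1 + phiV P2 by exact: (linearD phiV).
by rewrite phi_star // phi_X_sub // addr0.
Qed.

Lemma phi_V_eq (P Q : Vk) : e P = e Q -> phiV P = phiV Q.
Proof.
move=> ePQ; have := phi_V_ker (P := P - Q); rewrite linearB /= ePQ subrr => /(_ erefl) h.
have := linearB phiV P Q => h'; rewrite h' in h.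
by apply/eqP; rewrite -subr_eq0 h.
Qed.

Lemma phi_hecke :
  \sum_(l : Fq) ract (alpha l) (phiV (mono k r (mM p r))) +
  ract beta (phiV (mono k r (mM p r))) = 0.
Proof.
have h := reds_mono C r (mM p r); have iM := pint_mono C r (mM p r).
have iS : integral_fun (\sum_(l : Fq) ie (alpha l) oM).
  by apply: integral_sum => l; exact: integral_elem iM.
have := cls_null (integralD iS (integral_elem (beta * kap)%g iM)) hecke_sum_null.
rewrite clsD //; last exact: integral_elem iM.
rewrite cls_sum => [|l]; last exact: integral_elem iM.
rewrite (cls_elem T a (beta * kap)%g h) (eq_bigr _ (fun l _ => cls_elem T a (alpha l) h)).
rewrite ractM -[kap]/(val (KZElt kap_KZ : KZ L)) -phi_V_act.
by rewrite (@phi_V_eq (ract (KZElt kap_KZ : KZ L) (mono k r (mM p r) : Vk)) (mono k r (mM p r))) // hom_act.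
Qed.

End HeckeRelations.

(** * Factoring through the trivial weight and the cokernel of T *)

Section Factor.
Variables (R : comNzRingType) (G : groupType) (S : pred G) (H : subGroupType S).
Variables (V : rep R H) (M : rep R G) (phi : {linear V -> M}).
Hypothesis phi_act : forall (x : H) w, phi (ract x w) = ract (val x) (phi w).
Variables (e : rep_hom V (triv_rep R H)) (w1 : V).
Hypothesis e_w1 : e w1 = 1.
Hypothesis phi_eq : forall P Q : V, e P = e Q -> phi P = phi Q.

(** [phi w] depends only on [e w], hence is the multiple [e w] of [phi w1]. As [e] is invariant, H
    fixes [phi w1], and Frobenius reciprocity applies to c -> c phi(w1). *)
Lemma factor_through_triv : exists Phi : rep_hom (ind (triv_rep R H)) M,
  (forall g c, Phi (ind_elem g c) = c *: ract g (phi w1)) /\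
  forall g w, Phi (ind_map e (ind_elem g w)) = ract g (phi w).
Proof.
have [phib phibE] : exists phib : {linear triv_rep R H -> M}, forall c, phib c = c *: phi w1.
  suff /linear_exists[h hE] : linear (fun c : triv_rep R H => (c : R) *: phi w1) by exists h.
  by move=> c u v; rewrite scalerDl scalerA.
have [|Phi PhiE] := @Frobenius_reciprocity _ _ _ _ (triv_rep R H) M phib.
  move=> x c; rewrite !phibE linearZ /= -phi_act; congr (_ *: _).
  by apply: phi_eq; rewrite hom_act.
exists Phi; split=> [g c|g w]; first by rewrite PhiE phibE linearZ.
rewrite ind_map_elem PhiE phibE -linearZ; congr (ract g _).
by apply: phi_eq; rewrite linearZ e_w1 -[LHS]/(e w * 1) mulr1.
Qed.
End Factor.

Lemma ind_map_ext (R : comNzRingType) (G : groupType) (S : pred G) (H : subGroupType S)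
    (V W : rep R H) (M : rep R G) (h : rep_hom V W) (Phi : rep_hom (ind W) M)
    (pr : rep_hom (ind V) M) :
  (forall g w, Phi (ind_map h (ind_elem g w)) = pr (ind_elem g w)) ->
  forall F, Phi (ind_map h F) = pr F.
Proof.
move=> E; elim/ind_ind => [|u v hu hv|//]; first by rewrite !linear0.
by rewrite !linearD /= hu hv.
Qed.

(** By equivariance and linearity everything reduces to the relation on y. The sign is that of e (M)
    = -1: with y the class of M, the generator 1 goes to - y. *)
Lemma hecke_triv_vanish (R : comNzRingType) (G : groupType) (S : pred G)
    (H : subGroupType S) (M : rep R G) (Phi : rep_hom (ind (triv_rep R H)) M) (y : M)
    (I : finType) (alpha : I -> G) (beta : G) :
  (forall g c, Phi (ind_elem g c) = c *: ract g (- y)) ->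
  \sum_i ract (alpha i) y + ract beta y = 0 ->
  forall g c, Phi (\sum_i ind_elem (g * alpha i)%g c + ind_elem (g * beta)%g c) = 0.
Proof.
move=> PhiE y0 g c; rewrite linearD linear_sum PhiE /=.
transitivity (c *: ract g (- (\sum_i ract (alpha i) y + ract beta y))).
  rewrite opprD linearD -sumrN linear_sum scalerDr scaler_sumr /=.
  congr (_ + _); last by rewrite ractM linearN.
  by apply: eq_bigr => i _; rewrite PhiE ractM linearN.
by rewrite y0 oppr0 linear0 scaler0.
Qed.

Lemma coker_factor (R : comNzRingType) (G : groupType) (M N : rep R G)
    (t : rep_hom M M) (h : rep_hom M N) : (forall x, h (t x) = 0) ->
  exists psi : rep_hom (coker t) N, forall x, psi (coker_pi t x) = h x.
Proof.
move=> ht; have [|psi psiE] := @quot_rep_factor R G M N (image_of t) (@image_of_stable R G M M t) h.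
  by move=> _ [y ->].
by exists psi.
Qed.

Theorem theorem7p1
  (p f : nat) (p_prime : prime p) (p_gt2 : (2 < p)%N) (f_gt0 : (0 < f)%N)
  (L : unramified p f) (C : coef_field L)
  (k r : 'I_f -> nat) (kE : forall i, k i = (r i + 2)%N)
  (r_gt : forall i, (p ^ f + p - 2 < r i)%N)
  (r_mod : (\sum_(i < f) r i * p ^ i = 0 %[mod p ^ f - 1])%N)
  (ap : C) (ap_neq0 : ap != 0) (v_ap : 0 < cf_val ap < 1)
  (T : rep_hom (ind (V_E C r)) (ind (V_E C r))) (T_hecke : is_hecke_E T)
  (T1 : rep_hom (ind (triv_rep (cf_res C) (KZ L)))
                (ind (triv_rep (cf_res C) (KZ L))))
  (T1_hecke : is_hecke_triv T1) :
  exists pr : rep_hom (ind (V_k C r)) (Theta_bar T ap),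
    [/\ is_natural pr, onto pr &
    exists e : rep_hom (V_k C r) (triv_rep (cf_res C) (KZ L)),
      presents_Q e /\
      exists phi : rep_hom (ind (triv_rep (cf_res C) (KZ L))) (Theta_bar T ap),
        [/\ onto phi,
            forall F, phi (ind_map e F) = pr F,
            forall F, phi (T1 F) = 0 &
            exists psi : rep_hom (coker T1) (Theta_bar T ap),
              onto psi /\ forall F, psi (coker_pi T1 F) = phi F]].
Proof.
have r_ge i : (p <= r i)%N.
  apply: leq_trans (ltnW (r_gt i)); rewrite -addnBAC ?leq_addl //.
  exact: q_gt1.
have r_dvd : (p ^ f - 1 %| \sum_(i < f) r i * p ^ i)%N by rewrite /dvdn r_mod mod0n.
have [pr [pr_nat pr_onto prE]] := @natural_exists p f L C r T ap.
have [e [eQ eM]] := presents_Q_exists C p_prime f_gt0 r_ge r_dvd.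
exists pr; split=> //; exists e; split=> //.
pose M := mono (cf_res C) r (mM p r) : V_k C r.
have e1 : e (- M) = 1 by rewrite linearN /= eM opprK.
have phi_eq := @phi_V_eq p f p_prime p_gt2 f_gt0 L C r r_ge ap ap_neq0 v_ap T T_hecke e eQ.
have [Phi [PhiE Phie]] := @factor_through_triv _ _ _ _ (V_k C r) (Theta_bar T ap)
  (@phi_V p f L C r T ap) (@phi_V_act p f L C r T ap) e (- M) e1 phi_eq.
have Phi_pr : forall F, Phi (ind_map e F) = pr F.
  by apply: ind_map_ext => g w; rewrite Phie prE.
have Phi_onto : onto Phi.
  by move=> y; have [F <-] := pr_onto y; exists (ind_map e F); rewrite Phi_pr.
have PhiE' g c : Phi (ind_elem g c) = c *: ract g (- phi_V T ap M).
  have <- : phi_V T ap (- M) = - phi_V T ap M by exact: (linearN (@phi_V p f L C r T ap)).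
  exact: PhiE.
have PhiT F : Phi (T1 F) = 0.
  elim/ind_ind: F => [|u v hu hv|g c]; first by rewrite !linear0.
    by rewrite !linearD /= hu hv addr0.
  rewrite T1_hecke; apply: hecke_triv_vanish PhiE' _ _ _.
  exact: (phi_hecke p_prime p_gt2 f_gt0 r_ge r_dvd ap_neq0 v_ap T_hecke eQ).
exists Phi; split=> //.
have [psi psiE] := coker_factor PhiT.
exists psi; split=> // y; have [F <-] := Phi_onto y.
by exists (coker_pi T1 F).
Qed.
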